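(* Suppose the pricing kernel $S$ (as specified in the context) admits a risk-neutral factorization $S_t=e^{-\int_0^tr(X_s)ds}M_t$, where $r$ is a Borel function with $\int_0^t|r(X_s)|ds<\infty$ a.s. for each finite $t>0$ and $M$ is a positive martingale with $M_0=1$, and suppose that $S$ also admits a representation $$S_t=e^{-\lambda t}\frac{\pi(X_0)}{\pi(X_t)}M_t^\pi,\qquad M^\pi_t=e^{\lambda t}\frac{\pi(X_t)}{\pi(X_0)}S_t,$$ where $\pi$ is a strictly positive finite Borel eigenfunction, $\mathscr{P}_t\pi=e^{-\lambda t}\pi$ for all $t\ge 0$. Let $h(x)=1/\pi(x)$. Then: (1) the short rate function is recovered by $$r(x)=\lambda-\frac{\mathcal{G}^\pi h(x)}{h(x)},$$ where $\mathcal{G}^\pi$ is the extended generator of $X$ under the eigen-measure $\mathbb{Q}^\pi$ (in particular $h$ belongs to the domain of $\mathcal{G}^\pi$); (2) the transition semigroup of $X$ under the risk-neutral measure $\mathbb{Q}$ is $$Q_tf(x)=\mathbb{E}^{\mathbb Q}_x[f(X_t)]=\pi(x)\,\mathbb{E}^{\mathbb{Q}^\pi}_x\!\left[e^{\int_0^tr(X_s)ds-\lambda t}\frac{f(X_t)}{\pi(X_t)}\right];$$ (3) its extended generator is $$\mathcal{G}^Qf=\mathcal{G}^\pi f+\frac{\Gamma^\pi(h,f)}{h},$$ where $\Gamma^\pi(h,f)=\mathcal{G}^\pi(fh)-f\,\mathcal{G}^\pi h-h\,\mathcal{G}^\pi f$ is the carré du champ operator of $X$ under $\mathbb{Q}^\pi$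 (for functions $f$ for which these expressions are defined).
   Context: $E$ is a Lusin space (homeomorphic to a Borel subset of a compact metric space) with Borel sigma-field. $X=(\Omega,\mathscr{F},(\mathscr{F}_t)_{t\ge0},(X_t)_{t\ge0},(\mathbb{P}_x)_{x\in E})$ is a conservative Borel right process on $E$ (time-homogeneous strong Markov process with right-continuous paths, shift operators $\theta_t$, Borel transition function, $\mathbb{P}_x(X_0=x)=1$, $\mathbb{P}_x(X_t\in E)=1$), $(\mathscr{F}_t)$ being its minimum augmented admissible filtration. ''Semimartingale'', ''(local) martingale'', ''a.s.'' mean under $\mathbb{P}_x$ for every $x\in E$. The pricing kernel $S$ is a strictly positive semimartingale with $S_0=1$, $S_->0$, $S_{t+s}(\omega)=S_t(\omega)S_s(\theta_t\omega)$ and $\mathbb{E}^{\mathbb P}_x[S_t]<\infty$ for all $t>0,x\in E$; the pricing operators are $\mathscr{P}_tf(x)=\mathbb{E}^{\mathbb P}_x[S_tf(X_t)]$. The risk-neutral measure $\mathbb{Q}$ and the eigen-measure $\mathbb{Q}^\pi$ are defined by $\mathbb{Q}_x|_{\mathscr{F}_t}=M_t\,\mathbb{P}_x|_{\mathscr{F}_t}$ and $\mathbb{Q}^\pi_x|_{\mathscr{F}_t}=M^\pi_t\,\mathbb{P}_x|_{\mathscr{F}_t}$ for all $x\in E$, $t\ge0$. Extended generator: a pair of Borel functions $g,f$ on $E$ with $\int_0^t|f(X_s)|ds<\infty$ a.s. for all $t>0$ belongs to the extended generator $\mathcal{G}$ of $X$ (under a given family of laws) if $g(X_t)-\int_0^tf(X_s)ds$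 is a local martingale under that family; one then writes $f=\mathcal{G}g$ (such $f$ is determined only up to sets on which $X$ spends zero time, and identities involving $\mathcal{G}$ are understood accordingly). *)

(* Defs.v *)
From HB Require Import structures.
From mathcomp Require Import all_boot all_order all_algebra.
From mathcomp Require Import all_classical all_reals all_analysis.
From mathcomp Require Import measurable_realfun.

Set Implicit Arguments.
Unset Strict Implicit.
Unset Printing Implicit Defensive.

Import Order.TTheory GRing.Theory Num.Theory.
Import numFieldNormedType.Exports.

Local Open Scope classical_set_scope.
Local Open Scope ring_scope.

(* Time is indexed by R; everything is only constrained at times t >= 0. *)

Notation borel E := (g_sigma_algebraType (@open E)).

Definition lusin_space (R : realType) (E : topologicalType) : Prop :=
  exists (K : metricType R) (j : E -> K),
    [/\ compact [set: K],
        injective j,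
        <<s (@open K) >> (range j) &
        forall U : set E,
          open U <-> exists2 V : set K, open V & U = j @^-1` V].

Section filtration.
Context {R : realType} {E : ptopologicalType} {d : measure_display}
  {Omega : measurableType d}.
Variables (X : R -> Omega -> E) (P : E -> probability Omega R).

Definition raw_filtration (t : R) : set (set Omega) :=
  <<s [set A | exists (s : R) (B : set (borel E)),
        [/\ 0 <= s <= t, measurable B & A = X s @^-1` B]] >>.

Definition raw_sigma_field : set (set Omega) :=
  <<s [set A | exists (s : R) (B : set (borel E)),
        [/\ 0 <= s, measurable B & A = X s @^-1` B]] >>.

(* Intersection over all initial laws mu of the sigma-fields generated by G and
   the P_mu-null sets, where P_mu(C) = \int P_x(C) mu(dx). *)
Definition augmented (G : set (set Omega)) : set (set Omega) :=
  [set A | forall mu : probability (borel E) R, exists B C,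
    [/\ G B, raw_sigma_field C, (\int[mu]_x (P x C) = 0)%E &
        (A `\` B) `|` (B `\` A) `<=` C]].

Definition aug_filtration (t : R) : set (set Omega) :=
  augmented (raw_filtration t).

End filtration.

(* Conservativeness is built in: paths take values in E at all times.
   [brp_strong_markov] is stated for the right-limits of the filtration,
   i.e. for times T with {T < t} in F_t and events A with A /\ {T < t} in F_t;
   in particular it yields the right-continuity of the filtration. *)
Record borel_right_process (R : realType) (E : ptopologicalType)
    (d : measure_display) (Omega : measurableType d) := BorelRightProcess {
  path :> R -> Omega -> E ;
  shift : R -> Omega -> Omega ;
  law : E -> probability Omega R ;
  brp_sigma_field : forall A : set Omega,
    measurable A <-> augmented path law (raw_sigma_field path) A ;
  brp_right_continuous : forall w (t : R), 0 <= t ->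
    path s w @[s --> t^'+] --> path t w ;
  brp_shift : forall (s t : R) w, 0 <= s -> 0 <= t ->
    path s (shift t w) = path (t + s) w ;
  brp_transition : forall (t : R) (B : set (borel E)),
    0 <= t -> measurable B ->
    measurable_fun [set: borel E]
      (fun x => law x (path t @^-1` B)) ;
  brp_normal : forall x, law x [set w | path 0 w = x] = 1%E ;
  brp_strong_markov : forall (T : Omega -> \bar R) (A : set Omega),
    (forall w, 0 <= T w)%E ->
    (forall t : R, 0 <= t ->
      aug_filtration path law t [set w | (T w < t%:E)%E]) ->
    (forall t : R, 0 <= t ->
      aug_filtration path law t (A `&` [set w | (T w < t%:E)%E])) ->
    forall x (t : R) (B : set (borel E)), 0 <= t -> measurable B ->
    law x (A `&` [set w | (T w < +oo)%E]
             `&` [set w | B (path (fine (T w) + t) w)]) =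
    (\int[law x]_(w in A `&` [set w | (T w < +oo)%E])
       law (path (fine (T w)) w) (path t @^-1` B))%E
}.

(* A family (Q_x) of laws given through its restrictions to the F_t: Q t x
   stands for the restriction of Q_x to F_t, and only its values on F_t are ever
   used.  A single measure on the whole sigma-field is the case of a family
   constant in t.  The horizon is needed because F_0 contains all the null sets
   of the whole sigma-field: a single measure with density M_t on each F_t would
   have to be absolutely continuous at infinity. *)
Definition laws (R : realType) (E : Type) (d : measure_display)
    (Omega : measurableType d) : Type :=
  R -> E -> probability Omega R.

Section stochastic_calculus.
Context {R : realType} {E : ptopologicalType} {d : measure_display}
  {Omega : measurableType d}.
Variable X : borel_right_process R E Omega.

Definition F_ (t : R) : set (set Omega) := aug_filtration X (law X) t.

Definition adapted (Y : R -> Omega -> R) : Prop :=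
  forall (t : R) (B : set R), 0 <= t -> measurable B -> F_ t (Y t @^-1` B).

Definition stopping_time (T : Omega -> \bar R) : Prop :=
  (forall w, 0 <= T w)%E /\
  (forall t : R, 0 <= t -> F_ t [set w | (T w <= t%:E)%E]).

Definition stopped (Y : R -> Omega -> R) (T : Omega -> \bar R) :
    R -> Omega -> R :=
  fun t w => Y (fine (Order.min t%:E (T w))) w.

Definition law_P : laws R E Omega := fun _ => law X.

(* Q_x | F_t = M_t P_x | F_t for every t; the second clause says that the
   Q t x are the restrictions of one set function on the union of the F_t. *)
Definition has_density (Q : laws R E Omega) (M : R -> Omega -> R) : Prop :=
  (forall (t : R) x (A : set Omega), 0 <= t -> F_ t A ->
    Q t x A = (\int[law X x]_(w in A) (M t w)%:E)%E) /\
  (forall (s t : R) x (A : set Omega), 0 <= s <= t -> F_ s A ->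
    Q t x A = Q s x A).

(* Q_x-almost surely, for a property of the path up to time t *)
Definition as_upto (Q : laws R E Omega) (t : R) (x : E)
    (p : Omega -> Prop) : Prop :=
  exists N : set Omega,
    [/\ F_ t N, Q t x N = 0%E & forall w, ~ N w -> p w].

Definition cadlag_upto (t : R) (u : R -> R) : Prop :=
  (forall s : R, 0 <= s < t -> u v @[v --> s^'+] --> u s) /\
  (forall s : R, 0 < s <= t -> cvg (u v @[v --> s^'-])).

Definition cadlag (Q : laws R E Omega) (x : E) (Y : R -> Omega -> R) : Prop :=
  forall t : R, 0 <= t -> as_upto Q t x (fun w => cadlag_upto t (Y ^~ w)).

Definition martingale (Q : laws R E Omega) (x : E)
    (Y : R -> Omega -> R) : Prop :=
  [/\ adapted Y,
      cadlag Q x Y,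
      forall t : R, 0 <= t -> (Q t x).-integrable setT (EFin \o Y t) &
      forall (s t : R) (A : set Omega), 0 <= s <= t -> F_ s A ->
        (\int[Q t x]_(w in A) (Y t w)%:E = \int[Q s x]_(w in A) (Y s w)%:E)%E].

Definition local_martingale (Q : laws R E Omega) (x : E)
    (Y : R -> Omega -> R) : Prop :=
  [/\ adapted Y,
      cadlag Q x Y &
      exists T : nat -> Omega -> \bar R,
        [/\ forall n, stopping_time (T n),
            forall n w, (T n w <= T n.+1 w)%E,
            forall t : R, 0 <= t ->
              as_upto Q t x (fun w => exists n, (t%:E <= T n w)%E) &
            forall n, martingale Q x (stopped Y (T n))]].

Definition finite_variation (Q : laws R E Omega) (x : E)
    (A : R -> Omega -> R) : Prop :=
  [/\ adapted A, cadlag Q x A &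
      forall t : R, 0 <= t ->
        as_upto Q t x (fun w => bounded_variation 0 t (A ^~ w))].

Definition semimartingale (Q : laws R E Omega) (S : R -> Omega -> R) : Prop :=
  adapted S /\
  forall x, exists L A : R -> Omega -> R,
    [/\ local_martingale Q x L,
        finite_variation Q x A &
        forall t : R, 0 <= t ->
          as_upto Q t x (fun w =>
            forall s : R, 0 <= s <= t -> S s w = S 0 w + L s w + A s w)].

Definition time_integral (f : E -> R) (t : R) (w : Omega) : R :=
  \int[lebesgue_measure]_(s in `[0, t]) f (X s w).

Definition time_integrable (Q : laws R E Omega) (f : E -> R) : Prop :=
  forall x (t : R), 0 < t -> as_upto Q t x (fun w =>
    (\int[lebesgue_measure]_(s in `[0%R, t]) `|f (X s w)|%:E < +oo)%E).

(* the pair (g, f) belongs to the extended generator under Q: f = G g *)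
Definition extended_generator (Q : laws R E Omega) (g f : E -> R) : Prop :=
  [/\ measurable_fun [set: borel E] g,
      measurable_fun [set: borel E] f,
      time_integrable Q f &
      forall x,
        local_martingale Q x (fun t w => g (X t w) - time_integral f t w)].

(* f and g agree except on a set on which X spends zero time *)
Definition eq_off_zero_time (Q : laws R E Omega) (f g : E -> R) : Prop :=
  forall x (t : R), 0 <= t -> as_upto Q t x (fun w =>
    {ae (@lebesgue_measure R),
       forall s : R, 0 <= s <= t -> f (X s w) = g (X s w)}).

Definition pricing_kernel (S : R -> Omega -> R) : Prop :=
  [/\ semimartingale law_P S,
      forall x, {ae law X x, forall w,
        [/\ S 0 w = 1,
            forall t : R, 0 <= t -> 0 < S t w &
            forall t : R, 0 < t ->
              exists2 l : R, 0 < l & S s w @[s --> t^'-] --> l]},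
      forall x (s t : R), 0 <= s -> 0 <= t ->
        {ae law X x, forall w, S (t + s) w = S t w * S s (shift X t w)} &
      forall x (t : R), 0 < t -> (\int[law X x]_w (S t w)%:E < +oo)%E].

Definition pricing_operator (S : R -> Omega -> R) (t : R) (f : E -> R)
    (x : E) : \bar R :=
  (\int[law X x]_w (S t w * f (X t w))%:E)%E.

Definition positive_eigenfunction (S : R -> Omega -> R) (lambda : R)
    (pi : E -> R) : Prop :=
  [/\ measurable_fun [set: borel E] pi,
      forall x, 0 < pi x &
      forall (t : R) x, 0 <= t ->
        pricing_operator S t pi x = (expR (- lambda * t) * pi x)%:E].

(* M^pi, so that S_t = exp (- lambda t) pi(X_0) / pi(X_t) M^pi_t *)
Definition eigen_density (S : R -> Omega -> R) (lambda : R) (pi : E -> R) :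
    R -> Omega -> R :=
  fun t w => expR (lambda * t) * (pi (X t w) / pi (X 0 w)) * S t w.

Definition risk_neutral_factorization (S : R -> Omega -> R) (r : E -> R)
    (M : R -> Omega -> R) : Prop :=
  [/\ measurable_fun [set: borel E] r,
      time_integrable law_P r,
      forall x, martingale law_P x M,
      forall x, {ae law X x, forall w,
        M 0 w = 1 /\ forall t : R, 0 <= t -> 0 < M t w} &
      forall x (t : R), 0 <= t -> {ae law X x, forall w,
        S t w = expR (- time_integral r t w) * M t w}].

(* Q_t f (x) = E^Q_x [f (X_t)] *)
Definition transition_operator (Q : laws R E Omega) (t : R) (f : E -> R)
    (x : E) : \bar R :=
  (\int[Q t x]_w (f (X t w))%:E)%E.

End stochastic_calculus.

(* Carre du champ h, f |-> G(fh) - f Gh - h Gf, from given versions gh, gf, gfh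
   of Gh, Gf, G(fh). *)
Definition carre_du_champ (R : realType) (E : Type) (h f gh gf gfh : E -> R) :
    E -> R :=
  fun x => gfh x - f x * gh x - h x * gf x.

(* Main.v *)
(** Under P_x the densities of Q and of Q^pi are positive, so that all the laws
    have the same null sets on each F_t, and
    dQ / dQ^pi = exp (\int_0^t r (X_s) ds - lambda t) h (X_t) / h (x) on F_t, which
    is (2).  Statements (1) and (3) come from one Girsanov lemma: if
    dL1 / dL2 = exp (\int_0^t a (X_s) ds) kappa (X_t) / kappa (x) on F_t and
    u (X_t) - \int_0^t g (X_s) ds is an L1-local martingale, then
    (kappa u) (X_t) - \int_0^t kappa (g - a u) (X_s) ds is an L2-local martingale.
    As exp (- \int a) and \int g are absolutely continuous in time, its proof only
    needs the rule that N B - \int N dB is a martingale when N is one, applied up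
    to the times at which \int (|a| + |g|) (X_s) ds reaches n.
    For (1) take L1 = Q, L2 = Q^pi, kappa = h, a = r - lambda, u = 1, g = 0; for
    (3) take L1 = Q^pi, L2 = Q, kappa = pi, a = lambda - r, u = f h, g = G^pi (f h).
    Two versions of G^pi h differ by the density c of a local martingale \int c,
    which has to vanish. *)

(* The obstacle is that neither kappa nor u need be bounded. In the Girsanov lemma kappa therefore
   stays inside the density th = dL1 / dL2. If N is the given L1-local martingale stopped at rho,
   then th and th N are true L2-martingales up to a fixed time. They are integrated by parts only
   against exp (- \int a) and its product with \int g, whose variation is bounded since rho stops
   the clock of |a| + |g|. The resulting V agrees with (kappa u (X) - \int q (X)) / k0, for k0 =
   kappa x, only up to rho, so it is stopped at rho once more. The identity is pathwise and needs
   kappa (X) and u (X) bounded along the path, which cadlag paths ensure. Hence both pi (X) and h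
   (X) must be shown cadlag. The first is, up to elementary factors, the quotient of W = M^pi by S,
   and S_- > 0 is given. The second is the inverse quotient and needs W_- > 0. This comes from a
   maximal inequality Q^pi (inf W < c) <= c on grids of times, together with the equivalence of Q^pi
   and P on each F_t. No stochastic integral and no conditional expectation is built. Fubini in time
   and integrals over events of F_s take their place. *)
Require Import Defs.
From HB Require Import structures.
From mathcomp Require Import all_boot all_order all_algebra.
From mathcomp Require Import all_classical all_reals all_analysis.
From mathcomp Require Import measurable_realfun ring lra.

Set Implicit Arguments.
Unset Strict Implicit.
Unset Printing Implicit Defensive.

Import Order.TTheory GRing.Theory Num.Theory.
Import numFieldNormedType.Exports.

Local Open Scope classical_set_scope.
Local Open Scope ring_scope.

(** * Sub-sigma-fields *)

Import HBNNSimple.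

Section sub_sigma.
Context {d : measure_display} {Omega : measurableType d} {R : realType}.
Variable G : set (set Omega).
Hypothesis Gsig : sigma_algebra setT G.
Hypothesis Gmeas : forall A, G A -> measurable A.

(** Omega with G as its sigma-field: measurability with respect to G becomes ordinary
    [measurable_fun] on this type, while measures stay on the full sigma-field. *)
Local Notation OmegaG := (g_sigma_algebraType G).

Lemma sub_sigmaE (A : set Omega) :
  measurable (A : set OmegaG) <-> G A.
Proof.
rewrite /measurable /=; split => [|]; last exact: sub_sigma_algebra.
by apply; split => //.
Qed.

Lemma sub_sigma_fun d' (T : measurableType d') (f : Omega -> T) :
  measurable_fun [set: OmegaG] f -> measurable_fun [set: Omega] f.
Proof.
move=> mf _ B mB; apply: Gmeas; apply/sub_sigmaE.
exact: (mf measurableT).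
Qed.

Local Open Scope ereal_scope.

Let indic_int (m : measure Omega R) (p : Omega -> R) (A : set Omega) :
  \int[m]_(x in A) (p x)%:E = \int[m]_x ((\1_A x)%:E * (p x)%:E).
Proof.
rewrite [LHS]integral_mkcond; apply: eq_integral => x _.
by rewrite epatch_indic muleC.
Qed.

(** Only integrals of the weight over sets of G remain on the right, and those are what the next
    lemma can compare. *)
Lemma nnsfun_weighted_integral (m : measure Omega R) (p : Omega -> R)
    (f : {nnsfun OmegaG >-> R}) :
  measurable_fun setT p -> (forall x, 0 <= p x)%R ->
  \int[m]_x ((f x)%:E * (p x)%:E) =
  \sum_(y \in range f) y%:E * \int[m]_(x in f @^-1` [set y]) (p x)%:E.
Proof.
move=> mp p0.
have mA (y : R) : measurable (f @^-1` [set y] : set Omega).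
  by apply: Gmeas; apply/sub_sigmaE; exact: measurable_sfunP.
have mpE : measurable_fun setT (EFin \o p) by exact/measurable_EFinP.
have m1p (y : R) : measurable_fun setT
    (fun x : Omega => (\1_(f @^-1` [set y] : set Omega) x)%:E * (p x)%:E).
  by apply: emeasurable_funM => //; exact/measurable_EFinP/measurable_indic.
transitivity (\int[m]_x (\sum_(y \in range f)
   (y%:E * ((\1_(f @^-1` [set y]) x)%:E * (p x)%:E)))).
  apply: eq_integral => x _; rewrite fimfunE -fsumEFin; last exact: fimfunP.
  rewrite ge0_mule_fsuml; last first.
    move=> y; rewrite lee_fin indicE; case: (boolP (_ \in _)) => [|_].
      by rewrite inE => /= <-; rewrite mulr1.
    by rewrite mulr0.
  by apply: eq_fsbigr => y _; rewrite EFinM muleA.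
rewrite ge0_integral_fsum//; last 2 first.
- by move=> y; exact: emeasurable_funM.
- move=> y x _; rewrite indicE; case: (boolP (_ \in _)) => [|_]; last first.
    by rewrite mul0e mule0.
  by rewrite inE => /= <-; rewrite -!EFinM lee_fin !mulr_ge0.
apply: eq_fsbigr => y; rewrite inE => -[x _ <-].
rewrite ge0_integralZl//; last 2 first.
- by move=> z _; rewrite -EFinM lee_fin mulr_ge0.
- by rewrite lee_fin.
by rewrite indic_int.
Qed.

(** Stands in for an inequality between conditional expectations given G. It passes from sets of G
    to simple functions, and then to [xi] by monotone convergence. Two measures are allowed because
    a change of law is also an instance. *)
Lemma weighted_integral_le (m1 m2 : measure Omega R) (p q : Omega -> R) :
  measurable_fun setT p -> (forall x, 0 <= p x)%R ->
  measurable_fun setT q -> (forall x, 0 <= q x)%R ->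
  (forall A, G A ->
    \int[m1]_(x in A) (p x)%:E <= \int[m2]_(x in A) (q x)%:E) ->
  forall xi : Omega -> \bar R, measurable_fun [set: OmegaG] xi ->
  (forall x, 0 <= xi x) ->
  \int[m1]_x (xi x * (p x)%:E) <= \int[m2]_x (xi x * (q x)%:E).
Proof.
move=> mp p0 mq q0 pq xi mxi xi0.
pose f := @nnsfun_approx _ OmegaG R _ (@measurableT _ OmegaG) xi mxi.
have mf n : measurable_fun [set: Omega] (fun x => (f n x)%:E).
  by apply/measurable_EFinP/sub_sigma_fun.
have key (m : measure Omega R) (r : Omega -> R) :
    measurable_fun setT r -> (forall x, 0 <= r x)%R ->
    \int[m]_x ((f n x)%:E * (r x)%:E) @[n --> \oo] -->
    \int[m]_x (xi x * (r x)%:E).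
  move=> mr r0.
  have -> : \int[m]_x (xi x * (r x)%:E) =
      \int[m]_x (limn ((fun x n => (f n x)%:E * (r x)%:E) x)).
    apply: eq_integral => x _; apply/esym/cvg_lim => //.
    by apply: cvgeZr => //; apply: cvg_nnsfun_approx.
  apply: (@cvg_monotone_convergence _ _ _ m setT measurableT
    (fun n x => (f n x)%:E * (r x)%:E)).
  - by move=> n; apply: emeasurable_funM => //; exact/measurable_EFinP.
  - by move=> n x _; rewrite mule_ge0 ?lee_fin.
  - move=> x _ a b ab; rewrite lee_pmul ?lee_fin//.
    by have /lefP := @nd_nnsfun_approx _ OmegaG R _ measurableT xi mxi _ _ ab; exact.
apply: (lee_cvg_to (key m1 p mp p0) (key m2 q mq q0)).
near=> n; rewrite !nnsfun_weighted_integral//.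
apply: lee_fsum => // y [x _ <-]; rewrite lee_wpmul2l ?lee_fin//.
apply: pq; apply/sub_sigmaE; exact: measurable_sfunP.
Unshelve. all: by end_near. Qed.

Lemma weighted_integral_eq (m1 m2 : measure Omega R) (p q : Omega -> R) :
  measurable_fun setT p -> (forall x, 0 <= p x)%R ->
  measurable_fun setT q -> (forall x, 0 <= q x)%R ->
  (forall A, G A ->
    \int[m1]_(x in A) (p x)%:E = \int[m2]_(x in A) (q x)%:E) ->
  forall xi : Omega -> \bar R, measurable_fun [set: OmegaG] xi ->
  (forall x, 0 <= xi x) ->
  \int[m1]_x (xi x * (p x)%:E) = \int[m2]_x (xi x * (q x)%:E).
Proof.
move=> mp p0 mq q0 pq xi mxi xi0; apply/eqP; rewrite eq_le.
by apply/andP; split; apply: weighted_integral_le => // A /pq ->.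
Qed.

End sub_sigma.

(** * Closure properties of a sigma-field *)

Section sigma_algebra_closure.
Context {T : Type} (G : set (set T)).
Hypothesis Gs : sigma_algebra setT G.

Lemma sigma_set0 : G set0.
Proof. by case: Gs. Qed.

Lemma sigma_setC A : G A -> G (~` A).
Proof. by move=> GA; rewrite -setTD; case: Gs => _ + _; exact. Qed.

Lemma sigma_setT : G setT.
Proof. by rewrite -setC0; exact: sigma_setC sigma_set0. Qed.

Lemma sigma_bigcup (A : nat -> set T) : (forall n, G (A n)) ->
  G (\bigcup_n A n).
Proof. by case: Gs => _ _; exact. Qed.

Lemma sigma_bigcap (A : nat -> set T) : (forall n, G (A n)) ->
  G (\bigcap_n A n).
Proof.
move=> GA; rewrite -[X in G X]setCK setC_bigcap; apply: sigma_setC.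
by apply: sigma_bigcup => n; exact: sigma_setC.
Qed.

Lemma sigma_setU A B : G A -> G B -> G (A `|` B).
Proof.
move=> GA GB; rewrite -bigcup2E; apply: sigma_bigcup => -[|[|n]] //=.
exact: sigma_set0.
Qed.

Lemma sigma_setI A B : G A -> G B -> G (A `&` B).
Proof.
move=> GA GB; rewrite -[X in G X]setCK setCI; apply: sigma_setC.
by apply: sigma_setU; exact: sigma_setC.
Qed.

Lemma sigma_setD A B : G A -> G B -> G (A `\` B).
Proof. by move=> GA GB; apply: sigma_setI => //; exact: sigma_setC. Qed.

End sigma_algebra_closure.

(** * The Markov property and the augmented filtration *)

Section markov.
Context {R : realType} {E : ptopologicalType} {d : measure_display}
  {Omega : measurableType d}.
Variable X : borel_right_process R E Omega.

Lemma raw_filtration_sigma (t : R) : sigma_algebra setT (raw_filtration X t).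
Proof. exact: smallest_sigma_algebra. Qed.

Lemma raw_filtrationS (s t : R) : s <= t ->
  raw_filtration X s `<=` raw_filtration X t.
Proof.
move=> st; apply: sub_sigma_algebra2 => A [u [B [/andP[u0 us] mB ->]]].
by exists u, B; split => //; rewrite u0 (le_trans us).
Qed.

Lemma raw_filtration_raw (t : R) : raw_filtration X t `<=` raw_sigma_field X.
Proof.
apply: sub_sigma_algebra2 => A [u [B [/andP[u0 us] mB ->]]].
by exists u, B; split.
Qed.

Lemma augmented_sub (G : set (set Omega)) : sigma_algebra setT G ->
  G `<=` augmented X (law X) G.
Proof.
move=> Gs A GA mu; exists A, set0; split => //.
- by have [] := smallest_sigma_algebra setT [set A | exists (s : R) (B : set (borel E)),
        [/\ 0 <= s, measurable B & A = X s @^-1` B]].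
- by rewrite integral0_eq// => x _; rewrite measure0.
- by rewrite setDv setU0.
Qed.

Lemma raw_measurable (A : set Omega) : raw_sigma_field X A -> measurable A.
Proof.
move=> rA; apply/(brp_sigma_field X); apply: augmented_sub => //.
exact: smallest_sigma_algebra.
Qed.

Lemma measurable_path (t : R) : 0 <= t ->
  measurable_fun setT (X t : Omega -> borel E).
Proof.
move=> t0 _ B mB; rewrite setTI; apply: raw_measurable.
by apply: sub_sigma_algebra; exists t, B; split.
Qed.

Local Open Scope ereal_scope.

(** The strong Markov property at the constant time s: the events {s < u} are trivial, and A lies in
    F_u as soon as s < u. *)
Lemma markov_set x (s t : R) (A : set Omega) (B : set (borel E)) :
  (0 <= s)%R -> (0 <= t)%R -> raw_filtration X s A -> measurable B ->
  law X x (A `&` [set w | B (X (s + t)%R w)]) =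
  \int[law X x]_(w in A) law X (X s w) (X t @^-1` B).
Proof.
move=> s0 t0 rA mB.
have raw0 u : raw_filtration X u set0 by have [] := raw_filtration_sigma u.
have rawT u : raw_filtration X u setT.
  by have [h0 hD _] := raw_filtration_sigma u; have := hD _ h0; rewrite setD0.
have := @brp_strong_markov _ _ _ _ X (fun=> s%:E) A _ _ _ x t B t0 mB.
have AE : A `&` [set w : Omega | s%:E < +oo] = A.
  by apply/seteqP; split => [w []//|w Aw]; split => //=; rewrite ltry.
rewrite AE /=; apply => //.
- move=> u u0; apply: augmented_sub; first exact: raw_filtration_sigma.
  rewrite lte_fin; case: (ltP s u) => _.
    by rewrite (_ : [set _ | _] = setT)//; apply/seteqP; split.
  by rewrite (_ : [set _ | _] = set0)//; apply/seteqP; split.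
- move=> u u0; apply: augmented_sub; first exact: raw_filtration_sigma.
  rewrite lte_fin; case: (ltP s u) => su.
    rewrite (_ : _ `&` _ = A); first exact: raw_filtrationS (ltW su) _ rA.
    by apply/seteqP; split => [w []//|w Aw]; split.
  by rewrite (_ : _ `&` _ = set0)//; apply/seteqP; split => // w [].
Qed.

Lemma measurable_transition (t : R) (psi : borel E -> \bar R) : (0 <= t)%R ->
  measurable_fun setT psi -> (forall y, 0 <= psi y) ->
  measurable_fun [set: borel E] (fun x => \int[law X x]_w psi (X t w)).
Proof.
move=> t0 mpsi psi0.
(* Seen as an integral against the image law of [X t], this is an integral against the transition
   kernel, whose measurability is [brp_transition]. *)
rewrite (_ : (fun x => _) =
   (fun x => \int[pushforward (law X x) (X t : Omega -> borel E)]_y psi y)).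
  apply: measurable_fun_integral_kernel => //.
    by move=> _; exact: measurable_path.
  by move=> mX B mB; exact: brp_transition.
apply/funext => x; rewrite ge0_integral_pushforward//.
exact: measurable_path.
Qed.


Let nnsfun_proc (m : measure Omega R) (A : set Omega) (u : R)
    (f : {nnsfun (borel E) >-> R}) : (0 <= u)%R -> measurable A ->
  \int[m]_(w in A) (f (X u w))%:E =
  \sum_(y \in range f) y%:E * m (A `&` X u @^-1` (f @^-1` [set y])).
Proof.
move=> u0 mA.
have mB (y : R) : measurable (X u @^-1` (f @^-1` [set y]) : set Omega).
  by rewrite -[X in measurable X]setTI; apply: (measurable_path u0) => //;
    exact: measurable_sfunP.
transitivity (\int[m]_(w in A) (\sum_(y \in range f)
   (y%:E * (\1_(X u @^-1` (f @^-1` [set y]) : set Omega) w)%:E))).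
  apply: eq_integral => w _; rewrite fimfunE -fsumEFin; last exact: fimfunP.
  by apply: eq_fsbigr => y _; rewrite EFinM.
have mi (y : R) : measurable_fun A
    (EFin \o (\1_(X u @^-1` (f @^-1` [set y])) : Omega -> R)).
  exact/measurable_EFinP/measurable_indic.
rewrite ge0_integral_fsum//; last 2 first.
- by move=> y; apply: emeasurable_funM => //; exact: mi.
- move=> y w _; rewrite indicE; case: (boolP (_ \in _)) => [|_]; last first.
    by rewrite mule0.
  by rewrite inE => /= <-; rewrite mule1 lee_fin.
apply: eq_fsbigr => y; rewrite inE => -[x _ <-].
rewrite ge0_integralZl//; [|exact: mi|by rewrite lee_fin].
by rewrite integral_indic// setIC.
Qed.

Lemma markov_fun x (s t : R) (A : set Omega) (psi : borel E -> \bar R) :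
  (0 <= s)%R -> (0 <= t)%R -> raw_filtration X s A ->
  measurable_fun setT psi -> (forall y, 0 <= psi y) ->
  \int[law X x]_(w in A) psi (X (s + t)%R w) =
  \int[law X x]_(w in A) \int[law X (X s w)]_v psi (X t v).
Proof.
move=> s0 t0 rA mpsi psi0.
have mA : measurable A by apply: raw_measurable; exact: raw_filtration_raw rA.
have st0 : (0 <= s + t)%R by exact: addr_ge0.
have mXs := measurable_path s0; have mXt := measurable_path t0.
have mXst := measurable_path st0.
pose f := nnsfun_approx measurableT mpsi.
have fpsi y : (f n y)%:E @[n --> \oo] --> psi y by exact: cvg_nnsfun_approx.
have ndf y : {homo (fun n => (f n y)%:E) : a b / (a <= b)%N >-> a <= b}.
  by move=> a b ab; have /lefP := nd_nnsfun_approx measurableT mpsi ab; exact.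
have mfXu n u : (0 <= u)%R -> measurable_fun setT (fun w => f n (X u w)).
  move=> u0; exact: (measurableT_comp (measurable_funP (f n)) (measurable_path u0)).
have cvg_proc (m : measure Omega R) (D : set Omega) u : measurable D ->
    (0 <= u)%R ->
    \int[m]_(w in D) (f n (X u w))%:E @[n --> \oo] -->
    \int[m]_(w in D) psi (X u w).
  move=> mD u0; have -> : \int[m]_(w in D) psi (X u w) =
      \int[m]_(w in D) (limn ((fun w n => (f n (X u w))%:E) w)).
    by apply: eq_integral => w _; apply/esym/cvg_lim => //; exact: fpsi.
  apply: (@cvg_monotone_convergence _ _ _ m D mD
    (fun n w => (f n (X u w))%:E)).
  - move=> n; apply: measurable_funTS; apply/measurable_EFinP.
    exact: mfXu.
  - by move=> n w _; rewrite lee_fin.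
  - by move=> w _; exact: ndf.
have mfX n : measurable_fun setT
   (fun w => \int[law X (X s w)]_v (f n (X t v))%:E).
  have hP : measurable_fun [set: borel E]
      (fun y => \int[law X y]_v (f n (X t v))%:E).
    apply: (@measurable_transition t (EFin \o f n)) => //.
      exact/measurable_EFinP/measurable_funP.
    by move=> y; rewrite /= lee_fin.
  exact: (measurableT_comp hP mXs).
have mlaw n y : measurable_fun setT
   (fun w => law X (X s w) (X t @^-1` (f n @^-1` [set y]))).
  exact: (measurableT_comp (brp_transition X t0
    (measurable_sfunP (f n) (measurable_set1 y))) mXs).
have step n : \int[law X x]_(w in A) (f n (X (s + t)%R w))%:E =
    \int[law X x]_(w in A) \int[law X (X s w)]_v (f n (X t v))%:E.
  rewrite nnsfun_proc//.
  under [RHS]eq_integral do rewrite nnsfun_proc//.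
  rewrite ge0_integral_fsum//; last 2 first.
  - move=> y; apply: measurable_funTS; apply: emeasurable_funM => //.
    by under eq_fun do rewrite setTI; exact: mlaw.
  - move=> y w _; have [y0|y0] := leP 0%R y.
      by rewrite mule_ge0// lee_fin.
    rewrite (_ : f n @^-1` [set y] = set0) ?preimage_set0 ?setI0 ?measure0 ?mule0//.
    by apply/seteqP; split => // z /= fy; move: y0; rewrite -fy ltNge (fun_ge0).
  apply: eq_fsbigr => y; rewrite inE => -[z _ <-].
  rewrite ge0_integralZl//; last 2 first.
  - by under eq_fun do rewrite setTI; apply: measurable_funTS; exact: mlaw.
  - by rewrite lee_fin.
  congr (_ * _); under [RHS]eq_integral do rewrite setTI.
  by rewrite -markov_set//; exact: measurable_sfunP.
have := cvg_proc (law X x) _ _ mA st0.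
rewrite (funext step) => cvf; apply: (cvg_unique _ cvf) => //.
have -> : \int[law X x]_(w in A) \int[law X (X s w)]_v psi (X t v) =
  \int[law X x]_(w in A) limn ((fun w n => \int[law X (X s w)]_v (f n (X t v))%:E) w).
  by apply: eq_integral => w _; apply/esym/cvg_lim => //; exact: cvg_proc.
apply: (@cvg_monotone_convergence _ _ _ (law X x) A mA
    (fun n w => \int[law X (X s w)]_v (f n (X t v))%:E)).
- by move=> n; exact: measurable_funTS.
- by move=> n w _; apply: integral_ge0 => v _; rewrite lee_fin.
- move=> w _ a b ab; apply: ge0_le_integral => //.
  + by move=> v _; rewrite lee_fin.
  + by apply/measurable_EFinP; exact: mfXu.
  + by apply/measurable_EFinP; exact: mfXu.
  + by move=> v _; exact: ndf.
Qed.

End markov.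

Section augmentation.
Context {R : realType} {E : ptopologicalType} {d : measure_display}
  {Omega : measurableType d}.
Variable X : borel_right_process R E Omega.

(* Cylinders list their times in decreasing order, all below t. *)
Fixpoint cylinder (l : seq (R * set (borel E))) : set Omega :=
  if l is (s, B) :: l' then X s @^-1` B `&` cylinder l' else setT.

Fixpoint cylinder_before (t : R) (l : seq (R * set (borel E))) : Prop :=
  if l is (s, B) :: l' then [/\ s <= t, measurable B & cylinder_before s l']
  else 0 <= t.

Lemma cylinder_before_ge0 t l : cylinder_before t l -> 0 <= t.
Proof. by elim: l t => [//|[s B] l IH] t [st _ /IH] /le_trans; apply. Qed.

Lemma cylinder_beforeS s t l : s <= t -> cylinder_before s l ->
  cylinder_before t l.
Proof.
case: l => [st s0|[u B] l st [us mB c]]; first exact: le_trans st.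
by split => //; exact: le_trans st.
Qed.

Lemma cylinder_raw t l : cylinder_before t l -> raw_filtration X t (cylinder l).
Proof.
elim: l t => [t _|[s B] l IH t [st mB c]] /=.
  exact: sigma_setT (raw_filtration_sigma X t).
apply: (sigma_setI (raw_filtration_sigma X t)).
  apply: sub_sigma_algebra; exists s, B; split => //.
  by rewrite (cylinder_before_ge0 c).
exact: raw_filtrationS st _ (IH _ c).
Qed.

(** Merges the two decreasing lists of times. *)
Lemma cylinderI t l1 l2 : cylinder_before t l1 -> cylinder_before t l2 ->
  exists2 l, cylinder_before t l & cylinder l = cylinder l1 `&` cylinder l2.
Proof.
elim: l1 t l2 => [t l2 _ c2|[s1 B1] l1 IH1 t l2]; first by exists l2; rewrite ?setTI.
elim: l2 t => [t c1 _|[s2 B2] l2 IH2 t [st1 mB1 c1] [st2 mB2 c2]].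
  by exists ((s1, B1) :: l1); rewrite ?setIT.
have [s21|/ltW s12] := leP s2 s1.
  have [|l cl lE] := IH1 s1 ((s2, B2) :: l2) c1; first by split.
  by exists ((s1, B1) :: l); [split|rewrite /= lE/= setIA].
have [|l cl lE] := IH2 s2 _ c2; first by split.
by exists ((s2, B2) :: l); [split|rewrite /= lE/= setICA].
Qed.

Local Open Scope ereal_scope.

(** Induction on the number of times. The Markov property at the latest time s of the list replaces
    psi (X_t) by phi (X_s), and the condition X_s in B is absorbed into the new function phi
    restricted to B. *)
Lemma measurable_cylinder_fun l t (psi : borel E -> \bar R) :
  cylinder_before t l -> measurable_fun setT psi -> (forall y, 0 <= psi y) ->
  measurable_fun [set: borel E]
    (fun x => \int[law X x]_(w in cylinder l) psi (X t w)).
Proof.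
elim: l t psi => [|[s B] l IH] t psi /= => [t0 mpsi psi0|[st mB c] mpsi psi0].
  exact: measurable_transition.
have s0 := cylinder_before_ge0 c.
have ts0 : (0 <= t - s)%R by rewrite subr_ge0.
pose phi (y : borel E) := \int[law X y]_w psi (X (t - s)%R w).
have mphi : measurable_fun setT phi by exact: measurable_transition.
have phi0 y : 0 <= phi y by exact: integral_ge0.
have rA : raw_filtration X s (X s @^-1` B `&` cylinder l).
  by apply: (@cylinder_raw s ((s, B) :: l)); split.
rewrite (_ : (fun x => _) =
   (fun x => \int[law X x]_(w in cylinder l) (phi \_ B) (X s w))); last first.
  apply/funext => x.
  rewrite -[in LHS](subrK s t) addrC markov_fun// setIC.
  rewrite [LHS]integral_mkcond [RHS]integral_mkcond; apply: eq_integral => w _.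
  by rewrite !patchE in_setI; case: (w \in cylinder l) => //=; rewrite !patchE.
apply: IH => //.
- by apply/(measurable_restrictT _ mB); exact: measurable_funTS.
- by move=> y; rewrite patchE; case: ifP.
Qed.

(** Dynkin's argument: cylinders are stable under intersection and generate the raw sigma-field. The
    result makes P_mu meaningful for an initial law mu. *)
Lemma measurable_law (C : set Omega) : raw_sigma_field X C ->
  measurable_fun [set: borel E] (fun x => law X x C).
Proof.
pose G := [set C | exists t l, cylinder_before t l /\ C = cylinder l].
have GI : setI_closed G.
  move=> _ _ [t1 [l1 [c1 ->]]] [t2 [l2 [c2 ->]]].
  have [||l cl lE] := @cylinderI (Num.max t1 t2) l1 l2.
  - by apply: cylinder_beforeS c1; rewrite le_max lexx.
  - by apply: cylinder_beforeS c2; rewrite le_max lexx orbT.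
  - by exists (Num.max t1 t2), l.
have Gm C' : G C' -> measurable C'.
  move=> [t [l [c ->]]]; apply: raw_measurable; apply: raw_filtration_raw.
  exact: cylinder_raw c.
move=> rC; have {rC} : <<s G >> C.
  apply: sub_sigma_algebra2 rC => A [s [B [s0 mB ->]]].
  by exists s, [:: (s, B)]; rewrite /= setIT; split.
have Gm' C' : <<s G >> C' -> measurable C'.
  apply: smallest_sub => //; exact: sigma_algebra_measurable.
apply: (@dynkin_induction _ (g_sigma_algebraType G) G
  (fun C => measurable_fun [set: borel E] (fun x => law X x C))) => //.
- by under eq_fun do rewrite probability_setT; exact: measurable_cst.
- move=> _ [t [l [c ->]]].
  have := measurable_cylinder_fun c (@measurable_cst _ _ _ _ setT 1) (fun=> lee01).
  congr (measurable_fun _ _); apply/funext => x.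
  by rewrite integral_cst ?mul1e//; apply: Gm; exists t, l.
- move=> S mS h.
  rewrite (_ : (fun x => _) = (fun x => 1 - law X x S)).
    exact: emeasurable_funB.
  by apply/funext => x; rewrite probability_setC//; exact: Gm'.
- move=> F mF tF h.
  rewrite (_ : (fun x => _) = (fun x => \sum_(n <oo) law X x (F n))).
    exact: ge0_emeasurable_sum.
  apply/funext => x; rewrite measure_semi_bigcup//.
    by move=> n; exact: Gm' (mF n).
  by apply: bigcup_measurable => n _; exact: Gm' (mF n).
Qed.

(** For a countable union the exceptional sets are united as well. Their union is P_mu-null because
    sum and mu-integral can be exchanged, which uses [measurable_law]. *)
Lemma augmented_sigma (G : set (set Omega)) : sigma_algebra setT G ->
  sigma_algebra setT (augmented X (law X) G).
Proof.
move=> Gs; split.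
- by apply: augmented_sub => //; exact: sigma_set0.
- move=> A GA mu; have [B [C [GB rC C0 ABC]]] := GA mu.
  exists (~` B), C; split => //; first exact: sigma_setC.
  rewrite setTD !setDE !setCK => w Hw; apply: ABC; move: Hw => -[] [].
    by move=> nAw Bw; right.
  by move=> nBw Aw; left.
- move=> A GA mu.
  have /choice[BC BCP] : forall n, exists BC : set Omega * set Omega,
      [/\ G BC.1, raw_sigma_field X BC.2, \int[mu]_x (law X x BC.2) = 0 &
          (A n `\` BC.1) `|` (BC.1 `\` A n) `<=` BC.2].
    by move=> n; have [B [C h]] := GA n mu; exists (B, C).
  have rC n : raw_sigma_field X (BC n).2 by case: (BCP n).
  exists (\bigcup_n (BC n).1), (\bigcup_n (BC n).2); split.
  + by apply: sigma_bigcup => // n; case: (BCP n).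
  + by apply: sigma_bigcup => //; exact: smallest_sigma_algebra.
  + apply/eqP; rewrite eq_le; apply/andP; split; last exact: integral_ge0.
    have rU : raw_sigma_field X (\bigcup_n (BC n).2).
      by apply: sigma_bigcup => //; exact: smallest_sigma_algebra.
    apply: (@le_trans _ _
      (\int[mu]_x \sum_(n <oo) law X x (BC n).2)); last first.
      rewrite integral_nneseries//; last by move=> n; exact: measurable_law.
      by rewrite eseries0// => n _ _; case: (BCP n).
    apply: ge0_le_integral => //.
    * exact: measurable_law.
    * by apply: ge0_emeasurable_sum => // n _; exact: measurable_law.
    * move=> x _; apply: measure_sigma_subadditive => //.
        by move=> n; exact: raw_measurable (rC n).
      exact: raw_measurable rU.
  + move=> w [[[n _ Anw] nB]|[[n _ Bnw] nA]]; exists n => //;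
      case: (BCP n) => _ _ _; apply.
    * by left; split => // Bnw; apply: nB; exists n.
    * by right; split => // Anw; apply: nA; exists n.
Qed.

Lemma augmentedS (G H : set (set Omega)) : G `<=` H ->
  augmented X (law X) G `<=` augmented X (law X) H.
Proof.
move=> GH A GA mu; have [B [C [GB rC C0 ABC]]] := GA mu.
by exists B, C; split => //; exact: GH.
Qed.

Lemma F_sigma t : sigma_algebra setT (F_ X t).
Proof. exact: augmented_sigma (raw_filtration_sigma X t). Qed.

Lemma F_mono s t : (s <= t)%R -> F_ X s `<=` F_ X t.
Proof. by move=> st; exact: augmentedS (raw_filtrationS st). Qed.

Lemma raw_F t : raw_filtration X t `<=` F_ X t.
Proof. exact: augmented_sub (raw_filtration_sigma X t). Qed.

Lemma F_measurable t A : F_ X t A -> measurable A.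
Proof.
move=> FA; apply/(brp_sigma_field X); apply: augmentedS FA.
exact: raw_filtration_raw.
Qed.

End augmentation.

(** * Progressive processes *)

(** Describes [U z], for a limit z of y, by countable operations on events about the y k. This is
    what makes pointwise limits of measurable maps into E measurable. The set [V n] is the preimage
    of the complement of all balls of radius 1/(n+1) centred outside the open set [V0]. *)
Lemma lusin_open_cvg (R : realType) (E : topologicalType) :
  lusin_space R E -> forall U : set E, open U ->
  exists2 V : nat -> set E, (forall n, closed (V n)) &
    forall (y : nat -> E) (z : E), y @ \oo --> z ->
      (U z <-> exists n k0, forall k, (k0 <= k)%N -> V n (y k)).
Proof.
move=> [K [j [_ _ _ opE]]] U /opE[V0 oV0 ->].
pose e n : R := n.+1%:R^-1.
pose W n := \bigcup_(z in ~` V0) (ball z (e n))^°.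
exists (fun n => j @^-1` (~` W n)).
  move=> n; rewrite preimage_setC; apply: open_closedC; apply/opE.
  exists (W n) => //; apply: bigcup_open => z _; exact: open_interior.
move=> y z yz.
have jcvg (O : set K) : open O -> O (j z) -> \forall k \near \oo, O (j (y k)).
  move=> oO Ojz; apply: (yz (j @^-1` O)); apply: open_nbhs_nbhs; split => //.
  by apply/opE; exists O.
split => [V0z|[n [k0 hk]]].
  have [r /= r0 rV0] : nbhs_ball (j z) V0 by apply/nbhs_ballP/open_nbhs_nbhs.
  have r20 : 0 < r / 2 by rewrite divr_gt0.
  have [n en] : exists n, e n < r / 2.
    by have [n _ /(_ n (leqnn n)) /=] := near_infty_natSinv_lt (PosNum r20); exists n.
  have [k0 _ hk] := jcvg _ (open_interior (ball (j z) (r / 2)))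
    (nbhsx_ballx (j z) _ r20).
  exists n, k0 => k /hk /= /interior_subset bk [u nV0u /interior_subset bu].
  apply: nV0u; apply: rV0; apply: (@ball_split _ _ (j (y k))) => //.
  by apply: le_ball (ltW en) _ _; exact: ball_sym.
apply: contrapT => nV0.
have en0 : 0 < e n by rewrite invr_gt0.
have [k1 _ hk1] := jcvg _ (open_interior (ball (j z) (e n)))
    (nbhsx_ballx (j z) _ en0).
have := hk (maxn k0 k1) (leq_maxl _ _); apply => /=.
by exists (j z) => //; apply: hk1; rewrite /= leq_maxr.
Qed.

Section progressive.
Context {R : realType} {E : ptopologicalType} {d : measure_display}
  {Omega : measurableType d}.
Variable X : borel_right_process R E Omega.

Local Notation Ft t := (g_sigma_algebraType (F_ X t)).

(* Clamping the time lets a process on [0, t] be tested for measurability on the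
   whole product R * Omega. *)
Definition clamp (t s : R) : R := Num.max 0 (Num.min t s).

Lemma clamp_id t s : 0 <= s <= t -> clamp t s = s.
Proof. by move=> /andP[s0 st]; rewrite /clamp (min_idPr st) (max_idPr s0). Qed.

Lemma clamp_itv t s : 0 <= t -> 0 <= clamp t s <= t.
Proof. by move=> t0; rewrite le_max lexx ge_max t0 ge_min lexx. Qed.

Lemma measurable_clamp t : measurable_fun [set: R] (clamp t).
Proof.
by apply: measurable_maxr => //; exact: measurable_minr.
Qed.

Definition progressive d' (T : measurableType d') (Y : R -> Omega -> T) : Prop :=
  forall t, 0 <= t ->
    measurable_fun [set: R * Ft t] (fun p => Y (clamp t p.1) p.2).

Lemma progressive_comp d1 (T1 : measurableType d1) d2 (T2 : measurableType d2)
    (Y : R -> Omega -> T1) (g : T1 -> T2) :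
  measurable_fun setT g -> progressive Y -> progressive (fun t w => g (Y t w)).
Proof. by move=> mg pY t t0; exact: (measurableT_comp mg (pY t t0)). Qed.

(** For s >= 0, the first point of the mesh 1/(k+1) strictly after s, capped at t. Strictness
    matters since only right limits of paths are available. *)
Definition grid (t : R) (k : nat) (s : R) : R :=
  Num.min t ((Num.truncn (s * k.+1%:R)).+1%:R / k.+1%:R).

Lemma grid_ge t k s : 0 <= s <= t -> s <= grid t k s <= t.
Proof.
move=> /andP[s0 st]; rewrite /grid ge_min lexx /= andbT le_min st /=.
rewrite ler_pdivlMr// ltW// truncnS_gt//.
Qed.

Lemma grid_gt t k s : 0 <= s < t -> s < grid t k s.
Proof.
move=> /andP[s0 st]; rewrite /grid lt_min st /=.
by rewrite ltr_pdivlMr// truncnS_gt.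
Qed.

Lemma grid_cvg t s : 0 <= s <= t -> grid t k s @[k --> \oo] --> s.
Proof.
move=> st; have /andP[s0 _] := st.
apply: (@squeeze_cvgr _ _ _ _ (fun=> s) (fun k => s + k.+1%:R^-1)).
- near=> k; have /andP[-> _] := grid_ge k st => /=.
  rewrite /grid ge_min; apply/orP; right; rewrite ler_pdivrMr// mulrDl mulVf//.
  by rewrite -natr1 lerD2r truncn_le// mulr_ge0.
- exact: cvg_cst.
- rewrite -[X in _ --> X]addr0; apply: cvgD; first exact: cvg_cst.
  exact: cvg_harmonic.
Unshelve. all: by end_near. Qed.

(** At s = t the grid is constantly t, so right continuity is asked for only when s < t. *)
Lemma grid_right_cvg (T : topologicalType) (u : R -> T) t s : 0 <= s <= t ->
  (s < t -> u v @[v --> s^'+] --> u s) ->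
  u (grid t k s) @[k --> \oo] --> u s.
Proof.
move=> /andP[s0]; rewrite le_eqVlt => /predU1P[<- _|st /(_ st) us].
  apply: cvg_near_cst; near=> k; congr u.
  by apply/eqP; rewrite eq_le; have /andP[-> ->] := @grid_ge s k s (introT andP (conj s0 (lexx _))).
move=> A nA; have nb : \forall v \near s, s < v -> A (u v) := us A nA.
have [k0 _ hk] := grid_cvg (introT andP (conj s0 (ltW st))) nb.
by exists k0 => // k /hk; apply; rewrite grid_gt// s0.
Unshelve. all: by end_near. Qed.

Lemma path_grid_cvg w t s : 0 <= s <= t ->
  X (grid t k s) w @[k --> \oo] --> X s w.
Proof.
move=> st; apply: (@grid_right_cvg _ (X ^~ w)) => // _.
by apply: brp_right_continuous; case/andP: st.
Qed.

Lemma measurable_grid_path t k : 0 <= t ->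
  measurable_fun [set: R * Ft t]
    (fun p => X (grid t k (clamp t p.1)) p.2 : borel E).
Proof.
move=> t0 _ B mB; rewrite setTI.
(* On each mesh interval [I j] the path is read at the fixed time [g j] <= t, so the preimage is a
   countable union of rectangles. *)
pose I j := [set s : R | j%:R <= clamp t s * k.+1%:R < j.+1%:R].
pose g j : R := Num.min t (j.+1%:R / k.+1%:R).
rewrite (_ : _ @^-1` _ = \bigcup_j (I j `*` (X (g j) @^-1` B : set (Ft t)))).
  apply: bigcup_measurable => j _; apply: measurableX.
    rewrite (_ : I j = (fun s => clamp t s * k.+1%:R) @^-1` `[j%:R, j.+1%:R[%classic).
      rewrite -[X in measurable X]setTI.
      by apply: measurable_funM => //; exact: measurable_clamp.
    by apply/seteqP; split => s; rewrite /= in_itv.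
  apply/(sub_sigmaE (F_sigma X t)); apply: raw_F; apply: sub_sigma_algebra.
  exists (g j), B; split => //.
  by rewrite /g le_min t0 ge_min lexx/= divr_ge0.
have c0 s : 0 <= clamp t s * k.+1%:R.
  by rewrite mulr_ge0//; case/andP: (clamp_itv s t0).
apply/seteqP; split => [[s w] /= Bsw|[s w] [j _ [/= Ij]]].
  exists (Num.truncn (clamp t s * k.+1%:R)) => //; split => //=.
  exact: truncn_itv.
by rewrite /g /grid -(truncn_def Ij).
Qed.

(** X on [0, t] is the pointwise limit of its grid discretizations, and [lusin_open_cvg] carries
    their measurability to the limit. It suffices to test open sets. *)
Lemma progressive_path : lusin_space R E -> progressive (X : R -> Omega -> borel E).
Proof.
move=> hE t t0; apply: (@measurability _ _ _ (borel E) _ _ (@open E)) => // _ [U oU <-].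
have [V cV VP] := lusin_open_cvg hE oU.
pose h k (p : R * Ft t) : borel E := X (grid t k (clamp t p.1)) p.2.
rewrite (_ : _ `&` _ = \bigcup_n \bigcup_k0 \bigcap_(k in [set k | (k0 <= k)%N])
   (h k @^-1` V n)).
  apply: bigcup_measurable => n _; apply: bigcup_measurable => k0 _.
  apply: bigcap_measurable => [|k _]; first by exists k0 => /=.
  rewrite -[X in measurable X]setTI; apply: measurable_grid_path => //.
  rewrite -[V n]setCK; apply: measurableC; apply: sub_sigma_algebra.
  exact: closed_openC.
rewrite setTI; apply/seteqP; split => [[s w]|[s w]] /=.
  have := VP _ _ (@path_grid_cvg w t (clamp t s) (clamp_itv s t0)).
  by move=> [+ _] Us => /(_ Us)[n [k0 hk]]; exists n => //; exists k0.
have := VP _ _ (@path_grid_cvg w t (clamp t s) (clamp_itv s t0)).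
by move=> [_ +] [n _ [k0 _ hk]]; apply; exists n, k0.
Qed.


Lemma progressive_adapted d' (T : measurableType d') (Y : R -> Omega -> T) t :
  progressive Y -> 0 <= t -> measurable_fun [set: Ft t] (Y t).
Proof.
move=> pY t0.
have -> : Y t = (fun p : R * Ft t => Y (clamp t p.1) p.2) \o (fun w => (t, w)).
  by apply/funext => w /=; rewrite clamp_id// t0 lexx.
apply: measurableT_comp; first exact: pY.
exact: measurable_fun_pair.
Qed.

Lemma Ft_id t d' (T : measurableType d') (f : Omega -> T) :
  measurable_fun [set: Ft t] f -> measurable_fun [set: Omega] f.
Proof. exact: (sub_sigma_fun (F_sigma X t) (@F_measurable _ _ _ _ X t)). Qed.

Lemma Ft_sub s t d' (T : measurableType d') (f : Omega -> T) : s <= t ->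
  measurable_fun [set: Ft s] f -> measurable_fun [set: Ft t] f.
Proof.
move=> st mf _ B mB; apply/(sub_sigmaE (F_sigma X t)); apply: F_mono st _ _.
apply/(sub_sigmaE (F_sigma X s)); exact: mf.
Qed.

Lemma progressive_joint d' (T : measurableType d') (Y : R -> Omega -> T) t :
  progressive Y -> 0 <= t ->
  measurable_fun [set: R * Omega] (fun p => Y (clamp t p.1) p.2).
Proof.
move=> pY t0.
have mid : measurable_fun [set: R * Omega]
    (fun p => (p.1, p.2) : R * Ft t).
  apply: measurable_fun_pair => //.
  have : measurable_fun [set: Omega] (id : Omega -> Ft t) by exact: Ft_id.
  by move/measurableT_comp; apply; exact: measurable_snd.
exact: (measurableT_comp (pY t t0) mid).
Qed.

Lemma stopping_time_min (T1 T2 : Omega -> \bar R) :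
  stopping_time X T1 -> stopping_time X T2 ->
  stopping_time X (fun w => Order.min (T1 w) (T2 w)).
Proof.
move=> [T10 T1F] [T20 T2F]; split => [w|t t0]; first by rewrite le_min T10 T20.
rewrite (_ : [set _ | _] = [set w | (T1 w <= t%:E)%E] `|` [set w | (T2 w <= t%:E)%E]).
  by apply: (sigma_setU (F_sigma X t)); [exact: T1F|exact: T2F].
by apply/seteqP; split => w /=; rewrite ge_min => /orP.
Qed.

Definition capped (T : Omega -> \bar R) (s : R) (w : Omega) : R :=
  fine (Order.min s%:E (T w)).

Lemma cappedE T s w : (0 <= T w)%E -> (capped T s w)%:E = Order.min s%:E (T w).
Proof.
move=> T0; rewrite /capped; case: (T w) T0 => [r| |] //.
  by move=> _; rewrite -EFin_min.
by move=> _; rewrite (min_idPl _)// leey.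
Qed.

Lemma capped_ge0 T s w : (0 <= T w)%E -> 0 <= s -> 0 <= capped T s w.
Proof. by move=> T0 s0; rewrite -lee_fin cappedE// le_min T0 lee_fin s0. Qed.

Lemma capped_le T s w : (0 <= T w)%E -> capped T s w <= s.
Proof. by move=> T0; rewrite -lee_fin cappedE// ge_min lexx. Qed.

Lemma measurable_capped T t : stopping_time X T -> 0 <= t ->
  measurable_fun [set: Ft t] (capped T t).
Proof.
move=> [T0 TF] t0; apply: (measurability _ (RGenOInfty.measurableE R)).
move=> _ [_ [r ->] <-]; rewrite setTI.
rewrite (_ : _ @^-1` _ = ~` [set w | capped T t w <= r]); last first.
  by apply/seteqP; split => w; rewrite /= in_itv/= andbT ltNge; move/negP.
apply: measurableC; apply/(sub_sigmaE (F_sigma X t)).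
have [tr|rt] := leP t r.
  rewrite (_ : [set _ | _] = setT); first exact: sigma_setT (F_sigma X t).
  by apply/seteqP; split => w //= _; apply: le_trans tr; exact: capped_le.
have [r0|r0] := ltP r 0.
  rewrite (_ : [set _ | _] = set0); first exact: sigma_set0 (F_sigma X t).
  by apply/seteqP; split => w //=; rewrite leNgt (lt_le_trans r0)// capped_ge0.
rewrite (_ : [set _ | _] = [set w | (T w <= r%:E)%E]).
  by apply: F_mono (TF r r0); exact: ltW.
by apply/seteqP; split => w /=; rewrite -lee_fin cappedE// ge_min lee_fin
  (leNgt t) rt.
Qed.

Lemma capped_clamp T t s w : (0 <= T w)%E -> 0 <= t ->
  capped T (clamp t s) w = Num.min (clamp t s) (capped T t w).
Proof.
move=> T0 t0; apply: EFin_inj; rewrite cappedE// EFin_min cappedE//.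
rewrite minA; congr Order.min; apply/esym/min_idPl; rewrite lee_fin.
by case/andP: (clamp_itv s t0).
Qed.

Lemma progressive_stopped d' (T' : measurableType d') (Y : R -> Omega -> T') T :
  stopping_time X T -> progressive Y ->
  progressive (fun t w => Y (capped T t w) w).
Proof.
move=> sT pY t t0; have [T0 _] := sT.
(* Stopping is composition with the map sending (s, w) to (min (s, T w), w), which is measurable for
   F_t. *)
have -> : (fun p : R * Ft t => Y (capped T (clamp t p.1) p.2) p.2) =
   (fun p : R * Ft t => Y (clamp t p.1) p.2) \o
   (fun p : R * Ft t => (Num.min (clamp t p.1) (capped T t p.2), p.2)).
  apply/funext => p /=; rewrite -capped_clamp// [clamp t (capped _ _ _)]clamp_id//.
  have /andP[c0 ct] := clamp_itv p.1 t0.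
  by rewrite capped_ge0//= (le_trans (capped_le _ _)).
apply: (measurableT_comp (pY t t0)).
apply: measurable_fun_pair => //; apply: measurable_minr.
  exact: (measurableT_comp (measurable_clamp t) measurable_fst).
exact: (measurableT_comp (measurable_capped sT t0) measurable_snd).
Qed.

(** Multiplying a rate by this indicator of [0, T] stops its primitive at T. *)
Definition alive (T : Omega -> \bar R) (s : R) (w : Omega) : R :=
  ((s%:E <= T w)%E : bool)%:R.

Lemma progressive_alive T : stopping_time X T -> progressive (alive T).
Proof.
move=> sT t t0; have [T0 _] := sT.
have -> : (fun p : R * Ft t => alive T (clamp t p.1) p.2) =
   (fun p => ((clamp t p.1 <= capped T t p.2)%R)%:R).
  apply/funext => p; rewrite /alive; congr (_%:R); congr nat_of_bool.
  rewrite -lee_fin cappedE// le_min lee_fin.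
  by have /andP[_ ->] := clamp_itv p.1 t0.
have m1 : measurable_fun [set: R * Ft t] (fun p => clamp t p.1).
  exact: (measurableT_comp (measurable_clamp t) measurable_fst).
have m2 : measurable_fun [set: R * Ft t] (fun p => capped T t p.2).
  exact: (measurableT_comp (measurable_capped sT t0) measurable_snd).
have mb := measurable_fun_ler m1 m2.
have := measurable_fun_ifT mb (@measurable_cst _ _ (R * Ft t)%type R setT 1)
  (@measurable_cst _ _ (R * Ft t)%type R setT 0).
by congr measurable_fun; apply/funext => p /=; case: ifP.
Qed.

Definition pint (b : R -> Omega -> R) (t : R) (w : Omega) : R :=
  \int[lebesgue_measure]_(s in `[0, t]) b s w.

(** Integrability plays no part: the integrals of the positive and negative parts are measurable by
    Tonelli, and [fine] of their difference is measurable whatever its value. *)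
Lemma measurable_fubini_param d' (T : measurableType d') (H : T * R -> R) :
  measurable_fun setT H ->
  measurable_fun setT (fun p => \int[lebesgue_measure]_u H (p, u)).
Proof.
move=> mH; rewrite /Rintegral; apply/measurableT_comp => //.
have mHE : measurable_fun setT (EFin \o H) by exact/measurable_EFinP.
have m0 := @measurable_cst _ _ (T * R)%type (\bar R) setT 0%E.
pose fp (q : T * R) := maxe (H q)%:E 0%E.
pose fn (q : T * R) := maxe (- (H q)%:E)%E 0%E.
have mp : measurable_fun setT fp by exact: measurable_maxe.
have mn : measurable_fun setT fn.
  apply: measurable_maxe => //; exact: measurableT_comp.
have fp0 q : (0 <= fp q)%E by rewrite le_max lexx orbT.
have fn0 q : (0 <= fn q)%E by rewrite le_max lexx orbT.
have hp := @measurable_fun_fubini_tonelli_F _ _ T (measurableTypeR R) R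
  lebesgue_measure fp mp fp0.
have hn := @measurable_fun_fubini_tonelli_F _ _ T (measurableTypeR R) R
  lebesgue_measure fn mn fn0.
have := emeasurable_funB hp hn; congr measurable_fun.
apply/funext => p; rewrite [RHS]integralE; congr (_ - _)%E.
  by apply: eq_integral => u _; rewrite funeposE.
by apply: eq_integral => u _; rewrite funenegE.
Qed.

Lemma progressive_pint (b : R -> Omega -> R) : progressive b ->
  progressive (pint b).
Proof.
move=> pb t t0.
(* The interval of integration moves with the time variable; cutting b off outside it gives an
   integral over the whole line with a parameter. *)
pose H (q : (R * Ft t) * R) : R :=
  if (0 <= q.2) && (q.2 <= clamp t q.1.1) then b (clamp t q.2) q.1.2 else 0.
rewrite (_ : (fun p : R * Ft t => pint b (clamp t p.1) p.2) =
    (fun p => \int[lebesgue_measure]_u H (p, u))).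
  apply: measurable_fubini_param; apply: measurable_fun_ifT => //.
  - apply: measurable_and; apply: measurable_fun_ler => //.
    exact: (measurableT_comp (measurable_clamp t)
      (measurableT_comp measurable_fst measurable_fst)).
  - have m : measurable_fun setT
        (fun q : (R * Ft t) * R => (q.2, q.1.2) : R * Ft t).
      apply: measurable_fun_pair => //.
      exact: (measurableT_comp measurable_snd measurable_fst).
    exact: (measurableT_comp (pb t t0) m).
apply/funext => -[s w] /=; rewrite /pint /Rintegral integral_mkcond.
congr fine; apply: eq_integral => u _; rewrite /H/= patchE mem_setE/= in_itv/=.
case: ifPn => // /andP[u0 us]; rewrite clamp_id// u0 (le_trans us)//.
by case/andP: (clamp_itv s t0).
Qed.

End progressive.

(** * Uniform integrability *)

Section real_integrable.
Context {d : measure_display} {T : measurableType d} {R : realType}.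
Variables (mu : measure T R) (D : set T).
Hypothesis mD : measurable D.
Implicit Types f g : T -> R.

Lemma Rintegrable_measurable f : mu.-integrable D (EFin \o f) ->
  measurable_fun D f.
Proof. by move=> iF; apply/measurable_EFinP; exact: measurable_int iF. Qed.

Lemma RintegrableD f g : mu.-integrable D (EFin \o f) ->
  mu.-integrable D (EFin \o g) ->
  mu.-integrable D (EFin \o (fun x => f x + g x)).
Proof.
move=> iF ig; apply: eq_integrable (integrableD mD iF ig) => // x _.
Qed.

Lemma RintegrableB f g : mu.-integrable D (EFin \o f) ->
  mu.-integrable D (EFin \o g) ->
  mu.-integrable D (EFin \o (fun x => f x - g x)).
Proof.
move=> iF ig; apply: eq_integrable (integrableB mD iF ig) => // x _.
Qed.

Lemma RintegrableZ k f : mu.-integrable D (EFin \o f) ->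
  mu.-integrable D (EFin \o (fun x => k * f x)).
Proof. by move=> iF; apply: eq_integrable (integrableZl mD k iF). Qed.

Lemma Rintegrable_norm f : mu.-integrable D (EFin \o f) ->
  mu.-integrable D (EFin \o (fun x => `|f x|)).
Proof. by move=> iF; exact: integrable_abse iF. Qed.

Lemma Rintegrable_le f g : measurable_fun D f ->
  (forall x, D x -> `|f x| <= g x) ->
  mu.-integrable D (EFin \o g) -> mu.-integrable D (EFin \o f).
Proof.
move=> mf fg ig; apply: (le_integrable mD _ _ ig); first exact/measurable_EFinP.
by move=> x Dx; rewrite /= lee_fin (le_trans (fg x Dx))// ler_norm.
Qed.

Lemma Rintegrable_mul_bounded f g K : measurable_fun D g ->
  (forall x, D x -> `|g x| <= K) -> mu.-integrable D (EFin \o f) ->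
  mu.-integrable D (EFin \o (fun x => f x * g x)).
Proof.
move=> mg gK iF; apply: (@Rintegrable_le _ (fun x => K * `|f x|)).
- apply: measurable_funM => //; exact: Rintegrable_measurable.
- by move=> x Dx; rewrite normrM mulrC ler_wpM2r// gK.
- exact/RintegrableZ/Rintegrable_norm.
Qed.

Lemma EFin_Rintegral f : mu.-integrable D (EFin \o f) ->
  (\int[mu]_(x in D) f x)%:E = (\int[mu]_(x in D) (f x)%:E)%E.
Proof. by move=> iF; rewrite /Rintegral fineK//; exact: integrable_fin_num. Qed.

End real_integrable.

Section uniform_integrability.
Context {d : measure_display} {T : measurableType d} {R : realType}.
Variable mu : probability T R.

Lemma integrable_patch (f : T -> R) B : measurable B ->
  mu.-integrable setT (EFin \o f) -> mu.-integrable setT (EFin \o (f \_ B)).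
Proof.
move=> mB iF; rewrite -restrict_EFin; apply/(integrable_mkcond _ mB).
exact: integrableS iF.
Qed.

Let gtset (f : T -> R) (K : R) := [set w | K < `|f w|].

Lemma measurable_gtset (f : T -> R) K : measurable_fun setT f ->
  measurable [set w | K < `|f w|].
Proof.
move=> mf; have := measurableT_comp (@normr_measurable R setT) mf.
move=> /(_ measurableT `]K, +oo[%classic (measurable_itv _)); rewrite setTI.
by congr measurable; apply/seteqP; split => w /=; rewrite in_itv/= andbT.
Qed.

Lemma tail_integral_cvg0 (g : T -> R) : mu.-integrable setT (EFin \o g) ->
  \int[mu]_(w in [set w | n%:R < `|g w|]) `|g w| @[n --> \oo] --> 0.
Proof.
move=> ig; have mg : measurable_fun setT g.
  by apply/measurable_EFinP; exact: measurable_int ig.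
have mG n := measurable_gtset (n%:R) mg.
pose f n w := ((fun w => `|g w|%:E) \_ (gtset g n%:R)) w.
have [] := @dominated_convergence _ _ _ mu setT measurableT f (cst 0%E)
  (fun w => `|g w|%:E).
- move=> n; apply/(measurable_restrictT _ (mG n)); apply: measurable_funTS.
  by apply/measurable_EFinP; exact: measurableT_comp.
- exact: measurable_cst.
- apply/aeW => w _; apply: cvg_near_cst.
  near=> n; rewrite /f patchE ifF//; apply/negP; rewrite inE /gtset/=.
  apply/negP; rewrite -leNgt; near: n; exact: nbhs_infty_ger.
- exact: integrable_abse ig.
- apply/aeW => w n _; rewrite /f patchE; case: ifP => _ //=; last by rewrite normr0 lee_fin.
  by rewrite normr_id.
move=> _ _; rewrite integral0_eq// => h.
rewrite (_ : (fun n => _) = fine \o (fun n => \int[mu]_x f n x)%E).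
  exact: fine_cvg h.
by apply/funext => n; rewrite /Rintegral/= [in LHS]integral_mkcond.
Unshelve. all: by end_near. Qed.

Definition truncate (K x : R) : R := Num.max (- K) (Num.min K x).

Lemma truncate_le K x : 0 <= K -> `|truncate K x| <= K.
Proof.
move=> K0; rewrite ler_norml /truncate le_max lexx/= ge_max ge_min lexx/=.
by rewrite andbT; lra.
Qed.

Lemma truncate_continuous K : continuous (truncate K : R -> R).
Proof.
move=> x.
have hmin : (fun y => Num.min K y) @ x --> Num.min K x.
  apply: (@continuous_min R R (fun=> K) id x); first exact: cvg_cst.
  exact: cvg_id.
by apply: (@continuous_max R R (fun=> - K) (fun y => Num.min K y) x);
  first exact: cvg_cst.
Qed.

Lemma dist_truncate K x : 0 <= K ->
  `|x - truncate K x| <= (if K < `|x| then `|x| else 0).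
Proof.
move=> K0; rewrite /truncate; have [x0|x0] := leP 0 x.
  rewrite (ger0_norm x0) (max_idPr _); last first.
    by rewrite le_min; apply/andP; split; lra.
  have [xK|Kx] := leP x K; first by rewrite subrr normr0.
  by rewrite ger0_norm; lra.
rewrite (ltr0_norm x0) (min_idPr _); last by lra.
have [xK|Kx] := ltP K (- x).
  by rewrite (max_idPl _) ?ltr0_norm; lra.
by rewrite (max_idPr _) ?subrr ?normr0; lra.
Qed.

Lemma measurable_truncate K (f : T -> R) : measurable_fun setT f ->
  measurable_fun setT (fun w => truncate K (f w)).
Proof. by move=> mf; apply: measurable_maxr => //; exact: measurable_minr. Qed.

Lemma Rintegral_truncate K (f : T -> R) (B : set T) : 0 <= K ->
  measurable B -> mu.-integrable setT (EFin \o f) ->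
  `|\int[mu]_(w in B) f w - \int[mu]_(w in B) truncate K (f w)| <=
  \int[mu]_(w in [set w | K < `|f w|]) `|f w|.
Proof.
move=> K0 mB iF; have mf : measurable_fun setT f.
  by apply/measurable_EFinP; exact: measurable_int iF.
have iFn : mu.-integrable setT (EFin \o (fun w => `|f w|)) by exact: integrable_abse iF.
have it : mu.-integrable setT (EFin \o (fun w => truncate K (f w))).
  apply: (le_integrable measurableT _ _ (finite_measure_integrable_cst mu K measurableT)).
    by apply/measurable_EFinP; exact: measurable_truncate.
  by move=> w _; rewrite /= lee_fin (ger0_norm K0) truncate_le.
have iS (g : T -> R) D : measurable D -> mu.-integrable setT (EFin \o g) ->
   mu.-integrable D (EFin \o g) by move=> mD; exact: integrableS.
have iB : mu.-integrable setT (EFin \o (fun w => f w - truncate K (f w))).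
  exact: RintegrableB.
rewrite -RintegralB//; [|exact: iS..].
apply: le_trans (le_normr_Rintegral mB (iS _ _ mB iB)) _.
have mG := measurable_gtset K mf.
rewrite [leLHS]Rintegral_mkcond [leRHS]Rintegral_mkcond.
apply: le_Rintegral => //; [| |move=> w _].
- by apply: integrable_patch => //; exact: integrable_abse iB.
- exact: integrable_patch.
have := dist_truncate (f w) K0; rewrite !patchE.
rewrite (_ : (w \in [set w | _]) = (K < `|f w|)); last by apply/idP/idP; rewrite inE.
case: (w \in B) => // _; case: ifP => // _; exact: normr_ge0.
Qed.

(** The tail condition is the one satisfied by conditional expectations f_n of g, and it yields
    uniform integrability: where |f_n| > K, either |g| > L or |g| <= (L / K) |f_n|. The constant
    integrals over B then pass to the limit. *)
Lemma uniform_integrable_limit (f_ : nat -> T -> R) (f g : T -> R) (B : set T) :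
  (forall n, measurable_fun setT (f_ n)) -> measurable_fun setT f ->
  mu.-integrable setT (EFin \o g) ->
  {ae mu, forall w, f_ n w @[n --> \oo] --> f w} ->
  (forall n K, (\int[mu]_(w in [set w | (K < `|f_ n w|)%R]) `|f_ n w|%:E <=
     \int[mu]_(w in [set w | (K < `|f_ n w|)%R]) `|g w|%:E)%E) ->
  measurable B ->
  (forall n, \int[mu]_(w in B) f_ n w = \int[mu]_(w in B) g w) ->
  mu.-integrable setT (EFin \o f) /\
  \int[mu]_(w in B) f w = \int[mu]_(w in B) g w.
Proof.
move=> mf_ mf ig cvf dom mB eqB.
have mg : measurable_fun setT g.
  by apply/measurable_EFinP; exact: measurable_int ig.
have ign : mu.-integrable setT (EFin \o (fun w => `|g w|)).
  exact: integrable_abse ig.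
have intg n : (\int[mu]_w `|f_ n w|%:E <= \int[mu]_w `|g w|%:E)%E.
  (* At the level -1 the tail set is the whole space. *)
  have := dom n (-1); rewrite (_ : [set w | _] = setT)//.
  by apply/seteqP; split => // w _ /=; have := normr_ge0 (f_ n w); lra.
have if_ n : mu.-integrable setT (EFin \o f_ n).
  apply/integrableP; split; first exact/measurable_EFinP.
  by apply: le_lt_trans (intg n) _; have /integrableP[] := ig.
have if0 : mu.-integrable setT (EFin \o f).
  apply/integrableP; split; first exact/measurable_EFinP.
  have /integrableP[_] := ig; apply: le_lt_trans.
  have mfn n : measurable_fun setT (fun w => `|f_ n w|%:E).
    by apply/measurable_EFinP; exact: measurableT_comp.
  have le_ae : (\int[mu]_w `|f w|%:E <= \int[mu]_w limn_einf (fun n => `|f_ n w|%:E))%E.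
    rewrite le_eqVlt; apply/orP; left; apply/eqP; apply: ae_eq_integral => //.
    - by apply/measurable_EFinP; exact: measurableT_comp.
    - rewrite (_ : (fun w => _) = (fun w => - limn_esup (fun n => - `|f_ n w|%:E))%E).
        apply: measurableT_comp => //; apply: measurable_fun_limn_esup => n.
        exact: measurableT_comp.
      by apply/funext => w; rewrite limn_esupN oppeK.
    - apply: filterS cvf => w cvw _ /=; apply/esym.
      have cvw' : (fun n => `|f_ n w|%:E) @ \oo --> `|f w|%:E.
        by apply/cvg_EFin; [exact: nearW|exact: cvg_norm].
      by rewrite (cvg_limn_einf_sup cvw').
  apply: le_trans le_ae _; apply: le_trans (fatou _ _ _ _) _ => //.
  rewrite limn_einf_lim; apply: lime_le; first exact: is_cvg_einfs.
  apply: nearW => n; apply: le_trans (intg n).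
  by apply: ereal_inf_lbound; exists n => /=.
split => //.
have iS (h : T -> R) D : measurable D -> mu.-integrable setT (EFin \o h) ->
   mu.-integrable D (EFin \o h) by move=> mD; exact: integrableS.
pose Cg := \int[mu]_w `|g w|.
have Cg0 : 0 <= Cg by exact: Rintegral_ge0.
have domR n K : \int[mu]_(w in [set w | K < `|f_ n w|]) `|f_ n w| <=
    \int[mu]_(w in [set w | K < `|f_ n w|]) `|g w|.
  have mG := measurable_gtset K (mf_ n).
  rewrite -lee_fin !EFin_Rintegral//; apply: iS => //; exact: Rintegrable_norm.
have intgR n : \int[mu]_w `|f_ n w| <= Cg.
  by rewrite -lee_fin /Cg !EFin_Rintegral//; exact: Rintegrable_norm.
have tailg n (L K : R) : 0 <= L -> 0 < K ->
    \int[mu]_(w in [set w | K < `|f_ n w|]) `|g w| <=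
    \int[mu]_(w in [set w | L < `|g w|]) `|g w| + L / K * Cg.
  move=> L0 K0; have mG1 := measurable_gtset K (mf_ n).
  have mG2 := measurable_gtset L mg.
  have LK0 : 0 <= L / K by rewrite divr_ge0// ltW.
  apply: (@le_trans _ _ (\int[mu]_(w in [set w | L < `|g w|]) `|g w| +
     L / K * \int[mu]_w `|f_ n w|)); last by rewrite lerD2l ler_wpM2l.
  have in_ : mu.-integrable setT (EFin \o (fun w => `|f_ n w|)).
    exact: Rintegrable_norm.
  rewrite -RintegralZl// [leLHS]Rintegral_mkcond [X in _ <= X + _]Rintegral_mkcond.
  rewrite -RintegralD//; first last.
  - exact: RintegrableZ.
  - exact: integrable_patch.
  apply: le_Rintegral => //.
  - exact: integrable_patch.
  - by apply: RintegrableD => //; [exact: integrable_patch|exact: RintegrableZ].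
  move=> w _; rewrite !patchE.
  rewrite (_ : (w \in [set w | K < _]) = (K < `|f_ n w|)); last by apply/idP/idP; rewrite inE.
  rewrite (_ : (w \in [set w | L < _]) = (L < `|g w|)); last by apply/idP/idP; rewrite inE.
  have lf : 0 <= L / K * `|f_ n w| by rewrite mulr_ge0.
  have g0 := normr_ge0 (g w).
  case: ifPn => Kf; case: ifPn => Lg //; rewrite ?lerDl ?add0r//.
  - rewrite -leNgt in Lg; apply: (le_trans Lg).
    by rewrite mulrAC ler_pdivlMr// ler_wpM2l// ltW.
  - by rewrite addr_ge0.
(* Two errors e bound the truncation of f_n (a tail of g and a term L / K times the norm of g), and
   the third bounds the truncation of f. *)
suff key e : 0 < e ->
    `|\int[mu]_(w in B) f w - \int[mu]_(w in B) g w| <= 3 * e.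
  apply/eqP; rewrite -subr_eq0 -normr_le0; apply/ler_addgt0Pl => e e0.
  have e3 : 0 < e / 3 by lra.
  by have := key _ e3; lra.
move=> e0.
have [L _ hL] : \forall L \near \oo,
    \int[mu]_(w in [set w | L%:R < `|g w|]) `|g w| < e.
  exact: cvgr_lt (tail_integral_cvg0 ig) _ e0.
have {hL} := hL L (leqnn _); rewrite /= => hL.
have [K1 _ hK1] : \forall K \near \oo,
    \int[mu]_(w in [set w | K%:R < `|f w|]) `|f w| < e.
  exact: cvgr_lt (tail_integral_cvg0 if0) _ e0.
(* With L already fixed by the tail of g, K is taken large enough that L / K times the norm of g is
   at most e. *)
have [K2 _ hK2] : \forall K \near \oo, L%:R * Cg / e <= K%:R.
  exact: nbhs_infty_ger.
pose K := (maxn K1 (maxn K2 1)).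
have K0 : 0 < K%:R :> R by rewrite ltr0n /K !leq_max !orbT.
have {}hK1 := hK1 K (leq_maxl _ _).
have {}hK2 : L%:R / K%:R * Cg <= e.
  have : (K2 <= K)%N by rewrite /K !leq_max leqnn orbT.
  move=> /hK2 /=; rewrite ler_pdivrMr// => h.
  by rewrite mulrAC ler_pdivrMr// [e * _]mulrC.
pose phi n := \int[mu]_(w in B) truncate K%:R (f_ n w).
have cphi : phi @ \oo --> \int[mu]_(w in B) truncate K%:R (f w).
  have [] := @dominated_convergence _ _ _ mu B mB
    (fun n w => (truncate K%:R (f_ n w))%:E) (fun w => (truncate K%:R (f w))%:E)
    (cst K%:R%:E).
  - move=> n; apply: measurable_funTS; apply/measurable_EFinP.
    exact: measurable_truncate.
  - apply: measurable_funTS; apply/measurable_EFinP; exact: measurable_truncate.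
  - apply: filterS cvf => w cvw _; apply/cvg_EFin; first exact: nearW.
    exact: (cvg_comp _ _ cvw (@truncate_continuous K%:R (f w))).
  - exact: finite_measure_integrable_cst.
  - by apply/aeW => w n _; rewrite lee_fin truncate_le// ltW.
  move=> itr _ h; rewrite /phi /Rintegral; apply: fine_cvg.
  by rewrite fineK; [exact: h|exact: integrable_fin_num].
have phic n : `|\int[mu]_(w in B) g w - phi n| <= e + e.
  rewrite -(eqB n); apply: le_trans (Rintegral_truncate (ltW K0) mB (if_ n)) _.
  apply: le_trans (domR n _) _.
  apply: le_trans (tailg n L%:R K%:R (ler0n _ _) K0) _.
  by rewrite lerD// ltW.
have lim_le : `|\int[mu]_(w in B) g w - \int[mu]_(w in B) truncate K%:R (f w)| <= e + e.
  have cc : (fun n => `|\int[mu]_(w in B) g w - phi n|) @ \oo -->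
     `|\int[mu]_(w in B) g w - \int[mu]_(w in B) truncate K%:R (f w)|.
    by apply: cvg_norm; apply: cvgB => //; exact: cvg_cst.
  rewrite -(cvg_lim _ cc)//; apply: limr_le; first exact: cvgP cc.
  exact: nearW.
have tr := Rintegral_truncate (ltW K0) mB if0.
rewrite (_ : _ - _ = (\int[mu]_(w in B) f w - \int[mu]_(w in B) truncate K%:R (f w))
  - (\int[mu]_(w in B) g w - \int[mu]_(w in B) truncate K%:R (f w))); last by ring.
apply: le_trans (ler_normB _ _) _; have := ltW hK1; lra.
Qed.

End uniform_integrability.

(** * Optional stopping *)

Section martingales.
Context {R : realType} {E : ptopologicalType} {d : measure_display}
  {Omega : measurableType d}.
Variable X : borel_right_process R E Omega.
Variables (mu : probability Omega R) (t1 : R).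

Local Notation Ft t := (g_sigma_algebraType (F_ X t)).

(** The martingale property on [0, t1] under one fixed measure. Adaptedness and path regularity are
    kept apart, so that this part is stable under algebra and changes on null sets. *)
Definition premartingale (Y : R -> Omega -> R) : Prop :=
  (forall s, 0 <= s <= t1 -> mu.-integrable setT (EFin \o Y s)) /\
  (forall s u A, 0 <= s -> s <= u -> u <= t1 -> F_ X s A ->
    \int[mu]_(w in A) Y u w = \int[mu]_(w in A) Y s w).

Definition nonanticipating (Y : R -> Omega -> R) : Prop :=
  forall s, 0 <= s <= t1 -> measurable_fun [set: Ft s] (Y s).

Lemma F_preimage s (f : Omega -> R) (B : set R) :
  measurable_fun [set: Ft s] f -> measurable B -> F_ X s (f @^-1` B).
Proof.
move=> mf mB; apply/(sub_sigmaE (F_sigma X s)); rewrite -[X in measurable X]setTI.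
exact: mf.
Qed.

(** A is split by the sign of Y_s, an event of F_s; on each piece the martingale equality for Y or
    -Y is followed by the bound by |Y_u|. *)
Lemma premartingale_abs Y s u A : nonanticipating Y -> premartingale Y ->
  0 <= s -> s <= u -> u <= t1 -> F_ X s A ->
  \int[mu]_(w in A) `|Y s w| <= \int[mu]_(w in A) `|Y u w|.
Proof.
move=> aY [iY eY] s0 su ut FA.
have u0 := le_trans s0 su; have st := le_trans su ut.
have iYs := iY s (introT andP (conj s0 st)).
have iYu := iY u (introT andP (conj u0 ut)).
pose P := [set w | 0 <= Y s w].
have FP : F_ X s P.
  rewrite (_ : P = Y s @^-1` `[0, +oo[%classic).
    by apply: F_preimage => //; apply: aY; rewrite s0.
  by apply/seteqP; split => w; rewrite /P /= in_itv/= andbT.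
have FAP := sigma_setI (F_sigma X s) FA FP.
have FAN := sigma_setD (F_sigma X s) FA FP.
have mAP := F_measurable FAP; have mAN := F_measurable FAN.
have mA := F_measurable FA.
have iS (h : Omega -> R) D : measurable D -> mu.-integrable setT (EFin \o h) ->
   mu.-integrable D (EFin \o h) by move=> mD; exact: integrableS.
have AE : A = (A `&` P) `|` (A `\` P) by rewrite setUIDK.
have spl (h : Omega -> R) : mu.-integrable setT (EFin \o h) ->
    \int[mu]_(w in A) h w =
    \int[mu]_(w in A `&` P) h w + \int[mu]_(w in A `\` P) h w.
  move=> ih; rewrite {1}AE Rintegral_setU//; first by rewrite -AE; exact: iS.
  by apply/disj_set2P/seteqP; split => w //= [[_ Pw] [_ nPw]].
rewrite !spl; [|exact: Rintegrable_norm..].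
apply: lerD.
- rewrite (@eq_Rintegral _ _ _ mu _ (Y s)); last first.
    by move=> w; rewrite inE => -[_ /= Ps]; rewrite ger0_norm.
  rewrite -(eY _ _ _ s0 su ut FAP); apply: le_Rintegral => //.
  + exact: iS.
  + by apply: iS => //; exact: Rintegrable_norm.
  + by move=> w _; exact: ler_norm.
- rewrite (@eq_Rintegral _ _ _ mu _ (fun w => -1 * Y s w)); last first.
    move=> w; rewrite inE => -[_ /= /negP]; rewrite -ltNge => Ps.
    by rewrite ltr0_norm// mulN1r.
  rewrite RintegralZl//; last exact: iS.
  rewrite -(eY _ _ _ s0 su ut FAN) -RintegralZl//; last exact: iS.
  apply: le_Rintegral => //.
  + by apply: RintegrableZ => //; exact: iS.
  + by apply: iS => //; exact: Rintegrable_norm.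
  + by move=> w _; rewrite mulN1r -normrN; exact: ler_norm.
Qed.

Section countably_valued_time.
Variables (V : R -> Omega -> R) (t : R) (J : Omega -> nat) (g : nat -> R).
Hypotheses (aV : nonanticipating V) (pV : premartingale V).
Hypotheses (tt1 : t <= t1) (g0t : forall j, 0 <= g j <= t).
Hypothesis FJ : forall j, F_ X (g j) [set w | J w = j].

Let gt1 j : 0 <= g j <= t1.
Proof. by have /andP[-> /le_trans ->] := g0t j. Qed.

Lemma measurable_discrete_time : measurable_fun setT (fun w => V (g (J w)) w).
Proof.
move=> _ B mB; rewrite setTI.
rewrite (_ : _ @^-1` _ = \bigcup_j ([set w | J w = j] `&` V (g j) @^-1` B)).
  apply: bigcup_measurable => j _; apply: F_measurable (g j) _ _.
  apply: (sigma_setI (F_sigma X _)) => //; apply: F_preimage => //.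
  exact: aV.
by apply/seteqP; split => [w BV|w [j _ [/= ->]]]; first by exists (J w).
Qed.

Variable B : set Omega.
Hypothesis FBJ : forall j, F_ X (g j) (B `&` [set w | J w = j]).

Let BE : B = \bigcup_j (B `&` [set w | J w = j]).
Proof. by apply/seteqP; split => [w Bw|w [j _ []//]]; exists (J w). Qed.

Let mBJ j : measurable (B `&` [set w | J w = j]).
Proof. exact: F_measurable (FBJ j). Qed.

Let tBJ : trivIset setT (fun j => B `&` [set w | J w = j]).
Proof. by move=> i j _ _ [w [[_ /= <-] [_ /= <-]]]. Qed.

Let mB : measurable B.
Proof. by rewrite BE; exact: bigcup_measurable. Qed.

Let iVt : mu.-integrable setT (EFin \o V t).
Proof.
case: pV => + _; apply; have /andP[g0 gt] := g0t 0%N.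
by rewrite (le_trans g0 gt).
Qed.

(** [FBJ] says that B belongs to the past of the random time g (J). On each {J = j} this time is the
    constant g j <= t, and [premartingale_abs] applies there. *)
Lemma discrete_time_abs :
  (\int[mu]_(w in B) `|V (g (J w)) w|%:E <= \int[mu]_(w in B) `|V t w|%:E)%E.
Proof.
have mVJ : measurable_fun setT (fun w => `|V (g (J w)) w|%:E).
  apply/measurable_EFinP/measurableT_comp => //; exact: measurable_discrete_time.
have mVt : measurable_fun setT (fun w => `|V t w|%:E).
  by apply/measurable_EFinP/measurableT_comp => //; exact: Rintegrable_measurable iVt.
rewrite BE ge0_integral_bigcup//; last exact: measurable_funTS.
rewrite ge0_integral_bigcup//; last exact: measurable_funTS.
apply: lee_nneseries => [j _ _|j _]; first exact: integral_ge0.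
rewrite (eq_integral (fun w => `|V (g j) w|%:E)); last first.
  by move=> w; rewrite inE => -[_ /= ->].
have iS (h : Omega -> R) : mu.-integrable setT (EFin \o h) ->
   mu.-integrable (B `&` [set w | J w = j]) (EFin \o (fun w => `|h w|)).
  by move=> ih; apply: integrableS (Rintegrable_norm ih).
have := iS _ (pV.1 _ (gt1 j)); have := iS _ iVt => i1 i2.
rewrite -!EFin_Rintegral// lee_fin; have /andP[g0 gt] := g0t j.
exact: premartingale_abs.
Qed.

Lemma discrete_time_eq : mu.-integrable setT (EFin \o (fun w => V (g (J w)) w)) ->
  \int[mu]_(w in B) V (g (J w)) w = \int[mu]_(w in B) V t w.
Proof.
move=> iVJ; rewrite /Rintegral BE; congr fine.
rewrite integral_bigcup//; last by rewrite -BE; exact: integrableS iVJ.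
rewrite integral_bigcup//; last by rewrite -BE; exact: integrableS iVt.
apply: eq_eseriesr => j _.
rewrite (eq_integral (fun w => (V (g j) w)%:E)); last first.
  by move=> w; rewrite inE => -[_ /= ->].
have i1 := integrableS measurableT (mBJ j) (@subsetT _ _) (pV.1 _ (gt1 j)).
have i2 := integrableS measurableT (mBJ j) (@subsetT _ _) iVt.
rewrite -!EFin_Rintegral//; congr EFin; have /andP[g0 gt] := g0t j.
by apply/esym; apply: pV.2.
Qed.

End countably_valued_time.

Lemma discrete_time_integrable V t (J : Omega -> nat) (g : nat -> R) : nonanticipating V -> premartingale V ->
  t <= t1 -> (forall j, 0 <= g j <= t) ->
  (forall j, F_ X (g j) [set w | J w = j]) ->
  mu.-integrable setT (EFin \o (fun w => V (g (J w)) w)).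
Proof.
move=> aV pV tt1 g0t FJ; apply/integrableP; split.
  by apply/measurable_EFinP; apply: (@measurable_discrete_time V t).
have h := @discrete_time_abs V t J g aV pV tt1 g0t FJ setT.
apply: le_lt_trans (h _) _; first by move=> j; rewrite setTI.
have /integrableP[_ //] : mu.-integrable setT (EFin \o V t).
case: pV => + _; apply; have /andP[g0 gt] := g0t 0%N.
by rewrite (le_trans g0 gt).
Qed.

Lemma capped_min (T : Omega -> \bar R) s t w : (0 <= T w)%E -> s <= t ->
  capped T s w = Num.min (capped T t w) s.
Proof.
move=> T0 st; apply: EFin_inj; rewrite EFin_min !cappedE// [RHS]minC [RHS]minA.
by congr Order.min; rewrite -EFin_min (min_idPl st).
Qed.

(** Says that the grid point following min (T, t) is a stopping time. The event asks for a strict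
    upper bound (j+1)/(k+1). If this number is at most t, it is g, and min (T, g) already decides
    whether T < g; otherwise g = t. *)
Lemma grid_time_F T t k j : stopping_time X T -> 0 <= t ->
  F_ X (Num.min t (j.+1%:R / k.+1%:R))
    [set w | Num.truncn (capped T t w * k.+1%:R) = j].
Proof.
move=> sT t0; have [T0 _] := sT; set g := Num.min _ _.
have g0 : 0 <= g by rewrite le_min t0 divr_ge0.
have gt : g <= t by rewrite ge_min lexx.
have c0 w : 0 <= capped T t w * k.+1%:R by rewrite mulr_ge0// capped_ge0.
rewrite (_ : [set _ | _] =
    (fun w => capped T g w * k.+1%:R) @^-1` `[j%:R, j.+1%:R[%classic).
  apply: F_preimage => //; apply: measurable_funM => //.
  exact: measurable_capped.
have -> : [set w | Num.truncn (capped T t w * k.+1%:R) = j] =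
    [set w | j%:R <= capped T t w * k.+1%:R < j.+1%:R].
  apply/seteqP; split => w /=; first by move=> /eqP; rewrite truncn_eq.
  by move=> h; apply/eqP; rewrite truncn_eq.
apply/seteqP; split => w; rewrite /= in_itv/= (capped_min (T0 w) gt).
all: have ct : capped T t w <= t by exact: capped_le.
all: have [//|gc] := ltP (capped T t w) g.
all: have [bt|/ltW tb] := leP (j.+1%:R / k.+1%:R) t; last
  by rewrite (_ : g = capped T t w)//; apply/eqP; rewrite eq_le gc /g (min_idPl tb).
all: have gE : g * k.+1%:R = j.+1%:R by rewrite /g (min_idPr bt) mulfVK.
- move=> /andP[_ ck]; have : g * k.+1%:R <= capped T t w * k.+1%:R.
    by rewrite ler_wpM2r.
  by rewrite gE leNgt ck.
- by rewrite gE ltxx andbF.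
Qed.

Section optional_stopping.
Variables (V : R -> Omega -> R) (T : Omega -> \bar R).
Hypotheses (aV : nonanticipating V) (pV : premartingale V).
Hypothesis sT : stopping_time X T.
Hypothesis mVT : forall s, 0 <= s <= t1 ->
  measurable_fun setT (fun w => V (capped T s w) w).
Hypothesis rcV : {ae mu, forall w, forall s, 0 <= s < t1 ->
  V v w @[v --> s^'+] --> V s w}.

(** T is approximated from the right by countably valued times, for which the equality is a sum over
    their values. Uniform integrability and right continuity give the limit. The inclusion of A in
    {s < T} places A in the past of every approximating time. *)
Let optional_stopping_after s t A : 0 <= s -> s <= t -> t <= t1 ->
  F_ X s A -> A `<=` [set w | (s%:E < T w)%E] ->
  mu.-integrable setT (EFin \o (fun w => V (capped T t w) w)) /\
  \int[mu]_(w in A) V (capped T t w) w = \int[mu]_(w in A) V t w.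
Proof.
move=> s0 st tt1 FA AT; have t0 := le_trans s0 st; have [T0 _] := sT.
pose J k w := Num.truncn (capped T t w * k.+1%:R).
pose g k j : R := Num.min t (j.+1%:R / k.+1%:R).
have g0t k j : 0 <= g k j <= t by rewrite /g le_min t0 divr_ge0//= ge_min lexx.
have FJ k j : F_ X (g k j) [set w | J k w = j] by exact: grid_time_F.
have gJ k w : g k (J k w) = grid t k (capped T t w) by [].
have ct w : 0 <= capped T t w <= t by rewrite capped_ge0// capped_le.
(* If g k j < s the intersection is empty: on A the capped time is at least s, hence so is the grid
   point after it. *)
have FAJ k j : F_ X (g k j) (A `&` [set w | J k w = j]).
  have [sg|gs] := leP s (g k j).
    by apply: (sigma_setI (F_sigma X _)) => //; exact: F_mono sg _ FA.
  rewrite (_ : _ `&` _ = set0); first exact: sigma_set0 (F_sigma X _).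
  apply/seteqP; split => w // [/AT /= sTw Jw]; move: gs; rewrite -Jw gJ ltNge.
  move/negP; apply; have /andP[+ _] := grid_ge k (ct w); apply: le_trans.
  by rewrite -lee_fin cappedE// le_min lee_fin st ltW.
have iVJ k := discrete_time_integrable aV pV tt1 (g0t k) (FJ k).
have iVt : mu.-integrable setT (EFin \o V t) by apply: pV.1; rewrite t0.
apply: (@uniform_integrable_limit _ _ _ mu (fun k w => V (g k (J k w)) w)).
- by move=> k; exact: Rintegrable_measurable (iVJ k).
- by apply: mVT; rewrite t0.
- exact: iVt.
- apply: filterS rcV => w rc.
  have := @grid_right_cvg _ _ (V ^~ w) t (capped T t w) (ct w).
  apply => cwt; apply: rc; have /andP[-> _] := ct w.
  exact: lt_le_trans cwt tt1.
(* The event that |V| at the grid time exceeds K is in the past of that time, so the submartingale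
   bound is exactly the tail condition. *)
- move=> k K; apply: (@discrete_time_abs V t (J k) (g k)) => // j.
  rewrite (_ : _ `&` _ = [set w | K < `|V (g k j) w|] `&` [set w | J k w = j]).
    apply: (sigma_setI (F_sigma X _)) => //.
    apply/(sub_sigmaE (F_sigma X _)).
    apply: (@measurable_gtset _ (Ft (g k j)) R); apply: aV.
    by have /andP[-> /le_trans ->] := g0t k j.
  by apply/seteqP; split => w [/= Kw Jw]; move: Kw; rewrite ?Jw => Kw; split.
- exact: F_measurable FA.
- by move=> k; apply: (@discrete_time_eq V t (J k) (g k)).
Qed.

(** On {T <= s} the stopped values at s and t coincide; on the rest both integrals are compared with
    that of V at the fixed times. *)
Lemma optional_stopping : premartingale (fun s w => V (capped T s w) w).
Proof.
have [T0 TF] := sT.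
have iV s : 0 <= s <= t1 ->
    mu.-integrable setT (EFin \o (fun w => V (capped T s w) w)).
  move=> /andP[s0 st1].
  (* The empty event is chosen because only the integrability half is wanted here. *)
  have [||//] := @optional_stopping_after s s set0 s0 (lexx s) st1.
    exact: sigma_set0 (F_sigma X _).
  by [].
split => // s t A s0 st tt1 FA; have t0 := le_trans s0 st.
have st1 := le_trans st tt1.
pose P := [set w | (T w <= s%:E)%E].
have FP : F_ X s P by exact: TF.
have FAP := sigma_setI (F_sigma X s) FA FP.
have FAN := sigma_setD (F_sigma X s) FA FP.
have mAP := F_measurable FAP; have mAN := F_measurable FAN.
have AE : A = (A `&` P) `|` (A `\` P) by rewrite setUIDK.
have spl (h : Omega -> R) : mu.-integrable setT (EFin \o h) ->
    \int[mu]_(w in A) h w =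
    \int[mu]_(w in A `&` P) h w + \int[mu]_(w in A `\` P) h w.
  move=> ih; rewrite {1}AE Rintegral_setU//.
    by rewrite -AE; apply: integrableS ih => //; exact: F_measurable FA.
  by apply/disj_set2P/seteqP; split => w //= [[_ Pw] [_ nPw]].
rewrite !spl; [|by apply: iV; rewrite ?s0 ?t0..].
congr (_ + _).
  apply: eq_Rintegral => w; rewrite inE => -[_ /= Tws].
  congr (V _ w); apply: EFin_inj; rewrite !cappedE//.
  by rewrite !min_r// (le_trans Tws) ?lee_fin.
have AT : A `\` P `<=` [set w | (s%:E < T w)%E].
  by move=> w [_ /negP]; rewrite /P /= -ltNge.
have [_ ->] := optional_stopping_after s0 st tt1 FAN AT.
rewrite (pV.2 _ _ _ s0 st tt1 FAN); apply: eq_Rintegral => w.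
rewrite inE => /AT /= sTw; congr (V _ w); apply: EFin_inj; rewrite cappedE//.
by rewrite min_l// ltW.
Qed.

End optional_stopping.

End martingales.

(** * Integration by parts *)

Section martingale_weights.
Context {R : realType} {E : ptopologicalType} {d : measure_display}
  {Omega : measurableType d}.
Variable X : borel_right_process R E Omega.
Variables (mu : probability Omega R) (t1 : R) (N : R -> Omega -> R).
Hypotheses (aN : nonanticipating X t1 N) (pN : premartingale X mu t1 N).

Local Notation Ft t := (g_sigma_algebraType (F_ X t)).

Variables (s u : R).
Hypotheses (s0 : 0 <= s) (su : s <= u) (ut1 : u <= t1).

Let s01 : 0 <= s <= t1. Proof. by rewrite s0 (le_trans su ut1). Qed.
Let u01 : 0 <= u <= t1. Proof. by rewrite (le_trans s0 su) ut1. Qed.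
Let mNs : measurable_fun setT (N s). Proof. exact: Ft_id (aN s01). Qed.
Let mNu : measurable_fun setT (N u). Proof. exact: Ft_id (aN u01). Qed.

(** The submartingale property of |N| on events of F_s, extended to weights. *)
Lemma weighted_abs_le (xi : Omega -> \bar R) :
  measurable_fun [set: Ft s] xi -> (forall w, 0 <= xi w)%E ->
  (\int[mu]_w (xi w * `|N s w|%:E) <= \int[mu]_w (xi w * `|N u w|%:E))%E.
Proof.
move=> mxi xi0.
apply: (weighted_integral_le (F_sigma X s) (@F_measurable _ _ _ _ X s)) => //.
- exact: measurableT_comp.
- exact: measurableT_comp.
move=> A FA; have mA := F_measurable FA.
have iS (h : Omega -> R) : mu.-integrable setT (EFin \o h) ->
   mu.-integrable A (EFin \o (fun w => `|h w|)).
  by move=> ih; apply: integrableS (Rintegrable_norm ih).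
have i1 := iS _ (pN.1 _ s01); have i2 := iS _ (pN.1 _ u01).
by rewrite -!EFin_Rintegral// lee_fin; exact: premartingale_abs aN pN _ _ _ FA.
Qed.

Lemma weighted_integrable (xi : Omega -> R) : measurable_fun [set: Ft s] xi ->
  mu.-integrable setT (EFin \o (fun w => xi w * N u w)) ->
  mu.-integrable setT (EFin \o (fun w => xi w * N s w)).
Proof.
move=> mxi /integrableP[_ iu]; apply/integrableP; split.
  by apply/measurable_EFinP; apply: measurable_funM => //; exact: Ft_id mxi.
apply: le_lt_trans iu.
under eq_integral do rewrite /= normrM EFinM.
under [leRHS]eq_integral do rewrite /= normrM EFinM.
apply: weighted_abs_le => //; apply/measurable_EFinP; exact: measurableT_comp.
Qed.

(** The weight may be unbounded: integrability at the later time u is assumed, and at s it follows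
    from the submartingale bound. N has no sign, so the equality is first put between nonnegative
    weights and [xi] is split into positive and negative part. *)
Lemma weighted_eq (xi : Omega -> R) : measurable_fun [set: Ft s] xi ->
  mu.-integrable setT (EFin \o (fun w => xi w * N u w)) ->
  \int[mu]_w (xi w * N s w) = \int[mu]_w (xi w * N u w).
Proof.
move=> mxi iu; have is_ := weighted_integrable mxi iu.
have mxi' := Ft_id mxi.
(* q and p = q + (N_s - N_u) are nonnegative with equal integrals on F_s, so [weighted_integral_eq]
   applies to them and the difference isolates N_s - N_u. *)
pose q w := `|N s w| + `|N u w|.
pose p w := q w + (N s w - N u w).
have mq : measurable_fun setT q.
  by apply: measurable_funD; exact: measurableT_comp.
have mp : measurable_fun setT p.
  by apply: measurable_funD => //; exact: measurable_funB.
have q0 w : 0 <= q w by rewrite addr_ge0.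
have p0 w : 0 <= p w.
  rewrite /p /q; have := ler_norm (N u w); have := ler_norm (- N s w).
  by rewrite normrN; lra.
have iq : mu.-integrable setT (EFin \o q).
  by apply: RintegrableD => //; apply: Rintegrable_norm => //; exact: pN.1.
have ip : mu.-integrable setT (EFin \o p).
  by apply: RintegrableD => //; apply: RintegrableB => //; exact: pN.1.
have pq A : F_ X s A -> (\int[mu]_(w in A) (p w)%:E = \int[mu]_(w in A) (q w)%:E)%E.
  move=> FA; have mA := F_measurable FA.
  have iS (h : Omega -> R) : mu.-integrable setT (EFin \o h) ->
     mu.-integrable A (EFin \o h) by move=> ih; exact: integrableS ih.
  rewrite -!EFin_Rintegral//; [|exact: iS..]; congr EFin.
  rewrite RintegralD//; [|exact: iS|apply: RintegrableB => //; apply: iS; exact: pN.1].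
  rewrite RintegralB//; [|by apply: iS; apply: pN.1..].
  by rewrite (pN.2 _ _ _ s0 su ut1 FA) subrr addr0.
have key (x : Omega -> R) : measurable_fun [set: Ft s] x -> (forall w, 0 <= x w) ->
    (forall w, x w <= `|xi w|) ->
    \int[mu]_w (x w * N s w) = \int[mu]_w (x w * N u w).
  move=> mx x0 xxi; have mx' := Ft_id mx.
  have ix (h : Omega -> R) : measurable_fun setT h ->
     mu.-integrable setT (EFin \o (fun w => xi w * h w)) ->
     mu.-integrable setT (EFin \o (fun w => x w * h w)).
    move=> mh ih; apply: Rintegrable_le (Rintegrable_norm ih) => //.
      exact: measurable_funM.
    by move=> w _; rewrite !normrM ler_wpM2r// ger0_norm.
  have ixs := ix _ mNs is_; have ixu := ix _ mNu iu.
  have ixq : mu.-integrable setT (EFin \o (fun w => x w * q w)).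
    have h := RintegrableD measurableT (Rintegrable_norm ixs) (Rintegrable_norm ixu).
    apply: eq_integrable h => // w _ /=; rewrite /q mulrDr !normrM.
    by rewrite (ger0_norm (x0 w)).
  have E1 : \int[mu]_w (x w * p w) = \int[mu]_w (x w * q w).
    rewrite /Rintegral; congr fine.
    under eq_integral do rewrite EFinM.
    under [RHS]eq_integral do rewrite EFinM.
    apply: (weighted_integral_eq (F_sigma X s) (@F_measurable _ _ _ _ X s)) => //.
    - exact/measurable_EFinP.
  have ixB : mu.-integrable setT (EFin \o (fun w => x w * N s w - x w * N u w)).
    exact: RintegrableB.
  have : \int[mu]_w (x w * p w) =
      \int[mu]_w (x w * q w) + (\int[mu]_w (x w * N s w) - \int[mu]_w (x w * N u w)).
    rewrite -RintegralB// -RintegralD//; apply: eq_Rintegral => w _.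
    by rewrite /p; ring.
  rewrite E1; lra.
pose xp w := Num.max (xi w) 0; pose xn w := Num.max (- xi w) 0.
have mxp : measurable_fun [set: Ft s] xp by exact: measurable_maxr.
have mxn : measurable_fun [set: Ft s] xn.
  by apply: measurable_maxr => //; exact: measurableT_comp.
have xp0 w : 0 <= xp w by rewrite le_max lexx orbT.
have xn0 w : 0 <= xn w by rewrite le_max lexx orbT.
have xpx w : xp w <= `|xi w| by rewrite ge_max ler_norm normr_ge0.
have xnx w : xn w <= `|xi w| by rewrite ge_max -normrN ler_norm normr_ge0.
have xE w : xi w = xp w - xn w.
  rewrite /xp /xn !maxEle.
  by case: (lerP (xi w) 0) => ?; case: (lerP (- xi w) 0) => ?; lra.
have ip' (x h : Omega -> R) : measurable_fun [set: Ft s] x -> (forall w, 0 <= x w) ->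
     (forall w, x w <= `|xi w|) -> measurable_fun setT h ->
     mu.-integrable setT (EFin \o (fun w => xi w * h w)) ->
     mu.-integrable setT (EFin \o (fun w => x w * h w)).
  move=> mx x0 xxi mh ih; apply: Rintegrable_le (Rintegrable_norm ih) => //.
    by apply: measurable_funM => //; exact: Ft_id mx.
  by move=> w _; rewrite !normrM ler_wpM2r// ger0_norm.
have spl (h : Omega -> R) : measurable_fun setT h ->
    mu.-integrable setT (EFin \o (fun w => xi w * h w)) ->
    \int[mu]_w (xi w * h w) = \int[mu]_w (xp w * h w) - \int[mu]_w (xn w * h w).
  move=> mh ih; rewrite -RintegralB//; [|exact: ip'..].
  by apply: eq_Rintegral => w _; rewrite {1}xE mulrBl.
by rewrite !spl// !key.
Qed.

End martingale_weights.

Lemma lebesgue_aeS {R : realType} (P Q : R -> Prop) : (forall s, P s -> Q s) ->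
  {ae @lebesgue_measure R, forall s, P s} ->
  {ae @lebesgue_measure R, forall s, Q s}.
Proof.
exact: (@filterS _ _ (ae_filter_ringOfSetsType (@lebesgue_measure R))).
Qed.

(** * Exchange of time integral and expectation *)

Section time_fubini.
Context {R : realType} {d : measure_display} {Omega : measurableType d}.
Variable mu : probability Omega R.
Local Notation leb := (@lebesgue_measure R).

Definition jointly_measurable (t : R) (Y : R -> Omega -> R) : Prop :=
  measurable_fun [set: R * Omega] (fun p => Y (clamp t p.1) p.2).

Variables (t : R) (Y : R -> Omega -> R).
Hypotheses (t0 : 0 <= t) (jY : jointly_measurable t Y).

Let cut (p : R * Omega) : R :=
  if (0 <= p.1) && (p.1 <= t) then Y (clamp t p.1) p.2 else 0.

Let mcut : measurable_fun setT cut.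
Proof.
apply: measurable_fun_ifT => //.
by apply: measurable_and; apply: measurable_fun_ler => //.
Qed.

Let cutE w (s : R) : ((EFin \o (Y ^~ w)) \_ `[0, t]) s = (cut (s, w))%:E.
Proof.
rewrite /cut/= patchE mem_setE/= in_itv/=.
by case: ifPn => // h; rewrite clamp_id.
Qed.

Lemma jointly_measurable_section w : measurable_fun `[0, t] (Y ^~ w).
Proof.
have h : measurable_fun [set: R] (fun s => cut (s, w)).
  exact: (measurableT_comp mcut (measurable_fun_pair (@measurable_id _ R setT) (measurable_cst w))).
apply: (@eq_measurable_fun _ _ _ _ _ (fun s => cut (s, w))); last first.
  exact: measurable_funTS.
by move=> s; rewrite inE/= in_itv/= /cut/= => st; rewrite st clamp_id.
Qed.

Lemma jointly_measurable_time s : 0 <= s <= t -> measurable_fun setT (Y s).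
Proof.
move=> st; apply: eq_measurable_fun (measurableT_comp jY
  (measurable_fun_pair (@measurable_cst _ _ Omega R setT s) (@measurable_id _ Omega setT))).
by move=> w _ /=; rewrite clamp_id.
Qed.

Let mcutE : measurable_fun setT (EFin \o cut).
Proof. exact/measurable_EFinP. Qed.

(** The parameter f serves the identity and the absolute value at once. *)
Let int_time w (f : \bar R -> \bar R) : f 0%E = 0%E ->
  (\int[leb]_(s in `[0%R, t]) f (Y s w)%:E = \int[leb]_s f (cut (s, w))%:E)%E.
Proof.
move=> f0; rewrite integral_mkcond; apply: eq_integral => s _.
rewrite -cutE !patchE; case: ifP => // _; exact: esym f0.
Qed.

Let int_omega (f : \bar R -> \bar R) : f 0%E = 0%E ->
  (\int[leb]_(s in `[0%R, t]) \int[mu]_w f (Y s w)%:E =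
   \int[leb]_s \int[mu]_w f (cut (s, w))%:E)%E.
Proof.
move=> f0; rewrite integral_mkcond; apply: eq_integral => s _.
rewrite patchE; case: ifPn => sD.
  by apply: eq_integral => w _; rewrite -cutE patchE sD.
rewrite integral0_eq// => w _; by rewrite -cutE patchE (negbTE sD) f0.
Qed.

Lemma time_tonelli :
  (\int[leb]_(s in `[0%R, t]) \int[mu]_w `|Y s w|%:E =
   \int[mu]_w \int[leb]_(s in `[0%R, t]) `|Y s w|%:E)%E.
Proof.
rewrite (int_omega abse0).
under [RHS]eq_integral do rewrite (int_time _ abse0).
apply: (@fubini_tonelli _ _ (measurableTypeR R) Omega R leb mu
  (fun p => `|(cut p)%:E|)%E) => //.
exact: measurableT_comp.
Qed.

Lemma measurable_abs_time : measurable_fun `[0, t]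
  (fun s => \int[mu]_w `|Y s w|%:E)%E.
Proof.
have h : measurable_fun [set: measurableTypeR R]
    (fun s => \int[mu]_w `|(cut (s, w))%:E|)%E.
  apply: (@measurable_fun_fubini_tonelli_F _ _ (measurableTypeR R) Omega R mu
    (fun p => `|(cut p)%:E|)%E) => //; exact: measurableT_comp.
apply: (@eq_measurable_fun _ _ _ _ _ (fun s => \int[mu]_w `|(cut (s, w))%:E|)%E).
  move=> s sD; apply: eq_integral => w _.
  by rewrite -cutE patchE sD.
exact: measurable_funTS.
Qed.

Lemma measurable_time_abs : measurable_fun setT
  (fun w => \int[leb]_(s in `[0%R, t]) `|Y s w|%:E)%E.
Proof.
under eq_fun do rewrite (int_time _ abse0).
apply: (@measurable_fun_fubini_tonelli_G _ _ (measurableTypeR R) Omega R leb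
  (fun p => `|(cut p)%:E|)%E) => //; exact: measurableT_comp.
Qed.

Hypothesis finY :
  (\int[mu]_w \int[leb]_(s in `[0%R, t]) `|Y s w|%:E < +oo)%E.

Let icut : (leb \x mu)%E.-integrable setT (EFin \o cut).
Proof.
apply/(@integrable21ltyP _ _ (measurableTypeR R) Omega R leb mu (EFin \o cut) mcutE).
by apply: le_lt_trans finY; under [leRHS]eq_integral do rewrite (int_time _ abse0).
Qed.

Lemma ae_time_integrable :
  {ae mu, forall w, leb.-integrable `[0, t] (EFin \o (Y ^~ w))}.
Proof.
have := @ae_integrable2 _ _ (measurableTypeR R) Omega R leb mu (EFin \o cut) icut.
apply: filterS => w iw; apply/(@integrable_mkcond _ _ _ leb `[0, t]%classic (EFin \o (Y ^~ w)) (measurable_itv _)).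
by apply: eq_integrable iw => // s _; rewrite cutE.
Qed.

Lemma ae_integrable_time :
  {ae leb, forall s, 0 <= s <= t -> mu.-integrable setT (EFin \o Y s)}.
Proof.
have := @ae_integrable1 _ _ (measurableTypeR R) Omega R leb mu (EFin \o cut) icut.
apply: filterS => s is_ st; apply: eq_integrable is_ => // w _.
by rewrite /= -cutE patchE ifT// mem_setE/= in_itv.
Qed.

Lemma measurable_expectation_time : measurable_fun `[0, t]
  (fun s => \int[mu]_w (Y s w)%:E)%E.
Proof.
have h := @measurable_fubini_F _ _ (measurableTypeR R) Omega R leb mu _ icut.
apply: (@eq_measurable_fun _ _ _ _ _ (fubini_F mu (EFin \o cut))).
  by move=> s sD; apply: eq_integral => w _; rewrite /= -cutE patchE sD.
exact: measurable_funTS.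
Qed.

Let pintE w : (pint Y t w)%:E = (fine (\int[leb]_s (cut (s, w))%:E))%:E.
Proof. by rewrite /pint /Rintegral (@int_time w id). Qed.

Let iG : mu.-integrable setT (fubini_G leb (EFin \o cut)).
Proof.
have mG := @measurable_fubini_G _ _ (measurableTypeR R) Omega R leb mu _ icut.
apply/integrableP; split => //.
have /(@integrable21ltyP _ _ (measurableTypeR R) Omega R leb mu (EFin \o cut) mcutE) := icut.
apply: le_lt_trans; apply: ge0_le_integral => //.
- exact: measurableT_comp.
- apply: (@measurable_fun_fubini_tonelli_G _ _ (measurableTypeR R) Omega R leb
    (fun p => `|(cut p)%:E|)%E) => //; exact: measurableT_comp.
- move=> w _; apply: le_abse_integral => //.
  exact: (measurableT_comp mcutE (measurable_fun_pair
    (@measurable_id _ (measurableTypeR R) setT) (measurable_cst w))).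
Qed.

(** [pint] passes through [fine], so it agrees with the extended integral only where that is finite,
    which is almost everywhere. *)
Let fubini_pint : {ae mu, forall w, fubini_G leb (EFin \o cut) w = (pint Y t w)%:E}.
Proof.
apply: filterS (integrable_ae measurableT iG) => w /(_ I) h.
by rewrite pintE fineK.
Qed.

Lemma measurable_pint : measurable_fun setT (pint Y t).
Proof.
have mG := @measurable_fubini_G _ _ (measurableTypeR R) Omega R leb mu _ icut.
have mf : measurable_fun setT (fun w => fine (fubini_G leb (EFin \o cut) w)).
  exact/measurableT_comp.
apply: eq_measurable_fun mf => w _ /=.
by apply: EFin_inj; rewrite pintE.
Qed.

Lemma pint_integrable : mu.-integrable setT (EFin \o pint Y t).
Proof.
have mp := measurable_pint.
apply/integrableP; split; first exact/measurable_EFinP.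
have /integrableP[mG] := iG; apply: le_lt_trans.
rewrite le_eqVlt; apply/orP; left; apply/eqP; apply: ae_eq_integral => //.
- by apply/measurable_EFinP; exact: measurableT_comp.
- exact: measurableT_comp.
- by apply: filterS fubini_pint => w -> _.
Qed.

Lemma time_fubini : (\int[leb]_(s in `[0%R, t]) \int[mu]_w (Y s w)%:E =
  (\int[mu]_w pint Y t w)%:E)%E.
Proof.
rewrite (@int_omega id)// EFin_Rintegral//; last exact: pint_integrable.
have /integrableP[mG _] := iG.
transitivity (\int[mu]_w fubini_G leb (EFin \o cut) w)%E.
  exact: (@Fubini _ _ (measurableTypeR R) Omega R leb mu (EFin \o cut) icut).
apply: ae_eq_integral => //.
- by apply/measurable_EFinP; exact: measurable_pint.
- by apply: filterS fubini_pint => w -> _.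
Qed.

End time_fubini.

(** By Tonelli a comparison of expectations at each fixed time integrates to one over [0, t]. *)
Lemma time_abs_le {R : realType} {d : measure_display} {Omega : measurableType d}
    (mu : probability Omega R) (t : R) (Y Z : R -> Omega -> R) : 0 <= t ->
  jointly_measurable t Y -> jointly_measurable t Z ->
  (forall s, 0 <= s <= t ->
    (\int[mu]_w `|Y s w|%:E <= \int[mu]_w `|Z s w|%:E)%E) ->
  (\int[mu]_w \int[lebesgue_measure]_(s in `[0%R, t]) `|Y s w|%:E <=
   \int[mu]_w \int[lebesgue_measure]_(s in `[0%R, t]) `|Z s w|%:E)%E.
Proof.
move=> t0 jY jZ YZ; rewrite -!time_tonelli//.
apply: ge0_le_integral => //.
- by move=> s _; exact: integral_ge0.
- exact: measurable_abs_time.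
- exact: measurable_abs_time.
Qed.

Lemma Rintegral_after {R : realType} (f : R -> R) (s u : R) :
  0 <= s -> s <= u ->
  (@lebesgue_measure R).-integrable `[0, u] (EFin \o f) ->
  \int[lebesgue_measure]_(v in `[0, u]) ((s < v)%R%:R * f v) =
  \int[lebesgue_measure]_(v in `[0, u]) f v - \int[lebesgue_measure]_(v in `[0, s]) f v.
Proof.
move=> s0 su iF; rewrite (Rintegral_itvB iF) ?bnd_simp//.
rewrite [LHS]Rintegral_mkcond [RHS]Rintegral_mkcond.
apply: eq_Rintegral => v _; rewrite !patchE !mem_setE/= !in_itv/=.
case: (ltP s v) => sv; rewrite ?mul1r ?mul0r ?(le_trans s0 (ltW sv))//=.
by case: ifP.
Qed.

Lemma Rintegral_indicM {d} {T : measurableType d} {R : realType}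
    (mu : measure T R) (A : set T) (f : T -> R) :
  \int[mu]_(w in A) f w = \int[mu]_w (\1_A w * f w).
Proof.
rewrite Rintegral_mkcond; apply: eq_Rintegral => w _.
by rewrite patchE indicE; case: (w \in A); rewrite ?mul1r ?mul0r.
Qed.

Section premartingale_by_parts.
Context {R : realType} {E : ptopologicalType} {d : measure_display}
  {Omega : measurableType d}.
Variable X : borel_right_process R E Omega.
Variables (mu : probability Omega R) (t1 : R).
Local Notation leb := (@lebesgue_measure R).
Local Notation Ft t := (g_sigma_algebraType (F_ X t)).

Lemma progressive_jointly (Y : R -> Omega -> R) t :
  progressive X Y -> 0 <= t -> jointly_measurable t Y.
Proof. by move=> pY t0; exact: (progressive_joint pY t0). Qed.

Lemma jointly_measurableM t (Y Z : R -> Omega -> R) :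
  jointly_measurable t Y -> jointly_measurable t Z ->
  jointly_measurable t (fun s w => Y s w * Z s w).
Proof. by move=> jY jZ; exact: measurable_funM. Qed.

Lemma progressiveM (Y Z : R -> Omega -> R) : progressive X Y ->
  progressive X Z -> progressive X (fun s w => Y s w * Z s w).
Proof. by move=> pY pZ t t0; exact: measurable_funM (pY t t0) (pZ t t0). Qed.

Variables (N b : R -> Omega -> R) (B0 C : R).
Hypotheses (t10 : 0 <= t1) (prN : progressive X N) (prb : progressive X b).
Hypothesis pN : premartingale X mu t1 N.
Hypothesis bC : forall w,
  (\int[leb]_(s in `[0%R, t1]) `|b s w|%:E <= C%:E)%E.

Let aN : nonanticipating X t1 N.
Proof. by move=> s /andP[s0 _]; exact: progressive_adapted prN s0. Qed.

Let C0 : 0 <= C.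
Proof. by rewrite -lee_fin; apply: le_trans (bC point); exact: integral_ge0. Qed.

Let mb (w : Omega) (t : R) : 0 <= t -> measurable_fun `[0, t] (b ^~ w).
Proof.
by move=> t0; apply: jointly_measurable_section => //; exact: progressive_joint prb t0.
Qed.

Let ib (w : Omega) (t : R) : 0 <= t <= t1 -> leb.-integrable `[0, t] (EFin \o (b ^~ w)).
Proof.
move=> /andP[t0 tt1].
apply: (@integrableS _ _ _ leb `[0, t1]%classic).
- exact: measurable_itv.
- exact: measurable_itv.
- by move=> s /=; rewrite !in_itv/= => /andP[-> /le_trans ->].
apply/integrableP; split; first by apply/measurable_EFinP; exact: mb.
by apply: le_lt_trans (bC w) _; rewrite ltry.
Qed.

Let pint_le (w : Omega) (t : R) : 0 <= t <= t1 -> `|pint b t w| <= C.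
Proof.
move=> /andP[t0 tt1]; have it := ib w (introT andP (conj t0 tt1)).
apply: (le_trans (le_normr_Rintegral _ it)) => //.
rewrite -lee_fin EFin_Rintegral//; last exact: Rintegrable_norm it.
apply: le_trans (bC w).
apply: ge0_subset_integral => //.
- by apply/measurable_EFinP/measurableT_comp => //; exact: mb.
- by move=> s /=; rewrite !in_itv/= => /andP[-> /le_trans ->].
Qed.

(* |N| is a submartingale, so |N_s| may be replaced by |N_u| against the
   F_s-measurable weight |b_s|, and then b integrates out. *)
Let finite_u u : 0 <= u <= t1 ->
  (\int[mu]_w \int[leb]_(s in `[0%R, u]) `|(b s w * N u w)|%:E < +oo)%E.
Proof.
move=> /andP[u0 ut1]; have iNu := pN.1 u (introT andP (conj u0 ut1)).
have mNu := Rintegrable_measurable iNu.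
apply: (@le_lt_trans _ _ (\int[mu]_w (C%:E * `|N u w|%:E))%E); last first.
  have /integrableP[_] := RintegrableZ measurableT C (Rintegrable_norm iNu).
  by under eq_integral do rewrite /= ger0_norm ?mulr_ge0// EFinM.
apply: ge0_le_integral => //.
- by move=> w _; exact: integral_ge0.
- apply: measurable_time_abs => //; apply: jointly_measurableM.
    exact: progressive_jointly prb u0.
  exact: (measurableT_comp mNu measurable_snd).
- by apply: emeasurable_funM => //; apply/measurable_EFinP/measurableT_comp.
- move=> w _; under eq_integral do rewrite normrM mulrC EFinM.
  rewrite ge0_integralZl//; last first.
    by apply/measurable_EFinP/measurableT_comp => //; exact: mb.
  rewrite muleC lee_wpmul2r//; apply: le_trans (bC w).
  apply: ge0_subset_integral => //.
  + by apply/measurable_EFinP/measurableT_comp => //; exact: mb.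
  + by move=> s /=; rewrite !in_itv/= => /andP[-> /le_trans ->].
Qed.

Let finite_s u : 0 <= u <= t1 ->
  (\int[mu]_w \int[leb]_(s in `[0%R, u]) `|(b s w * N s w)|%:E < +oo)%E.
Proof.
move=> /andP[u0 ut1]; have iNu := pN.1 u (introT andP (conj u0 ut1)).
have mNu := Rintegrable_measurable iNu.
have jb := progressive_jointly prb u0; have jN := progressive_jointly prN u0.
apply: le_lt_trans (@finite_u u (introT andP (conj u0 ut1))).
apply: time_abs_le => //.
- exact: jointly_measurableM.
- by apply: jointly_measurableM => //; exact: (measurableT_comp mNu measurable_snd).
move=> s /andP[s0 su].
under eq_integral do rewrite normrM EFinM.
under [leRHS]eq_integral do rewrite normrM EFinM.
apply: (weighted_abs_le aN pN s0 su ut1) => [|w]; last by rewrite lee_fin.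
apply/measurable_EFinP/measurableT_comp => //; exact: progressive_adapted prb s0.
Qed.

(** At each time v in ]s, u] the martingale property gives E [1_A b_v N_u] = E [1_A b_v N_v], and
    Fubini integrates this over v. *)
Let increment s u A (s0 : 0 <= s) (su : s <= u) (ut1 : u <= t1) : F_ X s A ->
  \int[mu]_w (\1_A w * (N u w * (pint b u w - pint b s w) -
     (pint (fun v w => b v w * N v w) u w - pint (fun v w => b v w * N v w) s w))) = 0.
Proof.
move=> FA; have u0 := le_trans s0 su.
have u01 : 0 <= u <= t1 by rewrite u0.
have mA := F_measurable FA.
have iNu := pN.1 u u01; have mNu := Rintegrable_measurable iNu.
have jb := progressive_jointly prb u0; have jN := progressive_jointly prN u0.
have jNu : jointly_measurable u (fun _ w => N u w).
  exact: (measurableT_comp mNu measurable_snd).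
have jbN := jointly_measurableM jb jN; have jbNu := jointly_measurableM jb jNu.
(* The factor [s < v] restricts the time integral to ]s, u], where 1_A is F_v-measurable. *)
pose I (v : R) (w : Omega) : R := \1_A w * (s < v)%R%:R.
have jI : jointly_measurable u I.
  apply: measurable_funM.
    exact: (measurableT_comp (measurable_indic _) measurable_snd).
  have m : measurable_fun [set: R * Omega] (fun p => (s < clamp u p.1)%R).
    apply: measurable_fun_ltr => //.
    exact: (measurableT_comp (measurable_clamp u) measurable_fst).
  have := measurable_fun_ifT m (@measurable_cst _ _ (R * Omega)%type R setT 1)
    (@measurable_cst _ _ (R * Omega)%type R setT 0).
  by congr measurable_fun; apply/funext => p /=; case: ifP.
pose H v w := I v w * (b v w * N u w - b v w * N v w).
have jH : jointly_measurable u H.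
  by apply: jointly_measurableM => //; exact: measurable_funB.
have finH : (\int[mu]_w \int[leb]_(v in `[0%R, u]) `|H v w|%:E < +oo)%E.
  pose Z v w := `|b v w * N u w| + `|b v w * N v w|.
  have jZ : jointly_measurable u Z.
    by apply: measurable_funD; exact: measurableT_comp.
  apply: (@le_lt_trans _ _ (\int[mu]_w \int[leb]_(v in `[0%R, u]) `|Z v w|%:E)%E).
    apply: time_abs_le => // v v01; apply: ge0_le_integral => //.
    - apply/measurable_EFinP/measurableT_comp => //.
      exact: (jointly_measurable_time jH v01).
    - apply/measurable_EFinP/measurableT_comp => //.
      exact: (jointly_measurable_time jZ v01).
    - move=> w _; rewrite lee_fin [leRHS]ger0_norm ?addr_ge0// /H normrM.
      apply: le_trans (ler_normB _ _); rewrite ler_piMl//.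
      rewrite /I indicE; case: (w \in A) => /=; rewrite ?mul0r ?normr0 ?mul1r//.
      by case: (s < v); rewrite ?normr1 ?normr0.
  have mZ1 w : measurable_fun `[0, u] (fun v => `|b v w * N u w|%:E).
    apply/measurable_EFinP/measurableT_comp => //.
    exact: (jointly_measurable_section jbNu).
  have mZ2 w : measurable_fun `[0, u] (fun v => `|b v w * N v w|%:E).
    apply/measurable_EFinP/measurableT_comp => //.
    exact: (jointly_measurable_section jbN).
  rewrite (eq_integral (fun w =>
      (\int[leb]_(v in `[0%R, u]) `|b v w * N u w|%:E) +
      (\int[leb]_(v in `[0%R, u]) `|b v w * N v w|%:E))%E); last first.
    move=> w _; rewrite -ge0_integralD//; [|exact: mZ1|exact: mZ2].
    by apply: eq_integral => v _; rewrite ger0_norm ?addr_ge0// EFinD.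
  rewrite ge0_integralD//; first last.
  - exact: measurable_time_abs.
  - by move=> w _; exact: integral_ge0.
  - exact: measurable_time_abs.
  - by move=> w _; exact: integral_ge0.
  exact: (lte_add_pinfty (finite_u u01) (finite_s u01)).
have mA1 v : s <= v -> measurable_fun [set: Ft v] (\1_A : Omega -> R).
  move=> sv; apply: (@measurable_indic _ (Ft v)).
  by apply/(sub_sigmaE (F_sigma X v)); exact: F_mono sv _ FA.
(* Integrability of b_v N_u is known only for almost every v; for those, [weighted_eq] with the
   weight 1_A b_v gives expectation zero. *)
have EH : {ae leb, forall v, 0 <= v <= u -> (\int[mu]_w (H v w)%:E = 0)%E}.
  apply: lebesgue_aeS (ae_integrable_time jbNu (finite_u u01)) => v iv /[dup] v01 /andP[v0 vu].
  have [sv|vs] := ltP s v; last first.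
    rewrite integral0_eq// => w _.
    by rewrite /H /I ltNge vs/= mulr0 mul0r.
  pose xi w := \1_A w * b v w.
  have mxi : measurable_fun [set: Ft v] xi.
    apply: measurable_funM; first exact: mA1 (ltW sv).
    exact: progressive_adapted prb v0.
  have ixi : mu.-integrable setT (EFin \o (fun w => xi w * N u w)).
    apply: Rintegrable_le (Rintegrable_norm (iv v01)) => //.
      by apply: measurable_funM => //; exact: Ft_id mxi.
    move=> w _; rewrite /xi -mulrA normrM ler_piMl// indicE.
    by case: (w \in A); rewrite ?normr1 ?normr0.
  have ixv := weighted_integrable aN pN v0 vu ut1 mxi ixi.
  have := weighted_eq aN pN v0 vu ut1 mxi ixi.
  have -> : (\int[mu]_w (H v w)%:E =
      (\int[mu]_w (xi w * N u w) - \int[mu]_w (xi w * N v w))%:E)%E.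
    rewrite -RintegralB// EFin_Rintegral//; last exact: RintegrableB.
    by apply: eq_integral => w _; rewrite /H /I sv /xi mulr1 mulrBr !mulrA.
  by move=> ->; rewrite subrr.
have pintH : {ae mu, forall w, pint H u w = \1_A w * (N u w * (pint b u w - pint b s w) -
     (pint (fun v w => b v w * N v w) u w - pint (fun v w => b v w * N v w) s w))}.
  apply: filterS (ae_time_integrable jbN (finite_s u01)) => w ibN.
  have ibw := ib w u01.
  have ibNu : leb.-integrable `[0, u] (EFin \o (fun v => b v w * N u w)).
    rewrite (_ : (fun v => _) = (fun v => N u w * b v w)).
      exact: RintegrableZ.
    by apply/funext => v; rewrite mulrC.
  rewrite /pint /H /I.
  have -> : \int[leb]_(v in `[0, u]) (\1_A w * (s < v)%R%:R *
      (b v w * N u w - b v w * N v w)) =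
    \int[leb]_(v in `[0, u]) ((s < v)%R%:R * (\1_A w *
      (N u w * b v w - b v w * N v w))).
    by apply: eq_Rintegral => v _; ring.
  have iD : leb.-integrable `[0, u] (EFin \o
      (fun v => \1_A w * (N u w * b v w - b v w * N v w))).
    by apply: RintegrableZ => //; apply: RintegrableB => //; exact: RintegrableZ.
  rewrite Rintegral_after//.
  have val (t : R) : 0 <= t <= u ->
     \int[leb]_(v in `[0, t]) (\1_A w * (N u w * b v w - b v w * N v w)) =
     \1_A w * (N u w * \int[leb]_(v in `[0, t]) b v w -
       \int[leb]_(v in `[0, t]) (b v w * N v w)).
    move=> /andP[t0 tu].
    have sub f : leb.-integrable `[0, u] (EFin \o f) -> leb.-integrable `[0, t] (EFin \o f).
      apply: integrableS => //.
      by move=> v /=; rewrite !in_itv/= => /andP[-> /le_trans ->].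
    have i1 := sub _ ibw; have i2 := sub _ ibN.
    rewrite RintegralZl//; last by apply: RintegrableB => //; exact: RintegrableZ.
    by rewrite RintegralB// ?RintegralZl//; exact: RintegrableZ.
  rewrite !val ?s0 ?u0 ?lexx//; ring.
have EH0 := time_fubini jH finH.
have EH1 : (\int[leb]_(v in `[0%R, u]) \int[mu]_w (H v w)%:E = 0)%E.
  rewrite -[RHS](integral0 leb `[0, u]%classic); apply: ae_eq_integral => //.
  - exact: measurable_expectation_time jH finH.
rewrite EH1 in EH0; case: EH0 => EH0; rewrite [RHS]EH0.
rewrite /Rintegral; congr fine; apply: ae_eq_integral => //.
- apply/measurable_EFinP; apply: measurable_funM => //.
  have mp (c : R -> Omega -> R) t : progressive X c -> 0 <= t -> measurable_fun setT (pint c t).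
    by move=> pc t0; exact: Ft_id (progressive_adapted (progressive_pint pc) t0).
  have pbN := progressiveM prb prN.
  apply: measurable_funB; last by apply: measurable_funB; exact: mp.
  by apply: measurable_funM => //; apply: measurable_funB; exact: mp.
- by apply/measurable_EFinP; exact: measurable_pint jH finH.
- by apply: filterS pintH => w -> _.
Qed.

Lemma premartingale_by_parts : premartingale X mu t1
  (fun t w => N t w * (B0 + pint b t w) - pint (fun v w => b v w * N v w) t w).
Proof.
have mpb t : 0 <= t -> measurable_fun [set: Ft t] (pint b t).
  by move=> t0; exact: progressive_adapted (progressive_pint prb) t0.
have iB t : 0 <= t <= t1 -> mu.-integrable setT (EFin \o
    (fun w => N t w * (B0 + pint b t w))).
  move=> /[dup] t01 /andP[t0 tt1].
  apply: (@Rintegrable_mul_bounded _ _ _ mu setT measurableT _ _ (`|B0| + C)).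
  - by apply: measurable_funD => //; exact: Ft_id (mpb t t0).
  - by move=> w _; apply: le_trans (ler_normD _ _) _; rewrite lerD2l; exact: pint_le.
  - exact: pN.1.
have iJ t : 0 <= t <= t1 -> mu.-integrable setT (EFin \o
    (pint (fun v w => b v w * N v w) t)).
  move=> /[dup] t01 /andP[t0 tt1]; apply: pint_integrable; last exact: finite_s.
  by apply: jointly_measurableM; [exact: progressive_jointly prb t0|exact: progressive_jointly prN t0].
split => [t t01|s u A s0 su ut1 FA]; first exact: RintegrableB (iB _ t01) (iJ _ t01).
have u0 := le_trans s0 su; have u01 : 0 <= u <= t1 by rewrite u0.
have s01 : 0 <= s <= t1 by rewrite s0 (le_trans su).
have mA := F_measurable FA.
rewrite !(Rintegral_indicM _ A).
have m1A : measurable_fun [set: Ft s] (\1_A : Omega -> R).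
  by apply: (@measurable_indic _ (Ft s)); apply/(sub_sigmaE (F_sigma X s)).
have i1A (f : Omega -> R) : mu.-integrable setT (EFin \o f) ->
    mu.-integrable setT (EFin \o (fun w => \1_A w * f w)).
  move=> iF; apply: Rintegrable_le (Rintegrable_norm iF) => //.
    by apply: measurable_funM; [exact: Ft_id m1A|exact: Rintegrable_measurable iF].
  move=> w _; rewrite normrM ler_piMl// indicE.
  by case: (w \in A); rewrite ?normr1 ?normr0.
pose xi w := \1_A w * (B0 + pint b s w).
have mxi : measurable_fun [set: Ft s] xi.
  by apply: measurable_funM => //; apply: measurable_funD => //; exact: mpb.
have ixiN v : 0 <= v <= t1 -> mu.-integrable setT (EFin \o (fun w => xi w * N v w)).
  move=> v01.
  have h : mu.-integrable setT (EFin \o (fun w => N v w * xi w)).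
    apply: (@Rintegrable_mul_bounded _ _ _ mu setT measurableT _ _ (`|B0| + C)).
    - exact: Ft_id mxi.
    - move=> w _; rewrite /xi normrM; apply: (@le_trans _ _ `|B0 + pint b s w|).
        by rewrite ler_piMl// indicE; case: (w \in A); rewrite ?normr1 ?normr0.
      by apply: le_trans (ler_normD _ _) _; rewrite lerD2l; exact: pint_le.
    - exact: pN.1.
  by apply: eq_integrable h => // w _ /=; rewrite mulrC.
have E1 := weighted_eq aN pN s0 su ut1 mxi (ixiN u u01).
have E2 := increment s0 su ut1 FA.
set Yu := (X in _ = X); set Ys := (X in X = _).
apply/eqP; rewrite -subr_eq0; apply/eqP.
rewrite /Ys /Yu -RintegralB//; last 2 first.
- by apply: i1A; exact: RintegrableB (iB _ u01) (iJ _ u01).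
- by apply: i1A; exact: RintegrableB (iB _ s01) (iJ _ s01).
pose I w := \1_A w * (N u w * (pint b u w - pint b s w) -
     (pint (fun v w => b v w * N v w) u w - pint (fun v w => b v w * N v w) s w)).
have iI : mu.-integrable setT (EFin \o I).
  apply: i1A; apply: RintegrableB => //; last exact: RintegrableB (iJ _ u01) (iJ _ s01).
  have h := RintegrableB measurableT (iB _ u01) (_ : mu.-integrable setT (EFin \o
     (fun w => N u w * (B0 + pint b s w)))).
  apply: eq_integrable (h _) => // [w _ /=|]; first by congr EFin; ring.
  apply: (@Rintegrable_mul_bounded _ _ _ mu setT measurableT _ _ (`|B0| + C)).
  - by apply: measurable_funD => //; exact: Ft_id (mpb s s0).
  - by move=> w _; apply: le_trans (ler_normD _ _) _; rewrite lerD2l; exact: pint_le.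
  - exact: pN.1.
(* The increment over [s, u] is (N_u - N_s) times B0 + \int b at time s, plus the quantity of
   [increment]. The first term has weight [xi], known at time s. *)
rewrite (_ : \int[mu]_w _ = \int[mu]_w (xi w * N u w - xi w * N s w + I w)); last first.
  by apply: eq_Rintegral => w _; rewrite /xi /I; ring.
rewrite RintegralD//; last by apply: RintegrableB => //; apply: ixiN.
rewrite RintegralB//; [|exact: ixiN..].
by rewrite E1 subrr add0r.
Qed.

End premartingale_by_parts.

(** * Primitives of integrable functions *)

Section primitives.
Context {R : realType}.
Local Notation leb := (@lebesgue_measure R).
Implicit Types f g a b : R -> R.

Definition primitive f (t : R) : R := \int[lebesgue_measure]_(s in `[0, t]) f s.

Definition integrable_upto (T : R) f := leb.-integrable `[0, T] (EFin \o f).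

Lemma integrable_uptoS s t f : s <= t -> integrable_upto t f -> integrable_upto s f.
Proof.
move=> st; apply: integrableS => //.
by move=> v /=; rewrite !in_itv/= => /andP[-> /le_trans ->].
Qed.

Lemma primitive0 f : primitive f 0 = 0.
Proof. by rewrite /primitive set_itv1 Rintegral_set1. Qed.

Lemma eq_primitive f g t : (forall s, 0 <= s <= t -> f s = g s) ->
  primitive f t = primitive g t.
Proof.
by move=> fg; apply: eq_Rintegral => s; rewrite inE/= in_itv/=; exact: fg.
Qed.

Lemma ae_eq_primitive f g t : integrable_upto t f ->
  measurable_fun `[0, t] g ->
  {ae leb, forall s, 0 <= s <= t -> f s = g s} ->
  primitive f t = primitive g t.
Proof.
move=> iF mg fg; rewrite /primitive /Rintegral; congr fine.
apply: ae_eq_integral => //.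
- exact: measurable_int iF.
- exact/measurable_EFinP.
- rewrite /ae_eq; move: fg; apply: lebesgue_aeS => s h sD.
  by rewrite h//; move: sD; rewrite /= in_itv.
Qed.

Lemma primitive_continuous T f : 0 <= T -> integrable_upto T f ->
  {within `[0, T], continuous (primitive f)}.
Proof. by move=> T0 iF; exact: parameterized_integral_continuous. Qed.

Lemma primitiveB s t f : 0 <= s -> s <= t -> integrable_upto t f ->
  primitive f t - primitive f s = \int[leb]_(v in `]s, t]) f v.
Proof. by move=> s0 st iF; rewrite /primitive (Rintegral_itvB iF)// bnd_simp. Qed.

Lemma integrable_between s t f : 0 <= s -> integrable_upto t f ->
  leb.-integrable `]s, t] (EFin \o f).
Proof.
move=> s0; apply: integrableS => //.
by move=> v /=; rewrite !in_itv/= => /andP[/ltW sv ->]; rewrite (le_trans s0 sv).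
Qed.

Lemma primitive_le s t f : 0 <= s -> s <= t -> integrable_upto t f ->
  (forall v, s <= v <= t -> 0 <= f v) -> primitive f s <= primitive f t.
Proof.
move=> s0 st iF f0; rewrite -subr_ge0 primitiveB//.
by apply: Rintegral_ge0 => v; rewrite /= in_itv/= => /andP[/ltW sv vt]; rewrite f0// sv.
Qed.

Lemma norm_primitiveB s t f g : 0 <= s -> s <= t -> integrable_upto t f ->
  integrable_upto t g -> (forall v, s <= v <= t -> `|f v| <= g v) ->
  `|primitive f t - primitive f s| <= primitive g t - primitive g s.
Proof.
move=> s0 st iF ig fg; rewrite !primitiveB//.
have i1 := integrable_between s0 iF; have i2 := integrable_between s0 ig.
apply: (le_trans (le_normr_Rintegral _ i1)) => //.
apply: le_Rintegral => //; first exact: Rintegrable_norm i1.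
by move=> v; rewrite /= in_itv/= => /andP[/ltW sv vt]; rewrite fg// sv.
Qed.

(* A time at which the increasing function V is half way between V s and V t
   splits [s, t] into two pieces contributing a quarter of the error each. *)
Lemma quadratic_error_vanishes T (G : R -> R) f v (C : R) :
  integrable_upto T v -> (forall s, 0 <= v s) ->
  (forall s t, 0 <= s -> s <= t -> t <= T ->
    `|G t - G s - (primitive f t - primitive f s)| <=
     C * (primitive v t - primitive v s) ^+ 2) ->
  forall t, 0 <= t <= T -> G t = G 0 + primitive f t.
Proof.
move=> iv v0 err t /andP[t0 tT].
have key k : forall s t, 0 <= s -> s <= t -> t <= T ->
    `|G t - G s - (primitive f t - primitive f s)| <=
     C * (primitive v t - primitive v s) ^+ 2 / 2 ^+ k.
  elim: k => [|k IH] {t0 tT} {}t s' + + +.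
    by move=> *; rewrite expr0 divr1; exact: err.
  rename t into s, s' into t => s0 st tT.
  have t0 := le_trans s0 st; have ivt := integrable_uptoS tT iv.
  have cV : {within `[s, t], continuous (primitive v)}.
    apply: continuous_subspaceW (primitive_continuous t0 ivt) => u.
    by rewrite /= !in_itv/= => /andP[/(le_trans s0) -> ->].
  have Vst : primitive v s <= primitive v t by exact: primitive_le.
  have [|m + Vm] := @IVT _ _ _ _ ((primitive v s + primitive v t) / 2) st cV.
    by rewrite (min_idPl Vst) (max_idPr Vst); apply/andP; split; lra.
  rewrite in_itv/= => /andP[sm mt].
  have h1 := IH _ _ s0 sm (le_trans mt tT).
  have h2 := IH _ _ (le_trans s0 sm) mt tT.
  rewrite (_ : _ - _ = (G t - G m - (primitive f t - primitive f m)) +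
    (G m - G s - (primitive f m - primitive f s))); last by ring.
  apply: le_trans (ler_normD _ _) _; apply: le_trans (lerD h2 h1) _.
  rewrite Vm (exprS 2 k) invfM; set y := (2 ^+ k)^-1; rewrite le_eqVlt; apply/orP; left.
  by apply/eqP; field.
have /eqP : `|G t - G 0 - (primitive f t - primitive f 0)| = 0.
  apply/eqP; rewrite eq_le normr_ge0 andbT.
  set M := C * (primitive v t - primitive v 0) ^+ 2.
  have cM : (fun k => M / 2 ^+ k) @ \oo --> (0 : R).
    have h : (fun k => (2^-1 : R) ^+ k) @ \oo --> (0 : R).
      by apply: cvg_expr; rewrite ger0_norm// invf_lt1// ltr1n.
    rewrite -(mulr0 M) (_ : (fun k => _) = (fun k => M * 2^-1 ^+ k)).
      by apply: cvgM => //; exact: cvg_cst.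
    by apply/funext => k; rewrite exprVn.
  rewrite -[leRHS](cvg_lim _ cM)//; apply: limr_ge; first exact: cvgP cM.
  by apply: nearW => k; exact: key.
by rewrite normr_eq0 primitive0 => /eqP; lra.
Qed.

Lemma primitive_bounded T a t : integrable_upto T a -> 0 <= t <= T ->
  `|primitive a t| <= primitive (fun s => `|a s|) T.
Proof.
move=> ia /andP[t0 tT]; have ian : integrable_upto T (fun s => `|a s|).
  exact: Rintegrable_norm ia.
have := norm_primitiveB (lexx 0) t0 (integrable_uptoS tT ia)
  (integrable_uptoS tT ian) (fun v _ => lexx _).
rewrite !primitive0 !subr0 => /le_trans; apply; exact: primitive_le.
Qed.

Lemma measurable_primitive T a : 0 <= T -> integrable_upto T a ->
  measurable_fun `[0, T] (primitive a).
Proof.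
move=> T0 ia; apply: subspace_continuous_measurable_fun => //.
exact: primitive_continuous.
Qed.

Lemma integrable_upto_mul T a g K : integrable_upto T a ->
  measurable_fun `[0, T] g -> (forall s, 0 <= s <= T -> `|g s| <= K) ->
  integrable_upto T (fun s => a s * g s).
Proof.
by move=> ia mg gK; apply: (@Rintegrable_mul_bounded _ _ _ leb _ _ _ _ K).
Qed.

Lemma primitiveD t f g : integrable_upto t f -> integrable_upto t g ->
  primitive (fun s => f s + g s) t = primitive f t + primitive g t.
Proof. by move=> iF ig; exact: RintegralD. Qed.

Lemma primitiveZ t k f : integrable_upto t f ->
  primitive (fun s => k * f s) t = k * primitive f t.
Proof. by move=> iF; exact: RintegralZl. Qed.

Section product_rule.
Variables (T : R) (a b : R -> R) (x0 y0 : R).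
Hypotheses (T0 : 0 <= T) (ia : integrable_upto T a) (ib : integrable_upto T b).
Let x t := x0 + primitive a t.
Let y t := y0 + primitive b t.

Lemma product_rule_integrable :
  integrable_upto T (fun s => a s * y s + b s * x s).
Proof.
apply: RintegrableD => //.
- apply: (@integrable_upto_mul _ _ _ (`|y0| + primitive (fun s => `|b s|) T)) => //.
    by apply: measurable_funD => //; exact: measurable_primitive.
  move=> s s0T; apply: le_trans (ler_normD _ _) _.
  by rewrite lerD2l; exact: primitive_bounded.
- apply: (@integrable_upto_mul _ _ _ (`|x0| + primitive (fun s => `|a s|) T)) => //.
    by apply: measurable_funD => //; exact: measurable_primitive.
  move=> s s0T; apply: le_trans (ler_normD _ _) _.
  by rewrite lerD2l; exact: primitive_bounded.
Qed.

(** With x and y frozen at time s, the error over [s, t] is (x_t - x_s)(y_t - y_s) minus the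
    integral of Q. Each is at most the square of the increment of \int v, whence the constant 2 in
    [quadratic_error_vanishes]. *)
Lemma product_rule t : 0 <= t <= T ->
  x t * y t = x0 * y0 + primitive (fun s => a s * y s + b s * x s) t.
Proof.
pose v s := `|a s| + `|b s|.
have iv : integrable_upto T v by apply: RintegrableD => //; exact: Rintegrable_norm.
have v0 s : 0 <= v s by rewrite addr_ge0.
have iP := product_rule_integrable.
have := @quadratic_error_vanishes T (fun t => x t * y t)
  (fun s => a s * y s + b s * x s) v 2 iv v0.
rewrite /x /y !primitive0 !addr0 => h t0T; apply: h => // {t0T} s {}t s0 st tT.
rewrite -/(x _) -/(x _) -/(y _) -/(y _).
have t0 := le_trans s0 st; have sT := le_trans st tT.
have iat := integrable_uptoS tT ia; have ibt := integrable_uptoS tT ib.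
have ivt := integrable_uptoS tT iv; have iPt := integrable_uptoS tT iP.
set dV := primitive v t - primitive v s.
have dV0 : 0 <= dV by rewrite subr_ge0 primitive_le.
have dab c : integrable_upto T c -> (forall r, `|c r| <= v r) ->
    forall r, s <= r <= t -> `|primitive c r - primitive c s| <= dV.
  move=> ic cv r /andP[sr rt]; apply: (@le_trans _ _ (primitive v r - primitive v s)).
    apply: norm_primitiveB => //; exact: integrable_uptoS (le_trans rt tT) _.
  by rewrite lerD2r; apply: primitive_le => //; exact: le_trans s0 sr.
have da := dab a ia (fun r => ler_wpDr (normr_ge0 _) (lexx _)).
have db := dab b ib (fun r => ler_wpDl (normr_ge0 _) (lexx _)).
pose Q r := a r * y r + b r * x r - (y s * a r + x s * b r).
have iL : integrable_upto t (fun r => y s * a r + x s * b r).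
  by apply: RintegrableD => //; exact: RintegrableZ.
have iQ : integrable_upto t Q by exact: RintegrableB.
have PE r : 0 <= r <= t -> primitive (fun s => a s * y s + b s * x s) r =
    primitive Q r + (y s * primitive a r + x s * primitive b r).
  move=> /andP[r0 rt].
  have [iar ibr] := (integrable_uptoS rt iat, integrable_uptoS rt ibt).
  rewrite -!primitiveZ// -primitiveD//; [|exact: RintegrableZ..].
  rewrite -primitiveD//; [|exact: integrable_uptoS rt _..].
  by apply: eq_primitive => r' _; rewrite /Q; ring.
have Qle : `|primitive Q t - primitive Q s| <= dV ^+ 2.
  have ivd : integrable_upto t (fun r => dV * v r) by exact: RintegrableZ.
  apply: le_trans (norm_primitiveB s0 st iQ ivd _) _ => [r srt|].
    rewrite (_ : Q r = a r * (primitive b r - primitive b s) +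
      b r * (primitive a r - primitive a s)); last by rewrite /Q /y /x; ring.
    apply: le_trans (ler_normD _ _) _; rewrite !normrM /v mulrDr ![dV * _]mulrC.
    by apply: lerD; apply: ler_wpM2l => //; [exact: db|exact: da].
  rewrite !primitiveZ//; last exact: integrable_uptoS st ivt.
  by rewrite -mulrBr -expr2.
rewrite !PE ?s0 ?t0 ?lexx//.
rewrite (_ : _ - _ = (primitive a t - primitive a s) * (primitive b t - primitive b s)
  - (primitive Q t - primitive Q s)); last by rewrite /x /y; ring.
apply: le_trans (ler_normB _ _) _; rewrite normrM.
have : `|primitive a t - primitive a s| * `|primitive b t - primitive b s| <= dV * dV.
  by apply: ler_pM => //; [apply: da|apply: db]; rewrite st lexx.
by rewrite -expr2; lra.
Qed.

End product_rule.

Lemma expR_above_tangent (p q : R) : expR q * (1 + (p - q)) <= expR p.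
Proof.
have -> : expR p = expR q * expR (p - q) by rewrite -expRD; congr expR; ring.
by rewrite ler_wpM2l ?expR_ge0// expR_ge1Dx.
Qed.

(** Convexity, used through the tangents at both p and q. *)
Lemma expR_tangent (p q : R) :
  0 <= expR p - expR q - expR q * (p - q) <= (expR p - expR q) * (p - q).
Proof.
have h1 := expR_above_tangent p q; have h2 := expR_above_tangent q p.
by apply/andP; split; lra.
Qed.

Lemma expR_lip (K p q : R) : `|p| <= K -> `|q| <= K ->
  `|expR p - expR q| <= expR K * `|p - q|.
Proof.
wlog pq : p q / q <= p.
  move=> h pK qK; have [pq|/ltW qp] := leP q p; first exact: h.
  by rewrite distrC [`|p - q|]distrC h.
move=> pK qK; rewrite ger0_norm ?subr_ge0 ?ler_expR// ger0_norm ?subr_ge0//.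
have pK' : expR p <= expR K by rewrite ler_expR (le_trans (ler_norm _)).
have h2 := expR_above_tangent q p.
have : expR p * (p - q) <= expR K * (p - q) by rewrite ler_wpM2r// subr_ge0.
by lra.
Qed.

(** Same scheme as the product rule: the second-order remainder of the exponential and the freezing
    error Q are each at most e^K times a squared increment, K bounding |\int a|. *)
Lemma exp_rule T a : 0 <= T -> integrable_upto T a -> forall t, 0 <= t <= T ->
  expR (primitive a t) = 1 + primitive (fun s => a s * expR (primitive a s)) t.
Proof.
move=> T0 ia t t0T; pose x := primitive a.
pose K := primitive (fun s => `|a s|) T.
have xK s : 0 <= s <= T -> `|x s| <= K by exact: primitive_bounded.
have mex : measurable_fun `[0, T] (fun s => expR (x s)).
  by apply: measurableT_comp => //; exact: measurable_primitive.
have iP : integrable_upto T (fun s => a s * expR (x s)).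
  apply: (@integrable_upto_mul _ _ _ (expR K)) => // s s0T.
  by rewrite ger0_norm ?expR_ge0// ler_expR (le_trans (ler_norm _))// xK.
have ian : integrable_upto T (fun s => `|a s|) by exact: Rintegrable_norm.
have := @quadratic_error_vanishes T (fun t => expR (x t))
  (fun s => a s * expR (x s)) (fun s => `|a s|) (2 * expR K) ian (fun s => normr_ge0 _).
rewrite /x primitive0 expR0 => h; apply: h => // {t t0T} s t s0 st tT.
rewrite -/x -/(x t) -/(x s).
have t0 := le_trans s0 st; have sT := le_trans st tT.
have iat := integrable_uptoS tT ia; have iant := integrable_uptoS tT ian.
have iPt := integrable_uptoS tT iP.
set dV := primitive (fun s => `|a s|) t - primitive (fun s => `|a s|) s.
have dx r : s <= r <= t -> `|x r - x s| <= dV.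
  move=> /andP[sr rt]; have r0 := le_trans s0 sr.
  apply: (@le_trans _ _ (primitive (fun s => `|a s|) r - primitive (fun s => `|a s|) s)).
    by apply: norm_primitiveB => //; exact: integrable_uptoS (le_trans rt tT) _.
  by rewrite lerD2r; apply: primitive_le.
have dV0 : 0 <= dV by rewrite subr_ge0 primitive_le.
pose Q r := a r * expR (x r) - expR (x s) * a r.
have iQ : integrable_upto t Q by apply: RintegrableB => //; exact: RintegrableZ.
have PE r : 0 <= r <= t -> primitive (fun s => a s * expR (x s)) r =
    primitive Q r + expR (x s) * x r.
  move=> /andP[r0 rt]; have iar := integrable_uptoS rt iat.
  rewrite -primitiveZ// -primitiveD//; [|exact: integrable_uptoS rt _|exact: RintegrableZ].
  by apply: eq_primitive => r' _; rewrite /Q subrK.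
have Qle : `|primitive Q t - primitive Q s| <= expR K * dV ^+ 2.
  have ivd : integrable_upto t (fun r => (expR K * dV) * `|a r|) by exact: RintegrableZ.
  apply: le_trans (norm_primitiveB s0 st iQ ivd _) _ => [r /[dup] srt /andP[sr rt]|].
    rewrite /Q [expR (x s) * _]mulrC -mulrBr normrM mulrC ler_wpM2r//.
    apply: le_trans (expR_lip (K := K) _ _) _.
    - by apply: xK; rewrite (le_trans s0 sr) (le_trans rt tT).
    - by apply: xK; rewrite s0.
    - by rewrite ler_wpM2l ?expR_ge0// dx.
  rewrite !primitiveZ//; last exact: integrable_uptoS st iant.
  by rewrite -mulrBr expr2 mulrA.
rewrite !PE ?s0 ?t0 ?lexx//.
have alg (e1 e2 q1 q2 x1 x2 : R) : e1 - e2 - (q1 + e2 * x1 - (q2 + e2 * x2)) =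
    (e1 - e2 - e2 * (x1 - x2)) - (q1 - q2) by ring.
rewrite alg.
apply: le_trans (ler_normB _ _) _.
have /andP[h1 h2] := expR_tangent (x t) (x s).
have dxt : `|x t - x s| <= dV by apply: dx; rewrite st lexx.
have h3 : `|expR (x t) - expR (x s)| * `|x t - x s| <= (expR K * dV) * dV.
  apply: ler_pM => //; apply: le_trans (expR_lip (K := K) _ _) _.
  - by apply: xK; rewrite t0.
  - by apply: xK; rewrite s0.
  - by rewrite ler_wpM2l ?expR_ge0.
have h4 := ler_norm ((expR (x t) - expR (x s)) * (x t - x s)).
rewrite normrM in h4; rewrite expr2 mulrA in Qle *.
rewrite (ger0_norm h1); apply: le_trans (lerD (le_trans h2 (le_trans h4 h3)) Qle) _.
have alg2 (A D : R) : A * D * D + A * D * D = 2 * A * (D * D) by ring.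
by rewrite alg2.
Qed.

(** Lebesgue differentiation for f extended by zero, whose primitive vanishes on all of ]-oo, T].
    The endpoints are discarded as null, so that every remaining s < T has a neighbourhood on which
    the primitive is zero. *)
Lemma primitive_eq0_ae T f : 0 <= T -> integrable_upto T f ->
  (forall t, 0 <= t <= T -> primitive f t = 0) ->
  {ae leb, forall s, 0 <= s <= T -> f s = 0}.
Proof.
move=> T0 iF f0.
pose g := f \_ `[0, T].
have ig : leb.-integrable setT (EFin \o g).
  by rewrite -restrict_EFin; apply/(@integrable_mkcond _ _ _ leb `[0,T]%classic).
have lg : locally_integrable setT g by exact: integrable_locally.
have Fg y : y <= T -> primitive g y = 0.
  move=> yT; have [y0|y0] := leP 0 y; last first.
    by rewrite /primitive set_itv_ge ?Rintegral_set0// bnd_simp -ltNge.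
  rewrite -(f0 y) ?y0//; apply: eq_primitive => s /andP[s0 sy].
  by rewrite /g patchE mem_setE/= in_itv/= s0 (le_trans sy yT).
have ig' y : leb.-integrable `[0, y] (EFin \o g).
  by apply: integrableS ig.
have aeT r : {ae leb, forall s, s != r}.
  exists [set r]; split => //; first exact: lebesgue_measure_set1.
  by move=> s /= /negP; rewrite negbK => /eqP.
have aeF := @FTC1 R g (BLeft 0) ig' lg.
have := @filterS3 _ _ (ae_filter_ringOfSetsType leb) _ _ _
  (fun s => 0 <= s <= T -> f s = 0) _ aeF (aeT 0) (aeT T).
apply => s /= + sn0 sT /andP[s0 sT'].
rewrite lte_fin lt_neqAle eq_sym sn0 s0 => /(_ isT)[_].
have -> : f s = g s by rewrite /g patchE mem_setE/= in_itv/= s0 sT'.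
move=> <-; have sltT : s < T by rewrite lt_neqAle sT.
rewrite derive1E (@near_eq_derive _ _ _ _ (cst 0)); last first.
  near=> y; apply/Fg/ltW; near: y; exact: lt_nbhsl.
by rewrite derive_cst.
Unshelve. all: by end_near. Qed.

End primitives.

(** * Equivalent laws *)

Section equivalent_laws.
Context {R : realType} {E : ptopologicalType} {d : measure_display}
  {Omega : measurableType d}.
Variable X : borel_right_process R E Omega.
Local Notation Ft t := (g_sigma_algebraType (F_ X t)).

(** What the later arguments retain of a positive density: the same null events as P_x on each F_t,
    and compatibility between horizons. *)
Definition laws_equiv (L : laws R E Omega) (x : E) : Prop :=
  (forall t A, 0 <= t -> F_ X t A -> (L t x A = 0%E <-> law X x A = 0%E)) /\
  (forall s t A, 0 <= s -> s <= t -> F_ X s A -> L t x A = L s x A).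

Lemma laws_equiv_P x : laws_equiv (law_P X) x.
Proof. by []. Qed.

Lemma lusin_measurable1 (x : E) : lusin_space R E ->
  measurable ([set x] : set (borel E)).
Proof.
move=> [K [j [_ ji _ opE]]].
rewrite -[X in measurable X]setCK; apply: measurableC; apply: sub_sigma_algebra.
apply/opE; exists (~` [set j x]).
  by apply: closed_openC; exact: (@accessible_closed_set1 K (hausdorff_accessible (@metric_hausdorff _ K))).
by apply/seteqP; split => y /= h eq; apply: h; [exact: ji|rewrite eq].
Qed.

(* A P_x-null set may be charged by the other laws, but its part in {X_0 = x}
   is null for all of them, and {X_0 <> x} is a P_x-null event of F_0. *)
Lemma null_hull x (N0 : set Omega) : lusin_space R E ->
  measurable N0 -> law X x N0 = 0%E ->
  exists N, [/\ F_ X 0 N, law X x N = 0%E & N0 `<=` N].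
Proof.
move=> hE mN0 N00; have mx := lusin_measurable1 x hE.
pose D := X 0 @^-1` [set x] : set Omega.
have rD : raw_filtration X 0 D.
  by apply: sub_sigma_algebra; exists 0, [set x]; rewrite lexx.
have rD' := raw_filtration_raw rD; have mD := raw_measurable rD'.
have D1 : law X x D = 1%E by have := brp_normal X x.
have [B [C [rB rC C0 NBC]]] : exists B C : set Omega,
    [/\ raw_sigma_field X B, raw_sigma_field X C, law X x C = 0%E &
        (N0 `\` B) `|` (B `\` N0) `<=` C].
  have /(brp_sigma_field X) aN := mN0.
  (* The augmentation is tested with the initial law concentrated at x. *)
  have [B [C [rB rC C0 NBC]]] := aN (dirac (x : borel E)).
  exists B, C; split => //; rewrite -C0 integral_dirac//; last exact: measurable_law.
  by rewrite diracT mul1e.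
have mB := raw_measurable rB; have mC := raw_measurable rC.
have B0 : law X x B = 0%E.
  apply/eqP; rewrite -measure_le0.
  apply: (@le_trans _ _ (law X x (N0 `|` C))).
    apply: le_measure; rewrite ?inE//; first exact: measurableU.
    move=> w Bw; have [Nw|Nw] := pselect (N0 w); [by left|right].
    by apply: NBC; right.
  apply: le_trans (measureU2 _ mN0 mC) _.
  by rewrite -[leRHS]adde0; apply: leeD; [rewrite -N00|rewrite -C0].
pose C' := (B `|` C) `&` D.
have rs : sigma_algebra setT (raw_sigma_field X) by exact: smallest_sigma_algebra.
have rC' : raw_sigma_field X C'.
  by apply: (sigma_setI rs) => //; exact: (sigma_setU rs).
(* For y <> x the set lies in {X_0 <> y}, so it is null for every starting point, as membership in
   F_0 demands. *)
have C'0 y : law X y C' = 0%E.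
  have mC' := raw_measurable rC'.
  have [->|yx] := pselect (y = x).
    apply/eqP; rewrite -measure_le0; apply: (@le_trans _ _ (law X x (B `|` C))).
      by apply: le_measure; rewrite ?inE//; [exact: measurableU|move=> w []].
    by apply: le_trans (measureU2 _ mB mC) _; rewrite -[leRHS]adde0; apply: leeD; [rewrite -B0|rewrite -C0].
  apply/eqP; rewrite -measure_le0.
  have my := lusin_measurable1 y hE.
  have mDy : measurable (X 0 @^-1` [set y] : set Omega).
    by rewrite -[X in measurable X]setTI; exact: (measurable_path X (lexx 0)).
  have Dy1 : law X y (X 0 @^-1` [set y]) = 1%E by have := brp_normal X y.
  apply: (@le_trans _ _ (law X y (~` (X 0 @^-1` [set y])))).
    apply: le_measure; rewrite ?inE//; first exact: measurableC.
    by move=> w [_ /= ->] /esym.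
  by rewrite probability_setC// Dy1 subee.
exists ((N0 `&` D) `|` ~` D); split.
- apply: (sigma_setU (F_sigma X 0)).
    move=> mu; exists set0, C'; split => //.
    + exact: sigma_set0 (raw_filtration_sigma X 0).
    + by rewrite integral0_eq.
    + rewrite setD0 set0D setU0 => w [Nw Dw]; split => //.
      by have [Bw|Bw] := pselect (B w); [left|right; apply: NBC; left].
  by apply: (sigma_setC (F_sigma X 0)); exact: raw_F.
- apply/eqP; rewrite -measure_le0.
  apply: le_trans (measureU2 _ _ _) _; [exact: measurableI|exact: measurableC|].
  rewrite -[leRHS]adde0; apply: leeD; last first.
    by have := probability_setC (law X x) mD; rewrite D1 subee// => <-.
  rewrite -N00; apply: le_measure; rewrite ?inE//.
  exact: measurableI.
- by move=> w Nw; have [Dw|Dw] := pselect (D w); [left|right].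
Qed.

(** [null_hull] encloses a P_x-null set in one of F_0, and equivalence on F_t transfers its nullity.
    From here on almost sure arguments are carried out under P_x alone. *)
Lemma as_upto_ae L x t (p : Omega -> Prop) : lusin_space R E ->
  laws_equiv L x -> 0 <= t ->
  as_upto X L t x p <-> {ae law X x, forall w, p w}.
Proof.
move=> hE [LP _] t0; split.
  move=> [N [FN N0 Np]]; exists N; split; first exact: F_measurable FN.
    exact/(LP t N t0 FN).
  by move=> w /= npw; apply: contrapT => /Np.
move=> [N0 [mN0 N00 pN0]].
have [N [FN NN N0N]] := null_hull hE mN0 N00.
exists N; split => //; first exact: F_mono t0 _ FN.
  by apply/LP => //; exact: F_mono t0 _ FN.
by move=> w Nw; apply: contrapT => pw; apply: Nw; apply: N0N; apply: pN0.
Qed.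

Lemma F_fun_measurable t (f : Omega -> R) :
  (forall B : set R, measurable B -> F_ X t (f @^-1` B)) <->
  measurable_fun [set: Ft t] f.
Proof.
split => [h _ B mB|mf B mB]; last exact: F_preimage.
by rewrite setTI; apply/(sub_sigmaE (F_sigma X t)); exact: h.
Qed.

Section consistency.
Variables (L : laws R E Omega) (x : E).
Hypothesis hL : laws_equiv L x.

Lemma ge0_integral_consistent s t (xi : Omega -> \bar R) : 0 <= s -> s <= t ->
  measurable_fun [set: Ft s] xi -> (forall w, 0 <= xi w)%E ->
  (\int[L t x]_w xi w = \int[L s x]_w xi w)%E.
Proof.
move=> s0 st mxi xi0.
transitivity (\int[L t x]_w (xi w * (cst 1%R w)%:E))%E.
  by apply: eq_integral => w _; rewrite mule1.
transitivity (\int[L s x]_w (xi w * (cst 1%R w)%:E))%E; last first.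
  by apply: eq_integral => w _; rewrite mule1.
apply: (@weighted_integral_eq _ _ _ _ (F_sigma X s) (@F_measurable _ _ _ _ X s)) => //.
move=> A FA; have mA := F_measurable FA.
have e (m : probability Omega R) : (\int[m]_(w in A) (cst (1 : R) w)%:E = m A)%E.
  by transitivity (1 * m A)%E; [exact: (@integral_cst _ _ _ m _ mA 1%:E)|rewrite mul1e].
by rewrite !e; exact: hL.2.
Qed.

Lemma integral_consistent s t (xi : Omega -> \bar R) A : 0 <= s -> s <= t ->
  measurable_fun [set: Ft s] xi -> F_ X s A ->
  (\int[L t x]_(w in A) xi w = \int[L s x]_(w in A) xi w)%E.
Proof.
move=> s0 st mxi FA.
have mA : measurable (A : set (Ft s)) by apply/(sub_sigmaE (F_sigma X s)).
rewrite integral_mkcond [RHS]integral_mkcond.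
have mxA : measurable_fun [set: Ft s] (xi \_ A).
  by apply/(measurable_restrictT _ mA); exact: measurable_funTS.
rewrite integralE [RHS]integralE; congr (_ - _)%E.
  by apply: ge0_integral_consistent => //; exact: measurable_funepos.
by apply: ge0_integral_consistent => //; exact: measurable_funeneg.
Qed.

Lemma integrable_consistent s t (f : Omega -> R) : 0 <= s -> s <= t ->
  measurable_fun [set: Ft s] f ->
  (L t x).-integrable setT (EFin \o f) <-> (L s x).-integrable setT (EFin \o f).
Proof.
move=> s0 st mf; have mfO : measurable_fun [set: Omega] f := Ft_id mf.
have eq : (\int[L t x]_w `|(EFin \o f) w| = \int[L s x]_w `|(EFin \o f) w|)%E.
  apply: ge0_integral_consistent => //; apply: measurableT_comp => //.
  exact/measurable_EFinP.
split=> /integrableP[_ h]; apply/integrableP; split.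
- exact/measurable_EFinP.
- by rewrite -eq.
- exact/measurable_EFinP.
- by rewrite eq.
Qed.

(** Consistency replaces the laws at all earlier horizons by the single law [L t x], to which the
    one-measure results apply. *)
Lemma martingale_premartingale (Y : R -> Omega -> R) :
  martingale X L x Y -> forall t, 0 <= t -> premartingale X (L t x) t Y.
Proof.
move=> [aY _ iY eY] t t0.
have mY s : 0 <= s -> measurable_fun [set: Ft s] (Y s).
  by move=> s0; apply/F_fun_measurable => B mB; exact: aY.
split => [s /andP[s0 st]|s u A s0 su ut FA].
  by apply/(integrable_consistent s0 st (mY s s0)); exact: iY.
have u0 := le_trans s0 su.
rewrite /Rintegral (integral_consistent u0 ut)//; last 2 first.
- by apply/measurable_EFinP; exact: mY.
- exact: F_mono su _ FA.
rewrite (integral_consistent s0 (le_trans su ut))//; last first.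
  by apply/measurable_EFinP; exact: mY.
by rewrite (eY s u)// s0.
Qed.

Lemma premartingale_martingale (Y : R -> Omega -> R) :
  adapted X Y -> cadlag X L x Y ->
  (forall t, 0 <= t -> premartingale X (L t x) t Y) -> martingale X L x Y.
Proof.
move=> aY cY pY.
have mY s : 0 <= s -> measurable_fun [set: Ft s] (Y s).
  by move=> s0; apply/F_fun_measurable => B mB; exact: aY.
split => // [t t0|s t A /andP[s0 st] FA].
  by have [iY _] := pY t t0; apply: iY; rewrite t0 lexx.
have t0 := le_trans s0 st; have [iY eY] := pY t t0.
have mA := F_measurable FA.
have iS f : (L t x).-integrable setT (EFin \o f) -> (L t x).-integrable A (EFin \o f).
  by move=> iF; exact: integrableS iF.
rewrite -(integral_consistent s0 st)//; last by apply/measurable_EFinP; exact: mY.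
have it := iS _ (iY t (introT andP (conj t0 (lexx t)))).
have is_ := iS _ (iY s (introT andP (conj s0 st))).
by rewrite -!EFin_Rintegral// (eY _ _ _ s0 st (lexx t) FA).
Qed.

End consistency.
End equivalent_laws.

(** * Right-continuous paths with left limits *)

Section cadlag_paths.
Context {R : realType}.
Implicit Types (t s : R) (u v : R -> R).

Lemma at_right_within s t : s < t -> \forall z \near s^'+, z \in `[s, t].
Proof.
move=> st; near=> z; rewrite in_itv/=; apply/andP; split.
  by near: z; exact: nbhs_right_ge.
by near: z; exact: nbhs_right_le.
Unshelve. all: by end_near.
Qed.

Lemma at_left_within s t : t < s -> \forall z \near s^'-, z \in `[t, s].
Proof.
move=> st; near=> z; rewrite in_itv/=; apply/andP; split.
  by near: z; exact: nbhs_left_ge.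
by near: z; exact: nbhs_left_le.
Unshelve. all: by end_near.
Qed.

Lemma cadlag_eq t u v : (forall s, 0 <= s <= t -> u s = v s) ->
  cadlag_upto t u -> cadlag_upto t v.
Proof.
move=> uv [ru lu]; split => [s /andP[s0 st]|s /andP[s0 st]].
  rewrite -uv; last by rewrite s0 ltW.
  apply: cvg_trans (ru s _); last by rewrite s0.
  apply: near_eq_cvg; apply: filterS (at_right_within st) => z.
  rewrite in_itv/= => /andP[sz zt]; apply: uv.
  by rewrite (le_trans s0 sz) zt.
have /cvg_ex[l ul] := lu s (introT andP (conj s0 st)); apply/cvg_ex; exists l.
apply: cvg_trans ul; apply: near_eq_cvg; apply: filterS (at_left_within s0) => z.
rewrite in_itv/= => /andP[z0 zs]; apply: uv.
by rewrite z0 (le_trans zs st).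
Qed.

Lemma cadlagS t t' u : t' <= t -> cadlag_upto t u -> cadlag_upto t' u.
Proof.
move=> tt [ru lu]; split => s /andP[s0 st].
  by apply: ru; rewrite s0 (lt_le_trans st).
by apply: lu; rewrite s0 (le_trans st).
Qed.

Lemma cadlag_cst t (c : R) : cadlag_upto t (fun=> c).
Proof. by split => s _; [exact: cvg_cst|exact: is_cvg_cst]. Qed.

Lemma cadlagD t u v : cadlag_upto t u -> cadlag_upto t v ->
  cadlag_upto t (fun s => u s + v s).
Proof.
move=> [ru lu] [rv lv]; split => s sI; first by apply: cvgD; [exact: ru|exact: rv].
by apply: is_cvgD; [exact: lu|exact: lv].
Qed.

Lemma cadlagM t u v : cadlag_upto t u -> cadlag_upto t v ->
  cadlag_upto t (fun s => u s * v s).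
Proof.
move=> [ru lu] [rv lv]; split => s sI; first by apply: cvgM; [exact: ru|exact: rv].
by apply: is_cvgM; [exact: lu|exact: lv].
Qed.

Lemma cadlagB t u v : cadlag_upto t u -> cadlag_upto t v ->
  cadlag_upto t (fun s => u s - v s).
Proof.
move=> cu cv; apply: cadlag_eq (cadlagD cu (cadlagM (cadlag_cst t (-1)) cv)).
by move=> s _; rewrite mulN1r.
Qed.

Lemma cadlagV t u : (forall s, 0 <= s <= t -> u s != 0) ->
  (forall s, 0 < s <= t -> exists2 l, l != 0 & u z @[z --> s^'-] --> l) ->
  cadlag_upto t u -> cadlag_upto t (fun s => (u s)^-1).
Proof.
move=> u0 l0 [ru lu]; split => s /andP[s0 st].
  by apply: cvgV; [apply: u0; rewrite s0 ltW|apply: ru; rewrite s0].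
have [l ln ul] := l0 s (introT andP (conj s0 st)).
by apply/cvg_ex; exists l^-1; exact: cvgV.
Qed.

Lemma continuous_cadlag t u : {within `[0, t], continuous u} -> cadlag_upto t u.
Proof.
move=> cu; split => s /andP[s0 st].
  have [h h0 _] := (continuous_within_itvP u (le_lt_trans s0 st)).1 cu.
  have := s0; rewrite le_eqVlt => /orP[/eqP<-//|s0'].
  by apply: cvg_at_right_filter; apply: h; rewrite in_itv/= s0'.
have t0' := lt_le_trans s0 st.
have [h _ ht] := (continuous_within_itvP u t0').1 cu.
have := st; rewrite le_eqVlt => /orP[/eqP->|st'].
  by apply/cvg_ex; exists (u t).
apply/cvg_ex; exists (u s); apply: cvg_at_left_filter.
by apply: h; rewrite in_itv/= s0.
Qed.

Lemma cadlag_stopped t u (tau : R) : 0 <= tau ->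
  cadlag_upto t u -> cadlag_upto t (fun s => u (Num.min s tau)).
Proof.
move=> tau0 [ru lu]; split => s /andP[s0 st].
  have [stau|taus] := ltP s tau.
    apply: cvg_trans (ru s _); last by rewrite s0.
    apply: near_eq_cvg; apply: filterS (at_right_within stau) => z.
    by rewrite in_itv/= => /andP[_ /min_idPl ->].
  apply: cvg_near_cst; near=> z.
  rewrite (min_idPr _)//; apply: le_trans taus _.
  by near: z; exact: nbhs_right_ge.
have [stau|taus] := leP s tau.
  have /cvg_ex[l ul] := lu s (introT andP (conj s0 st)); apply/cvg_ex; exists l.
  apply: cvg_trans ul; apply: near_eq_cvg; near=> z.
  rewrite (min_idPl _)//; apply: le_trans stau.
  by near: z; exact: nbhs_left_le.
apply/cvg_ex; exists (u tau).
apply: cvg_near_cst; near=> z.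
rewrite (min_idPr _)//.
by near: z; exact: nbhs_left_ge.
Unshelve. all: by end_near.
Qed.

(** Each point of [0, t] has a bounded neighbourhood, by the right limit, the left limit and the
    value there; compactness makes the bound uniform. *)
Lemma cadlag_bounded t u : cadlag_upto t u ->
  exists C, forall s, 0 <= s <= t -> `|u s| <= C.
Proof.
move=> [ru lu].
have loc x : `[0, t]%classic x -> \forall x' \near x & n \near \oo,
    0 <= x' <= t -> `|u x'| <= n%:R.
  rewrite /= in_itv/= => /andP[x0 xt].
  have nb (c : R) : \forall n \near \oo, c <= n%:R.
    exact: nbhs_infty_ger.
  have hR : \forall x' \near x^'+ & n \near \oo, 0 <= x' <= t -> `|u x'| <= n%:R.
    have [xt'|tx] := ltP x t; last first.
      exists ([set z | x < z], setT) => //=.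
        by split; [exact: nbhs_right_gt|exact: filterT].
      by move=> [z n] /= [xz _] /andP[_ zt]; move: (lt_le_trans xz zt); rewrite ltNge tx.
    have h := ru x; rewrite x0 xt' in h; have {}h := h isT.
    have b : \forall z \near x^'+, `|u z| <= `|u x| + 1.
      have /cvgrPdist_le/(_ 1 ltr01) := h.
      apply: filterS => z; rewrite distrC => hz.
      by have := ler_normD (u z - u x) (u x); rewrite subrK => /le_trans -> //; rewrite addrC lerD2l.
    exists ([set z | `|u z| <= `|u x| + 1], [set n | `|u x| + 1 <= n%:R]) => //=.
      by split; [exact: b|exact: nb].
    by move=> [z n] /= [hz hn] _; exact: le_trans hz hn.
  have hL : \forall x' \near x^'- & n \near \oo, 0 <= x' <= t -> `|u x'| <= n%:R.
    have [x0'|x0'] := ltP 0 x; last first.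
      exists ([set z | z < x], setT) => //=.
        by split; [exact: nbhs_left_lt|exact: filterT].
      by move=> [z n] /= [xz _] /andP[z0 _]; move: (le_lt_trans z0 xz); rewrite ltNge x0'.
    have h := lu x; rewrite x0' xt in h; have {h}/cvg_ex[l h] := h isT.
    have b : \forall z \near x^'-, `|u z| <= `|l| + 1.
      have /cvgrPdist_le/(_ 1 ltr01) := h.
      apply: filterS => z; rewrite distrC => hz.
      by have := ler_normD (u z - l) l; rewrite subrK => /le_trans -> //; rewrite addrC lerD2l.
    exists ([set z | `|u z| <= `|l| + 1], [set n | `|l| + 1 <= n%:R]) => //=.
      by split; [exact: b|exact: nb].
    by move=> [z n] /= [hz hn] _; exact: le_trans hz hn.
  move: hR hL => [[A N] /= [hA hN] AN] [[B M] /= [hB hM] BM].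
  pose C := [set n : nat | `|u x| <= n%:R].
  exists ([set z | [\/ A z, B z | z = x]], N `&` M `&` C) => /=.
    split; last by apply: filterI; [exact: filterI|exact: nb].
    move: hA hB; rewrite /at_right /at_left /within /= => hA hB.
    near=> z; have [zx|zx|->] := ltgtP z x.
    - by apply: Or32; move: zx; near: z.
    - by apply: Or31; move: zx; near: z.
    - exact: Or33.
  move=> [z n] /= [hz [[Nn Mn] Cn]] zI.
  case: hz => [Az|Bz|->]; [exact: (AN (z, n))|exact: (BM (z, n))|exact: Cn].
have [N _ /(_ N (leqnn N)) h] := (compact_near_coveringP _).1 (@segment_compact R 0 t)
  _ \oo%classic (fun n x => 0 <= x <= t -> `|u x| <= n%:R) _ loc.
by exists N%:R => s sI; apply: h => //=; rewrite in_itv.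
Unshelve. all: by end_near.
Qed.

End cadlag_paths.

(** * Left limits of positive martingales *)

Section positive_martingale.
Context {R : realType} {E : ptopologicalType} {d : measure_display}
  {Omega : measurableType d}.
Variable X : borel_right_process R E Omega.
Local Notation Ft t := (g_sigma_algebraType (F_ X t)).

(** As p improves when time decreases, the positive integers suffice, and countably many null sets
    are united. *)
Lemma ae_all_times (mu : probability Omega R) (p : R -> Omega -> Prop) :
  (forall s t w, s <= t -> p t w -> p s w) ->
  (forall t, 0 < t -> {ae mu, forall w, p t w}) ->
  {ae mu, forall w, forall t, p t w}.
Proof.
move=> pS h; have := ae_foralln (fun n => h n.+1%:R (ltr0Sn _ _)).
apply: filterS => w pw t.
have [n _ tn] : \forall n \near \oo, t <= n%:R by exact: nbhs_infty_ger.
apply: pS (pw n); apply: le_trans (tn n (leqnn n)) _.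
by rewrite ler_nat.
Qed.

Lemma eq_lee (a b : \bar R) : a = b -> (a <= b)%E.
Proof. by move=> ->. Qed.

Variables (L : laws R E Omega) (x : E) (W : R -> Omega -> R).
Hypothesis hL : laws_equiv X L x.
Hypothesis mW : forall s, 0 <= s -> measurable_fun [set: Ft s] (W s).
Hypothesis dW : forall s A, 0 <= s -> F_ X s A ->
  L s x A = (\int[law X x]_(w in A) (W s w)%:E)%E.
Hypothesis W0 : {ae law X x, forall w, forall s, 0 <= s -> 0 < W s w}.
Hypothesis cW : {ae law X x, forall w, forall t, 0 <= t -> cadlag_upto t (W ^~ w)}.

(* The events that i is the first index with W (tau i) < c are disjoint, and W is
   the density of L on each of them. *)
Lemma first_passage_le t (tau : nat -> R) (c : R) : 0 <= c ->
  (forall i, 0 <= tau i <= t) -> (forall i j, (i <= j)%N -> tau i <= tau j) ->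
  (L t x (\bigcup_i [set w | (W (tau i) w < c)%R]) <= c%:E)%E.
Proof.
move=> c0 tauI tauM; pose F i := [set w | W (tau i) w < c].
have tau0 i : 0 <= tau i by have /andP[] := tauI i.
have FF i : F_ X (tau i) (F i).
  have -> : F i = W (tau i) @^-1` [set z | z < c] by [].
  apply: F_preimage; first exact: mW.
  by rewrite -set_itvNyo; exact: measurable_itv.
have FD i : F_ X (tau i) (seqDU F i).
  apply: (sigma_setD (F_sigma X _)) => //.
  apply: (big_ind (F_ X (tau i))).
  - exact: sigma_set0 (F_sigma X _).
  - by move=> A B; exact: (sigma_setU (F_sigma X _)).
  - by move=> j _; apply: F_mono (FF j); apply: tauM; exact: ltnW.
have mD i : measurable (seqDU F i) by exact: F_measurable (FD i).
have mF i : measurable (F i) by exact: F_measurable (FF i).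
have -> : \bigcup_i [set w | (W (tau i) w < c)%R] = \bigcup_i seqDU F i.
  by rewrite -seqDU_bigcup_eq.
have mU : measurable (\bigcup_i seqDU F i) by exact: bigcup_measurable.
rewrite measure_semi_bigcup//; do ?exact: trivIset_seqDU.
apply: (@le_trans _ _ (\sum_(i <oo) (c%:E * law X x (seqDU F i)))%E).
  apply: lee_nneseries => // i _.
  have /andP[_ ti] := tauI i.
  have e : L t x (seqDU F i) = (\int[law X x]_(w in seqDU F i) (W (tau i) w)%:E)%E.
    by rewrite -dW//; exact: hL.2.
  apply: le_trans (eq_lee e) _; apply: (@le_trans _ _ (\int[law X x]_(w in seqDU F i) cst c%:E w)%E); last first.
    by apply: eq_lee; exact: (integral_cst _ (mD i)).
  rewrite (ae_eq_integral (fun w => `|(W (tau i) w)%:E|)%E)//; last 3 first.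
  - by apply/measurable_EFinP; apply: measurable_funTS; exact: Ft_id (mW _).
  - apply: measurableT_comp => //.
    by apply/measurable_EFinP; apply: measurable_funTS; exact: Ft_id (mW _).
  - by apply: filterS W0 => w Wp _; rewrite /= gtr0_norm// Wp.
  apply: ae_ge0_le_integral => //.
  - apply: measurableT_comp => //.
    by apply/measurable_EFinP; apply: measurable_funTS; exact: Ft_id (mW _).
  - apply: filterS W0 => w Wp [Fw _]; rewrite /= lee_fin gtr0_norm ?Wp//.
    exact: ltW.
rewrite nneseriesZl// -measure_semi_bigcup//; do ?exact: trivIset_seqDU.
by rewrite -[leRHS]mule1; apply: lee_wpmul2l; [rewrite lee_fin|exact: probability_le1].
Qed.

Let gridtime t k i : R := Num.min t (i%:R / k.+1%:R).
Let hit t n k := \bigcup_i [set w | (W (gridtime t k i) w < n.+1%:R^-1)%R].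
(** The paths that all sufficiently fine grids see below 1/(n+1). By right continuity every path
    with such a value in [0, t] is among them ([not_low]). *)
Let low t n := \bigcup_m \bigcap_(k in [set k | (m <= k)%N]) hit t n k.

Let gridtimeI t k i : 0 <= t -> 0 <= gridtime t k i <= t.
Proof. by move=> t0; rewrite ge_min lexx andbT le_min t0 divr_ge0. Qed.

Let F_hit t n k : 0 <= t -> F_ X t (hit t n k).
Proof.
move=> t0; apply: (sigma_bigcup (F_sigma X t)) => i.
have /andP[g0 gt] := gridtimeI k i t0.
apply: F_mono gt _ _.
have -> : [set w | (W (gridtime t k i) w < n.+1%:R^-1)%R] =
  W (gridtime t k i) @^-1` [set z | z < n.+1%:R^-1] by [].
apply: F_preimage; first exact: mW.
by rewrite -set_itvNyo; exact: measurable_itv.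
Qed.

Let F_low t n : 0 <= t -> F_ X t (low t n).
Proof.
move=> t0; apply: (sigma_bigcup (F_sigma X t)) => m.
rewrite bigcap_mkcond; apply: (sigma_bigcap (F_sigma X t)) => k.
by case: ifPn => _; [exact: F_hit|exact: sigma_setT (F_sigma X t)].
Qed.

(** The intersections [V m] increase to [low t n], and each lies in the single event [hit t n m], to
    which [first_passage_le] applies. *)
Let low_le t n : 0 <= t -> (L t x (low t n) <= (n.+1%:R^-1)%:E)%E.
Proof.
move=> t0.
pose V m := \bigcap_(k in [set k | (m <= k)%N]) hit t n k.
have mV m : measurable (V m).
  by apply: bigcap_measurable => [|k _]; [exists m => /=|exact: F_measurable (F_hit n k t0)].
have cV : (L t x \o V) m @[m --> \oo] --> L t x (\bigcup_m V m).
  apply: nondecreasing_cvg_mu => //; first exact: bigcup_measurable.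
  by move=> i j ij; apply/subsetPset => w Vw k /= jk; apply: Vw => /=; exact: leq_trans jk.
rewrite -(cvg_lim _ cV)//; apply: lime_le; first by apply/cvg_ex; eexists; exact: cV.
apply: nearW => m /=.
apply: (@le_trans _ _ (L t x (hit t n m))).
  apply: le_measure; rewrite ?inE//; first exact: F_measurable (F_hit n m t0).
  by move=> w Vw; apply: Vw => /=.
apply: first_passage_le; first by rewrite invr_ge0.
  by move=> i; exact: gridtimeI.
move=> i j ij; rewrite /gridtime le_min !ge_min lexx/=.
by rewrite ler_pM2r ?invr_gt0// ler_nat ij orbT.
Qed.

Let not_low t n w : 0 < t -> cadlag_upto t (W ^~ w) -> ~ low t n w ->
  forall s, 0 <= s <= t -> n.+1%:R^-1 <= W s w.
Proof.
move=> t0 [rW _] nl s sI; rewrite leNgt; apply/negP => Ws; apply: nl.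
have gW : W (grid t k s) w @[k --> \oo] --> W s w.
  apply: (@grid_right_cvg R R (W ^~ w) t s sI) => st.
  by apply: rW; have /andP[-> _] := sI.
have [m _ h] := gW _ (lt_nbhsl Ws); exists m => // k /= mk; have := h k mk.
rewrite /grid => hk; exists (Num.truncn (s * k.+1%:R)).+1 => //=.
Qed.

Let bad t := \bigcap_n low t n.

Let bad0 t : 0 < t -> law X x (bad t) = 0%E.
Proof.
move=> /ltW t0; have Fb : F_ X t (bad t).
  by apply: (sigma_bigcap (F_sigma X t)) => n; exact: F_low.
apply/(hL.1 t _ t0 Fb); apply/eqP; rewrite -measure_le0.
apply/lee_addgt0Pr => e e0; rewrite add0e.
have [n ne] : exists n : nat, n.+1%:R^-1 <= e.
  have [m _ hm] := near_infty_natSinv_lt (PosNum e0).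
  by exists m; apply/ltW; exact: (hm m (leqnn m)).
apply: (@le_trans _ _ (L t x (low t n))).
  apply: le_measure; rewrite ?inE//.
  - exact: F_measurable Fb.
  - exact: F_measurable (F_low n t0).
  - by move=> w; apply.
by apply: le_trans (low_le n t0) _; rewrite lee_fin.
Qed.

(** Letting the level 1/(n+1) tend to 0, paths that come arbitrarily near 0 on [0, t] are L-null,
    hence P_x-null by equivalence. A positive lower bound on [0, t] passes to the left limit. *)
Lemma positive_left_limits : {ae law X x, forall w, forall t : R, 0 < t ->
  exists2 l : R, 0 < l & W v w @[v --> t^'-] --> l}.
Proof.
suff : {ae law X x, forall w, forall t : R, exists n, forall s, 0 <= s <= t ->
    n.+1%:R^-1 <= W s w}.
  move=> hb; apply: filterS2 hb cW => w hb cWw t t0.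
  have [n hn] := hb t.
  have [_ lW] := cWw t (ltW t0).
  have {lW}/cvg_ex[l Wl] := lW t (introT andP (conj t0 (lexx t))).
  exists l => //; apply: (@lt_le_trans _ _ n.+1%:R^-1); first by rewrite invr_gt0.
  apply: (cvgr_to_ge Wl); apply: filterS (at_left_within t0) => v.
  by rewrite in_itv/=; exact: hn.
apply: ae_all_times => [s t w st [n hn]|t t0].
  by exists n => v /andP[v0 vs]; apply: hn; rewrite v0 (le_trans vs).
have nb : {ae law X x, forall w, ~ bad t w}.
  exists (bad t); split; [|exact: bad0|by move=> w /contrapT].
  apply: (@F_measurable _ _ _ _ X t); apply: (sigma_bigcap (F_sigma X t)) => n.
  exact: F_low (ltW t0).
apply: filterS2 nb cW => w nb cWw.
have [n nl] : exists n, ~ low t n w.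
  by apply: contrapT => h; apply: nb => n _; apply: contrapT => nl; apply: h; exists n.
by exists n; exact: not_low t0 (cWw t (ltW t0)) nl.
Qed.

End positive_martingale.

(** * Localization *)

Section localization.
Context {R : realType} {E : ptopologicalType} {d : measure_display}
  {Omega : measurableType d}.
Variable X : borel_right_process R E Omega.
Local Notation Ft t := (g_sigma_algebraType (F_ X t)).
Local Notation leb := (@lebesgue_measure R).

Lemma primitive_integral f (t : R) : integrable_upto t f ->
  (primitive f t)%:E = (\int[leb]_(s in `[0%R, t]) (f s)%:E)%E.
Proof. by move=> fi; rewrite /primitive EFin_Rintegral. Qed.

Definition clock (k : R -> Omega -> R) (t : R) (w : Omega) : \bar R :=
  (\int[leb]_(s in `[0%R, t]) `|k s w|%:E)%E.

Variables (k : R -> Omega -> R) (x : E).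
Hypothesis hE : lusin_space R E.
Hypothesis pk : progressive X k.
Hypothesis fk : forall t : R, 0 < t ->
  {ae law X x, forall w, (clock k t w < +oo)%E}.

Let mk (t : R) (w : Omega) : 0 <= t -> measurable_fun `[0, t] (k ^~ w).
Proof.
by move=> t0; apply: jointly_measurable_section; exact: progressive_jointly pk t0.
Qed.

Lemma measurable_clock (t : R) : 0 <= t -> measurable_fun [set: Ft t] (clock k t).
Proof. by move=> t0; exact: (@measurable_time_abs R _ (Ft t) t k (pk t0)). Qed.

Lemma clock_le (s t : R) w : 0 <= s -> s <= t -> (clock k s w <= clock k t w)%E.
Proof.
move=> s0 st; apply: ge0_subset_integral => //.
  by apply/measurable_EFinP/measurableT_comp => //; exact: mk (le_trans s0 st).
by move=> v /=; rewrite !in_itv/= => /andP[-> vs]; exact: le_trans vs st.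
Qed.

Lemma clock_integrable (t : R) w : 0 <= t -> (clock k t w < +oo)%E ->
  integrable_upto t (fun s => `|k s w|).
Proof.
move=> t0 ft; apply/integrableP; split.
  by apply/measurable_EFinP/measurableT_comp => //; exact: mk.
by under eq_integral do rewrite /= normr_id.
Qed.

Lemma clock_primitive (t : R) w : 0 <= t -> (clock k t w < +oo)%E ->
  clock k t w = (primitive (fun s => `|k s w|) t)%:E.
Proof. by move=> t0 ft; rewrite primitive_integral//; exact: clock_integrable. Qed.

Let explode := [set w | exists n : nat, clock k n.+1%:R w = +oo%E].

Let explode_hull : exists N, [/\ F_ X 0 N, law X x N = 0%E & explode `<=` N].
Proof.
have mE : measurable explode.
  have -> : explode = \bigcup_n (clock k n.+1%:R @^-1` [set +oo%E]).
    by apply/seteqP; split => w [n]; [move=> h; exists n|move=> _ h; exists n].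
  apply: bigcup_measurable => n _; rewrite -[X in measurable X]setTI.
  by apply: (Ft_id (measurable_clock (ler0n _ _))) => //; exact: emeasurable_set1.
apply: null_hull => //; apply/eqP; rewrite -measure_le0.
have := ae_foralln (fun n => fk (ltr0Sn _ n)) => -[N [mN N0 h]].
rewrite -N0; apply: le_measure; rewrite ?inE// => w [n wn]; apply: h => /= /(_ n).
by rewrite wn.
Qed.

(** Explosion depends on the whole future of the path and is null only under P_x; a null event of
    F_0 containing it takes its place in the definition of [clock_time]. *)
Let null := projT1 (cid explode_hull).
Let F_null : F_ X 0 null. Proof. by rewrite /null; case: cid => N []. Qed.
Let null0 : law X x null = 0%E. Proof. by rewrite /null; case: cid => N []. Qed.
Let explode_null : explode `<=` null. Proof. by rewrite /null; case: cid => N []. Qed.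

Let finite_clock w (t : R) : ~ null w -> 0 <= t -> (clock k t w < +oo)%E.
Proof.
move=> nw t0; rewrite ltNge; apply/negP; rewrite leye_eq => /eqP tw; apply: nw.
apply: explode_null.
have [n _ tn] : \forall n \near \oo, t <= n%:R by exact: nbhs_infty_ger.
exists n; apply/eqP; rewrite -leye_eq -tw clock_le//.
by apply: le_trans (tn n (leqnn n)) _; rewrite ler_nat.
Qed.

(* On the explosion set the times are put equal to 0, which makes {sigma <= t}
   an event of F_t without right-continuity of the filtration. *)
Definition clock_time (n : nat) (w : Omega) : \bar R :=
  if w \in null then 0%E else
  ereal_inf [set t%:E | t in [set t : R | 0 <= t /\ (n%:R%:E <= clock k t w)%E]].

(** Off [null] the clock is a finite continuous function of time, so the infimum is attained. *)
Let clock_time_le n w (t : R) : ~ null w -> 0 <= t ->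
  (clock_time n w <= t%:E)%E = (n%:R%:E <= clock k t w)%E.
Proof.
move=> nw t0; rewrite /clock_time ifF; last by apply/negP; rewrite inE.
apply/idP/idP => [it|ct]; last by apply: ereal_inf_lbound; exists t.
rewrite leNgt; apply/negP => ct.
have t1 : 0 < t + 1 by rewrite ltr_pwDr.
have fi := clock_integrable (ltW t1) (finite_clock nw (ltW t1)).
have pc := primitive_continuous (ltW t1) fi.
have rc : primitive (fun s => `|k s w|) v @[v --> t^'+] --> primitive (fun s => `|k s w|) t.
  by have [h _] := continuous_cadlag pc; apply: h; rewrite t0 ltrDl ltr01.
have pt : primitive (fun s => `|k s w|) t < n%:R.
  by rewrite -lte_fin -clock_primitive//; exact: finite_clock.
have [v [tv vn]] : exists v, t < v /\ primitive (fun s => `|k s w|) v < n%:R.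
  have h : \forall v \near t^'+, t < v /\ primitive (fun s => `|k s w|) v < n%:R.
    by apply: filterI; [exact: nbhs_right_gt|exact: (rc _ (lt_nbhsl pt))].
  exact: filter_ex h.
move: it; rewrite leNgt => /negP; apply.
apply: (@lt_le_trans _ _ v%:E); first by rewrite lte_fin.
apply: le_ereal_inf_tmp => _ [u [u0 cu] <-]; rewrite lee_fin leNgt; apply/negP => uv.
have v0 : 0 <= v := le_trans t0 (ltW tv).
have := le_trans cu (clock_le w u0 (ltW uv)).
by rewrite clock_primitive//; [rewrite lee_fin leNgt vn|exact: finite_clock].
Qed.

Lemma clock_time_stopping n : stopping_time X (clock_time n).
Proof.
split => [w|t t0].
  rewrite /clock_time; case: ifP => // _.
  by apply: le_ereal_inf_tmp => _ [u [u0 _] <-]; rewrite lee_fin.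
have -> : [set w | (clock_time n w <= t%:E)%E] =
    null `|` clock k t @^-1` [set y | (n%:R%:E <= y)%E].
  apply/seteqP; split => w /=.
    by have [nw|nw] := pselect (null w); [left|right; rewrite -clock_time_le].
  have [nw _|nw] := pselect (null w).
    by rewrite /clock_time ifT ?inE// lee_fin.
  by case => //; rewrite clock_time_le.
apply: (sigma_setU (F_sigma X t)); first exact: F_mono t0 _ F_null.
apply/(sub_sigmaE (F_sigma X t)); rewrite -[X in measurable X]setTI.
apply: measurable_clock => //.
have -> : [set y : \bar R | (n%:R%:E <= y)%E] = `[n%:R%:E, +oo[%classic.
  by apply/seteqP; split => y; rewrite /= in_itv/= andbT.
exact: emeasurable_itv.
Qed.

Lemma clock_timeS n w : (clock_time n w <= clock_time n.+1 w)%E.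
Proof.
rewrite /clock_time; case: ifP => // _; apply: ereal_inf_le_tmp.
move=> _ [u [u0 cu] <-]; exists u => //; split => //.
by apply: le_trans cu; rewrite lee_fin ler_nat.
Qed.

Lemma clock_time_unbounded :
  {ae law X x, forall w, forall t : R, exists n, (t%:E <= clock_time n w)%E}.
Proof.
exists null; split; [exact: F_measurable F_null|exact: null0|].
move=> w /=; apply: contra_notP => nw t.
have [t0|t0] := leP t 0.
  by exists 0; have [h _] := clock_time_stopping 0; apply: le_trans (h w); rewrite lee_fin.
have [n _ nt] : \forall n \near \oo, primitive (fun s => `|k s w|) t < n%:R.
  exact: nbhs_infty_gtr.
exists n; rewrite leNgt; apply/negP => /ltW.
rewrite clock_time_le//; last exact: ltW.
rewrite (clock_primitive (ltW t0)); last exact: finite_clock nw (ltW t0).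
by rewrite lee_fin leNgt (nt n (leqnn n)).
Qed.

(** Strictly before [clock_time n] the clock is below n, and by continuity it is at most n at that
    time itself. On [null] the time is 0 and the integral runs over one point. *)
Lemma clock_time_bound n w (t : R) : 0 <= t ->
  (\int[leb]_(s in `[0%R, t]) `|alive (clock_time n) s w * k s w|%:E <= n%:R%:E)%E.
Proof.
move=> t0; have [s0 _] := clock_time_stopping n; have {}s0 := s0 w.
pose c := capped (clock_time n) t w.
have c0 : 0 <= c by exact: capped_ge0.
have ct : c <= t by exact: capped_le.
have cE s : 0 <= s -> s < c -> (s%:E < clock_time n w)%E.
  by move=> _; rewrite -lte_fin cappedE// lt_min => /andP[].
have -> : (\int[leb]_(s in `[0%R, t]) `|alive (clock_time n) s w * k s w|%:E)%E = clock k c w.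
  rewrite integral_mkcond [RHS]integral_mkcond; apply: eq_integral => s _.
  rewrite !patchE !mem_setE !in_itv/= /alive.
  have [s0'|s0']/= := leP 0 s => //.
  have [st|ts] := leP s t; last first.
    by rewrite ifF//; apply/negbTE; rewrite -ltNge; exact: le_lt_trans ct ts.
  rewrite -[s <= c]lee_fin cappedE// le_min lee_fin st/=.
  by case: (s%:E <= _)%E; rewrite ?mul1r// mul0r normr0.
have [nw|nw] := pselect (null w).
  have -> : c = 0 by rewrite /c /capped /clock_time ifT ?inE// min_r ?lee_fin.
  by rewrite /clock set_itv1 integral_set1 lee_fin.
have fc := finite_clock nw c0.
rewrite clock_primitive// lee_fin.
have [c0'|c0'] := ltP 0 c; last first.
  by have -> : c = 0 by [apply/eqP; rewrite eq_le c0 c0']; rewrite primitive0.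
have [_ _ lc] := (continuous_within_itvP _ c0').1 (primitive_continuous c0 (clock_integrable c0 fc)).
apply: (cvgr_to_le lc); near=> v.
have v0 : 0 <= v by near: v; exact: nbhs_left_ge.
have vc : v < c by near: v; exact: nbhs_left_lt.
rewrite -lee_fin -clock_primitive//; last exact: finite_clock.
apply/ltW; rewrite ltNge -clock_time_le// -ltNge; exact: cE.
Unshelve. all: by end_near.
Qed.

End localization.

(** * Change of law *)

Section premartingale_algebra.
Context {R : realType} {E : ptopologicalType} {d : measure_display}
  {Omega : measurableType d}.
Variable X : borel_right_process R E Omega.
Variables (mu : probability Omega R) (t1 : R).
Implicit Types Y Z : R -> Omega -> R.
Local Notation Ft t := (g_sigma_algebraType (F_ X t)).

Let Rint A Y s : premartingale X mu t1 Y -> 0 <= s <= t1 -> measurable A ->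
  mu.-integrable A (EFin \o Y s).
Proof. by move=> [iY _] sI mA; apply: integrableS (iY s sI). Qed.

Lemma premartingale_cst (c : R) : premartingale X mu t1 (fun _ _ => c).
Proof.
split => // s _; have -> : EFin \o (fun=> c) = cst c%:E :> (Omega -> \bar R) by [].
by apply: finite_measure_integrable_cst.
Qed.

Lemma premartingaleD Y Z : premartingale X mu t1 Y -> premartingale X mu t1 Z ->
  premartingale X mu t1 (fun s w => Y s w + Z s w).
Proof.
move=> pY pZ; split => [s sI|s u A s0 su ut FA].
  by apply: RintegrableD => //; [exact: pY.1|exact: pZ.1].
have mA := F_measurable FA.
have sI : 0 <= s <= t1 by rewrite s0 (le_trans su).
have uI : 0 <= u <= t1 by rewrite ut (le_trans s0).
rewrite RintegralD//; do ?exact: Rint.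
rewrite RintegralD//; do ?exact: Rint.
by rewrite (pY.2 s u A)// (pZ.2 s u A).
Qed.

Lemma premartingaleZ k Y : premartingale X mu t1 Y ->
  premartingale X mu t1 (fun s w => k * Y s w).
Proof.
move=> pY; split => [s sI|s u A s0 su ut FA].
  by apply: RintegrableZ => //; exact: pY.1.
have mA := F_measurable FA.
have sI : 0 <= s <= t1 by rewrite s0 (le_trans su).
have uI : 0 <= u <= t1 by rewrite ut (le_trans s0).
rewrite RintegralZl//; last exact: Rint.
rewrite RintegralZl//; last exact: Rint.
by rewrite (pY.2 s u A).
Qed.

Lemma premartingale_ae_eq Y Z :
  (forall s, 0 <= s <= t1 -> measurable_fun setT (Z s)) ->
  (forall s, 0 <= s <= t1 -> {ae mu, forall w, Y s w = Z s w}) ->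
  premartingale X mu t1 Y -> premartingale X mu t1 Z.
Proof.
move=> mZ YZ pY.
have eI s A : 0 <= s <= t1 -> measurable A ->
    (\int[mu]_(w in A) (Y s w)%:E = \int[mu]_(w in A) (Z s w)%:E)%E.
  move=> sI mA; apply: ae_eq_integral => //.
  - by apply/measurable_EFinP/measurable_funTS; exact: Rintegrable_measurable (pY.1 s sI).
  - by apply/measurable_EFinP/measurable_funTS; exact: mZ.
  - by apply: filterS (YZ s sI) => w /= -> _.
split => [s sI|s u A s0 su ut FA].
  have mYs : measurable_fun setT (Y s) by exact: Rintegrable_measurable (pY.1 s sI).
  apply/integrableP; split; first by apply/measurable_EFinP; exact: mZ.
  have /integrableP[_] := pY.1 s sI.
  rewrite (ae_eq_integral (fun w => `|(Z s w)%:E|%E))//.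
  - by apply: measurableT_comp => //; exact/measurable_EFinP.
  - by apply: measurableT_comp => //; apply/measurable_EFinP; exact: mZ.
  - by apply: filterS (YZ s sI) => w /= -> _.
have mA := F_measurable FA.
have sI : 0 <= s <= t1 by rewrite s0 (le_trans su).
have uI : 0 <= u <= t1 by rewrite ut (le_trans s0).
by have := pY.2 s u A s0 su ut FA; rewrite /Rintegral !eI.
Qed.

End premartingale_algebra.

Section change_of_law.
Context {R : realType} {E : ptopologicalType} {d : measure_display}
  {Omega : measurableType d}.
Variable X : borel_right_process R E Omega.
Local Notation Ft t := (g_sigma_algebraType (F_ X t)).
Variables (m1 m2 : probability Omega R) (s : R) (th : Omega -> R).
Hypothesis mth : measurable_fun [set: Ft s] th.
Hypothesis th0 : forall w, 0 <= th w.
Hypothesis density : forall A, F_ X s A -> m1 A = (\int[m2]_(w in A) (th w)%:E)%E.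

Lemma density_ge0_integral (xi : Omega -> \bar R) :
  measurable_fun [set: Ft s] xi -> (forall w, 0 <= xi w)%E ->
  (\int[m1]_w xi w = \int[m2]_w ((th w)%:E * xi w))%E.
Proof.
move=> mxi xi0; transitivity (\int[m1]_w (xi w * (cst 1%R w)%:E))%E.
  by apply: eq_integral => w _; rewrite mule1.
transitivity (\int[m2]_w (xi w * (th w)%:E))%E; last first.
  by apply: eq_integral => w _; rewrite muleC.
apply: (@weighted_integral_eq _ _ _ _ (F_sigma X s) (@F_measurable _ _ _ _ X s)) => //.
  exact: Ft_id mth.
move=> A FA; have mA := F_measurable FA; rewrite -density//.
by transitivity (1 * m1 A)%E; [exact: (@integral_cst _ _ _ m1 _ mA 1%:E)|rewrite mul1e].
Qed.

Lemma density_integral (f : Omega -> R) A : measurable_fun [set: Ft s] f ->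
  F_ X s A ->
  (\int[m1]_(w in A) (f w)%:E = \int[m2]_(w in A) (th w * f w)%:E)%E.
Proof.
move=> mf FA; have mA : measurable (A : set (Ft s)) by apply/(sub_sigmaE (F_sigma X s)).
rewrite integral_mkcond [RHS]integral_mkcond.
have mfA : measurable_fun [set: Ft s] ((EFin \o f) \_ A).
  by apply/(measurable_restrictT _ mA); apply: measurable_funTS; exact/measurable_EFinP.
rewrite integralE [RHS]integralE; congr (_ - _)%E.
  rewrite density_ge0_integral//; last exact: measurable_funepos.
  apply: eq_integral => w _; rewrite !funeposE !patchE; case: ifP => wA /=.
    by rewrite -!EFin_max -EFinM; congr EFin; rewrite maxr_pMr// mulr0.
  by rewrite maxxx mule0.
rewrite density_ge0_integral//; last exact: measurable_funeneg.
apply: eq_integral => w _; rewrite !funenegE !patchE; case: ifP => wA /=.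
  by rewrite -!EFin_max -EFinM; congr EFin; rewrite maxr_pMr// mulr0 mulrN.
by rewrite oppr0 maxxx mule0.
Qed.

Lemma density_integrable (f : Omega -> R) : measurable_fun [set: Ft s] f ->
  m1.-integrable setT (EFin \o f) ->
  m2.-integrable setT (EFin \o (fun w => th w * f w)).
Proof.
move=> mf /integrableP[_ fi]; apply/integrableP; split.
  apply/measurable_EFinP; apply: measurable_funM; [exact: Ft_id mth|exact: Ft_id mf].
move: fi; rewrite density_ge0_integral//; last first.
  apply: measurableT_comp => //; exact/measurable_EFinP.
under eq_integral => w _ do rewrite -[(th w)%:E]gee0_abs ?lee_fin// -abseM -EFinM.
by [].
Qed.

End change_of_law.

(** Bayes' rule: both sides of the martingale equality are rewritten under m2, each with the density
    at its own time. *)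
Lemma density_premartingale (R : realType) (E : ptopologicalType)
    (d : measure_display) (Omega : measurableType d)
    (X : borel_right_process R E Omega) (m1 m2 : probability Omega R) (t1 : R)
    (th N : R -> Omega -> R) :
  nonanticipating X t1 th -> (forall s w, 0 <= th s w) ->
  (forall s A, 0 <= s <= t1 -> F_ X s A ->
    m1 A = (\int[m2]_(w in A) (th s w)%:E)%E) ->
  nonanticipating X t1 N -> premartingale X m1 t1 N ->
  premartingale X m2 t1 (fun s w => th s w * N s w).
Proof.
move=> ath th0 dth aN pN; split => [s sI|s u A s0 su ut FA].
  apply: (density_integrable (ath s sI) (th0 s) _ (aN s sI) (pN.1 s sI)).
  by move=> A; exact: dth.
have sI : 0 <= s <= t1 by rewrite s0 (le_trans su).
have uI : 0 <= u <= t1 by rewrite ut (le_trans s0).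
have := pN.2 s u A s0 su ut FA; rewrite /Rintegral.
have e v : 0 <= v <= t1 -> F_ X v A ->
    (\int[m1]_(w in A) (N v w)%:E = \int[m2]_(w in A) (th v w * N v w)%:E)%E.
  move=> vI; apply: (density_integral (ath v vI) (th0 v) _ (aN v vI)) => B; exact: dth.
by rewrite !e//; exact: F_mono su _ FA.
Qed.

Section exponential_transform.
Context {R : realType}.
Local Notation leb := (@lebesgue_measure R).

(** By [exp_rule], 1 + \int b = D, and by the product rule \int c = D \int g; moreover th D = kap /
    k0. The boundary terms thus add up to (kap / k0)(y + \int g) = kap u / k0, and the integrands to
    (kap / k0)(g - a u) = q / k0. *)
Lemma exponential_transform_path (r : R) (a g q kap u : R -> R) (k0 K : R) :
  0 <= r -> k0 != 0 -> integrable_upto r a -> integrable_upto r g ->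
  measurable_fun `[0, r] kap -> measurable_fun `[0, r] u ->
  measurable_fun `[0, r] q ->
  (forall s, 0 <= s <= r -> `|kap s| <= K) ->
  (forall s, 0 <= s <= r -> `|u s| <= K) ->
  {ae leb, forall s, 0 <= s <= r -> q s = kap s * (g s - a s * u s)} ->
  let D t := expR (primitive (fun s => - a s) t) in
  let th t := expR (primitive a t) * kap t / k0 in
  let y t := u t - primitive g t in
  let b s := - a s * D s in
  let c s := g s * D s + b s * primitive g s in
  (th r * y r * (1 + primitive b r) - primitive (fun s => b s * (th s * y s)) r) +
  (th r * (0 + primitive c r) - primitive (fun s => c s * th s) r) =
  k0^-1 * (kap r * u r - primitive q r).
Proof.
move=> r0 k00 ia ig mk mu mq kK uK qE D th y b c.
have iNa : integrable_upto r (fun s => - a s).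
  have h : integrable_upto r (fun s => -1 * a s) by exact: RintegrableZ.
  by apply: eq_integrable h => // s _ /=; rewrite mulN1r.
have rr : 0 <= r <= r by rewrite r0 lexx.
have DE t : 0 <= t <= r -> 1 + primitive b t = D t by move=> tI; rewrite /D (exp_rule r0).
have ib : integrable_upto r b.
  have h := integrable_upto_mul iNa (g := D) (K := expR (primitive (fun s => `|- a s|) r)).
  apply: h.
    by apply: measurableT_comp; [exact: measurable_expR|exact: measurable_primitive].
  move=> s sI; rewrite ger0_norm ?expR_ge0// ler_expR.
  by apply: le_trans (ler_norm _) _; exact: primitive_bounded.
have cE : primitive c r = primitive g r * D r.
  have /= := product_rule 0 1 r0 ig ib rr; rewrite DE// mul0r !add0r => ->.
  by apply: eq_primitive => s sI; rewrite add0r DE.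
have thD s : 0 <= s <= r -> th s * D s = kap s / k0.
  move=> /andP[s0 sr]; rewrite /th /D.
  have -> : primitive (fun v => - a v) s = - primitive a s.
    rewrite -mulN1r -primitiveZ; last exact: integrable_uptoS sr ia.
    by apply: eq_primitive => v _; rewrite mulN1r.
  rewrite expRN; field.
  by rewrite k00 gt_eqF ?expR_gt0.
(* [m1], [m2] and [m3] are the bounded factors by which the integrable functions a, g and a are
   multiplied once th D is simplified. *)
pose m1 s := - (kap s / k0) * y s.
pose m2 s := kap s / k0.
pose m3 s := - (kap s / k0) * primitive g s.
have mG : measurable_fun `[0, r] (primitive g) by exact: measurable_primitive.
pose GK := primitive (fun s => `|g s|) r.
have GKE s : 0 <= s <= r -> `|primitive g s| <= GK by move=> sI; exact: primitive_bounded.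
have kk0 s : 0 <= s <= r -> `|kap s / k0| <= K / `|k0|.
  by move=> sI; rewrite normrM normfV ler_pM2r ?invr_gt0 ?normr_gt0// kK.
have mkk : measurable_fun `[0, r] (fun s => kap s / k0) by exact: measurable_funM.
have mN (f : R -> R) : measurable_fun `[0, r] f -> measurable_fun `[0, r] (fun s => - f s).
  by move=> mf; exact: measurableT_comp.
have im1 : integrable_upto r (fun s => a s * m1 s).
  apply: (integrable_upto_mul ia (K := K / `|k0| * (K + GK))).
    by apply: measurable_funM; [exact: mN|exact: measurable_funB].
  move=> s sI; rewrite normrM normrN ler_pM ?kk0//.
  by apply: le_trans (ler_normB _ _) _; rewrite lerD ?uK ?GKE.
have im2 : integrable_upto r (fun s => g s * m2 s).
  by apply: (integrable_upto_mul ig (K := K / `|k0|)).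
have im3 : integrable_upto r (fun s => a s * m3 s).
  apply: (integrable_upto_mul ia (K := K / `|k0| * GK)).
    by apply: measurable_funM; [exact: mN|].
  by move=> s sI; rewrite normrM normrN ler_pM ?kk0 ?GKE.
have e1 : primitive (fun s => b s * (th s * y s)) r = primitive (fun s => a s * m1 s) r.
  apply: eq_primitive => s sI; rewrite /m1 -thD// /b; ring.
have e2 : primitive (fun s => c s * th s) r =
    primitive (fun s => g s * m2 s + a s * m3 s) r.
  by apply: eq_primitive => s sI; rewrite /m3 /m2 -thD// /c /b; ring.
have e3 : primitive q r = k0 * primitive (fun s => g s * m2 s + (a s * m3 s + a s * m1 s)) r.
  have iS : integrable_upto r (fun s => g s * m2 s + (a s * m3 s + a s * m1 s)).
    by do ?apply: RintegrableD.
  rewrite -primitiveZ//; apply/esym; apply: ae_eq_primitive => //.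
    exact: RintegrableZ.
  apply: lebesgue_aeS qE => s qs sI; rewrite qs// /m1 /m2 /m3 /y; field.
  by [].
rewrite e1 e2 e3 DE// cE add0r.
rewrite !primitiveD//; last exact: RintegrableD.
have -> : th r * y r * D r = kap r / k0 * y r by rewrite -thD//; ring.
have -> : th r * (primitive g r * D r) = kap r / k0 * primitive g r.
  by rewrite -thD//; ring.
rewrite /y; field.
by [].
Qed.

End exponential_transform.

Section integral_bounds.
Context {R : realType}.
Local Notation leb := (@lebesgue_measure R).

Lemma abs_integralD_le (t : R) (f h : R -> R) (C K : R) :
  measurable_fun `[0, t] f -> measurable_fun `[0, t] h ->
  (\int[leb]_(s in `[0%R, t]) `|f s|%:E <= C%:E)%E ->
  (\int[leb]_(s in `[0%R, t]) `|h s|%:E <= K%:E)%E ->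
  (\int[leb]_(s in `[0%R, t]) `|f s + h s|%:E <= (C + K)%:E)%E.
Proof.
move=> mf mh fC hK; rewrite EFinD; apply: le_trans (leeD fC hK).
have mabs (k : R -> R) : measurable_fun `[0, t] k ->
    measurable_fun `[0, t] (fun s => `|k s|%:E).
  by move=> mk; apply/measurable_EFinP/measurableT_comp.
rewrite -ge0_integralD//; do ?exact: mabs.
apply: ge0_le_integral => //.
- by apply: mabs; exact: measurable_funD.
- by apply: emeasurable_funD; exact: mabs.
- by move=> s _; rewrite -EFinD lee_fin ler_normD.
Qed.

Lemma abs_integralM_le (t : R) (f h : R -> R) (C K : R) :
  measurable_fun `[0, t] f -> measurable_fun `[0, t] h -> 0 <= K ->
  (forall s, 0 <= s <= t -> `|h s| <= K) ->
  (\int[leb]_(s in `[0%R, t]) `|f s|%:E <= C%:E)%E ->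
  (\int[leb]_(s in `[0%R, t]) `|f s * h s|%:E <= (K * C)%:E)%E.
Proof.
move=> mf mh K0 hK fC; rewrite EFinM.
apply: (@le_trans _ _ (K%:E * \int[leb]_(s in `[0%R, t]) `|f s|%:E)%E); last first.
  by apply: lee_wpmul2l.
have mabs (k : R -> R) : measurable_fun `[0, t] k ->
    measurable_fun `[0, t] (fun s => `|k s|%:E).
  by move=> mk; apply/measurable_EFinP/measurableT_comp.
rewrite -ge0_integralZl//; last exact: mabs.
apply: ge0_le_integral => //.
- by apply: mabs; exact: measurable_funM.
- by apply: measurable_funeM; exact: mabs.
- by move=> s; rewrite /= in_itv/= => sI; rewrite -EFinM lee_fin normrM mulrC ler_wpM2r// hK.
Qed.

Lemma primitive_abs_le (t : R) (f : R -> R) (C : R) : integrable_upto t f ->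
  (\int[leb]_(s in `[0%R, t]) `|f s|%:E <= C%:E)%E ->
  forall s, 0 <= s <= t -> `|primitive f s| <= C.
Proof.
move=> fi fC s sI; apply: le_trans (primitive_bounded fi sI) _.
by rewrite -lee_fin primitive_integral//; exact: Rintegrable_norm.
Qed.

End integral_bounds.

Lemma cadlag_comp (R : realType) (t : R) (f u : R -> R) : continuous f ->
  cadlag_upto t u -> cadlag_upto t (fun s => f (u s)).
Proof.
move=> cf [ru lu]; split => s sI.
  by apply: continuous_cvg (ru s sI); exact: cf.
have /cvg_ex[l ul] := lu s sI; apply/cvg_ex; exists (f l).
by apply: continuous_cvg ul; exact: cf.
Qed.

(* With D = exp (- \int_0^. 1_{s <= rho} a (X_s) ds), G = \int_0^. 1_{s <= rho} g (X_s) ds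
   and N the L1-martingale Y1 stopped at rho, the processes th N and th are
   L2-martingales; integrating them by parts against D and G D gives a process V
   that at times before rho is (kappa u (X) - \int q (X)) / k0. *)
Section girsanov_step.
Context {R : realType} {E : ptopologicalType} {d : measure_display}
  {Omega : measurableType d}.
Variable X : borel_right_process R E Omega.
Local Notation Ft t := (g_sigma_algebraType (F_ X t)).
Local Notation leb := (@lebesgue_measure R).

Lemma progressive_cst (c : R) : progressive X (fun _ _ => c).
Proof. by move=> t _; exact: measurable_cst. Qed.

Lemma progressiveD (Y Z : R -> Omega -> R) : progressive X Y ->
  progressive X Z -> progressive X (fun s w => Y s w + Z s w).
Proof. by move=> pY pZ t t0; apply: measurable_funD; [exact: pY|exact: pZ]. Qed.

Lemma progressiveB (Y Z : R -> Omega -> R) : progressive X Y ->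
  progressive X Z -> progressive X (fun s w => Y s w - Z s w).
Proof. by move=> pY pZ t t0; apply: measurable_funB; [exact: pY|exact: pZ]. Qed.

Lemma progressiveN (Y : R -> Omega -> R) : progressive X Y ->
  progressive X (fun s w => - Y s w).
Proof. by move=> pY t t0; apply: measurableT_comp => //; exact: pY. Qed.

Lemma progressive_nonanticipating (Y : R -> Omega -> R) t :
  progressive X Y -> nonanticipating X t Y.
Proof. by move=> pY s /andP[s0 _]; exact: progressive_adapted. Qed.

Lemma progressive_section (Y : R -> Omega -> R) (t : R) w : progressive X Y ->
  0 <= t -> measurable_fun `[0, t] (Y ^~ w).
Proof.
by move=> pY t0; apply: jointly_measurable_section; exact: progressive_jointly pY t0.
Qed.

Lemma capped_capped (T sg : Omega -> \bar R) s w : (0 <= T w)%E -> (0 <= sg w)%E ->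
  capped T (capped sg s w) w = capped (fun w => Order.min (T w) (sg w)) s w.
Proof.
move=> T0 s0; apply: EFin_inj.
rewrite !cappedE// ?le_min ?T0//.
by rewrite -minA; congr Order.min; exact: minC.
Qed.

Lemma cadlag_capped t (T : Omega -> \bar R) (Y : R -> Omega -> R) w :
  (0 <= T w)%E -> 0 <= t -> cadlag_upto t (Y ^~ w) ->
  cadlag_upto t (fun s => stopped Y T s w).
Proof.
move=> T0 t0 cY; apply: cadlag_eq (cadlag_stopped (capped_ge0 T0 t0) cY).
by move=> s /andP[_ st]; rewrite minC -capped_min.
Qed.

Variables (mu1 mu2 : probability Omega R) (t1 : R).
Variables (kappa a u g q : E -> R) (k0 C : R) (T sg : Omega -> \bar R).
Hypothesis hE : lusin_space R E.
Hypothesis t10 : 0 <= t1.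
Hypothesis C0 : 0 <= C.
Hypothesis mkappa : measurable_fun [set: borel E] kappa.
Hypothesis ma : measurable_fun [set: borel E] a.
Hypothesis mu : measurable_fun [set: borel E] u.
Hypothesis mg : measurable_fun [set: borel E] g.
Hypothesis mq : measurable_fun [set: borel E] q.
Hypothesis kappa0 : forall y, 0 < kappa y.
Hypothesis k00 : 0 < k0.

Let th (s : R) (w : Omega) : R :=
  expR (pint (fun s w => a (X s w)) s w) * kappa (X s w) / k0.
Let Y1 (s : R) (w : Omega) : R := u (X s w) - time_integral X g s w.
Let Y2 (s : R) (w : Omega) : R := kappa (X s w) * u (X s w) - time_integral X q s w.

Hypothesis density : forall s A, 0 <= s <= t1 -> F_ X s A ->
  mu1 A = (\int[mu2]_(w in A) (th s w)%:E)%E.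
Hypothesis sT : stopping_time X T.
Hypothesis ssg : stopping_time X sg.
Hypothesis bound_a : forall w,
  (\int[leb]_(s in `[0%R, t1]) `|alive sg s w * a (X s w)|%:E <= C%:E)%E.
Hypothesis bound_g : forall w,
  (\int[leb]_(s in `[0%R, t1]) `|alive sg s w * g (X s w)|%:E <= C%:E)%E.
Hypothesis pY1 : premartingale X mu1 t1 (stopped Y1 T).
Hypothesis rcY1 : {ae mu1, forall w, forall s, 0 <= s < t1 ->
  stopped Y1 T v w @[v --> s^'+] --> stopped Y1 T s w}.
Hypothesis good : {ae mu2, forall w,
  [/\ cadlag_upto t1 (fun s => kappa (X s w)),
      cadlag_upto t1 (fun s => Y1 s w),
      integrable_upto t1 (fun s => a (X s w)),
      integrable_upto t1 (fun s => g (X s w)) &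
      {ae leb, forall s, 0 <= s <= t1 ->
        q (X s w) = kappa (X s w) * (g (X s w) - a (X s w) * u (X s w))}]}.

Let pf (f : E -> R) : measurable_fun [set: borel E] f ->
  progressive X (fun s w => f (X s w)).
Proof. by move=> mf; apply: progressive_comp mf _; exact: progressive_path. Qed.

Let pth : progressive X th.
Proof.
apply: progressiveM (progressive_cst _); apply: progressiveM (pf mkappa).
by apply: (progressive_comp (@measurable_expR R)); apply: progressive_pint; exact: pf.
Qed.

Let th_ge0 s w : 0 <= th s w.
Proof. by rewrite /th divr_ge0 ?mulr_ge0 ?expR_ge0// ltW. Qed.

Let rho w := Order.min (T w) (sg w).
Let srho : stopping_time X rho. Proof. exact: stopping_time_min. Qed.
Let rho0 w : (0 <= rho w)%E. Proof. by have [h _] := srho. Qed.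

Let prY1 : progressive X Y1.
Proof. by apply: progressiveB; [exact: pf|apply: progressive_pint; exact: pf]. Qed.

Let prY2 : progressive X Y2.
Proof.
by apply: progressiveB; [apply: progressiveM; exact: pf|apply: progressive_pint; exact: pf].
Qed.

Let N := stopped Y1 rho.
Let prN : progressive X N. Proof. exact: progressive_stopped. Qed.

(** Y1 is a martingale when stopped at T; the further stop at [sg] is optional stopping. *)
Let pN : premartingale X mu1 t1 N.
Proof.
have -> : N = (fun s w => stopped Y1 T (capped sg s w) w).
  apply/funext => s; apply/funext => w; rewrite /N /stopped.
  by rewrite -/(capped T (capped sg s w) w) -/(capped rho s w) capped_capped//;
    [have [h _] := sT|have [h _] := ssg].
have prS : progressive X (stopped Y1 T) by exact: progressive_stopped.
apply: optional_stopping => //; first exact: progressive_nonanticipating.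
move=> s /andP[s0 _]; apply: (@Ft_id _ _ _ _ X s).
have h : progressive X (fun s w => stopped Y1 T (capped sg s w) w) by exact: progressive_stopped.
exact: (progressive_adapted h s0).
Qed.

Let pthN : premartingale X mu2 t1 (fun s w => th s w * N s w).
Proof.
apply: (density_premartingale _ th_ge0 density _ pN); exact: progressive_nonanticipating.
Qed.

Let pth1 : premartingale X mu2 t1 th.
Proof.
have := density_premartingale (progressive_nonanticipating pth) th_ge0 density _
  (premartingale_cst X mu1 t1 1).
move=> /(_ (progressive_nonanticipating (progressive_cst 1))).
by congr premartingale; apply/funext => s; apply/funext => w; rewrite mulr1.
Qed.

(** Switching the rates off after rho makes their time integrals bounded by the constant C for every
    w, as [premartingale_by_parts] demands. *)
Let rate (f : E -> R) (s : R) w := alive rho s w * f (X s w).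
Let prate f : measurable_fun [set: borel E] f -> progressive X (rate f).
Proof. by move=> mf; apply: progressiveM; [exact: progressive_alive|exact: pf]. Qed.

Let rate_bound f w : measurable_fun [set: borel E] f ->
  (\int[leb]_(s in `[0%R, t1]) `|alive sg s w * f (X s w)|%:E <= C%:E)%E ->
  (\int[leb]_(s in `[0%R, t1]) `|rate f s w|%:E <= C%:E)%E.
Proof.
move=> mf; apply: le_trans; apply: ge0_le_integral => //.
- apply/measurable_EFinP/measurableT_comp => //; exact: progressive_section (prate mf) t10.
- apply/measurable_EFinP/measurableT_comp => //.
  apply: (@progressive_section (fun s w => alive sg s w * f (X s w))) t10.
  by apply: progressiveM; [exact: progressive_alive|exact: pf].
- move=> s _; rewrite lee_fin /rate !normrM ler_wpM2r// /alive /rho le_min.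
  by case: (s%:E <= T w)%E; case: (s%:E <= sg w)%E; rewrite ?normr0 ?normr1.
Qed.

Let rate_integrable f w : measurable_fun [set: borel E] f ->
  (\int[leb]_(s in `[0%R, t1]) `|alive sg s w * f (X s w)|%:E <= C%:E)%E ->
  integrable_upto t1 (rate f ^~ w).
Proof.
move=> mf bf; apply/integrableP; split.
  by apply/measurable_EFinP; exact: progressive_section (prate mf) t10.
by apply: le_lt_trans (rate_bound mf bf) _; rewrite ltry.
Qed.

Let b0 s w := - rate a s w.
Let D t w := expR (pint b0 t w).
Let b s w := b0 s w * D s w.
Let c s w := rate g s w * D s w + b s w * pint (rate g) s w.

Let pb0 : progressive X b0. Proof. by apply: progressiveN; exact: prate. Qed.
Let pD : progressive X D.
Proof. by apply: (progressive_comp (@measurable_expR R)); exact: progressive_pint. Qed.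
Let pb : progressive X b. Proof. exact: progressiveM. Qed.
Let pG : progressive X (pint (rate g)).
Proof. by apply: progressive_pint; exact: prate. Qed.
Let pc : progressive X c.
Proof. by apply: progressiveD; apply: progressiveM => //; exact: prate. Qed.

Let mpath (Y : R -> Omega -> R) (w : Omega) : progressive X Y -> measurable_fun `[0, t1] (Y ^~ w).
Proof. by move=> pY; exact: progressive_section pY t10. Qed.

Let b0C w : (\int[leb]_(s in `[0%R, t1]) `|b0 s w|%:E <= C%:E)%E.
Proof.
under eq_integral do rewrite normrN.
exact: rate_bound.
Qed.

Let ib0 w : integrable_upto t1 (b0 ^~ w).
Proof.
apply/integrableP; split; first by apply/measurable_EFinP; exact: mpath.
by apply: le_lt_trans (b0C w) _; rewrite ltry.
Qed.

Let D_le w s : 0 <= s <= t1 -> `|D s w| <= expR C.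
Proof.
move=> sI; rewrite ger0_norm ?expR_ge0// ler_expR; apply: le_trans (ler_norm _) _.
exact: primitive_abs_le (ib0 w) (b0C w) s sI.
Qed.

Let bC w : (\int[leb]_(s in `[0%R, t1]) `|b s w|%:E <= (expR C * C)%:E)%E.
Proof.
by apply: abs_integralM_le (D_le w) (b0C w); [exact: mpath|exact: mpath|exact: expR_ge0].
Qed.

Let ib w : integrable_upto t1 (b ^~ w).
Proof.
apply/integrableP; split; first by apply/measurable_EFinP; exact: mpath.
by apply: le_lt_trans (bC w) _; rewrite ltry.
Qed.

Let G_le w s : 0 <= s <= t1 -> `|pint (rate g) s w| <= C.
Proof.
move=> sI.
exact: primitive_abs_le (rate_integrable mg (bound_g w)) (rate_bound mg (bound_g w)) s sI.
Qed.

Let cC w : (\int[leb]_(s in `[0%R, t1]) `|c s w|%:E <= (expR C * C + C * (expR C * C))%:E)%E.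
Proof.
apply: (@abs_integralD_le R t1 (fun s => rate g s w * D s w) (fun s => b s w * pint (rate g) s w)).
- by apply: (@mpath (fun s w => rate g s w * D s w)); apply: progressiveM => //; exact: prate.
- by apply: (@mpath (fun s w => b s w * pint (rate g) s w)); apply: progressiveM.
- apply: abs_integralM_le (D_le w) (rate_bound mg (bound_g w)).
  + by apply: mpath; exact: prate.
  + exact: mpath.
  + exact: expR_ge0.
- by apply: abs_integralM_le (G_le w) (bC w) => //; exact: mpath.
Qed.

Let ic w : integrable_upto t1 (c ^~ w).
Proof.
apply/integrableP; split; first by apply/measurable_EFinP; exact: mpath.
by apply: le_lt_trans (cC w) _; rewrite ltry.
Qed.

Let V t w :=
  (th t w * N t w * (1 + pint b t w) - pint (fun s w => b s w * (th s w * N s w)) t w) +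
  (th t w * (0 + pint c t w) - pint (fun s w => c s w * th s w) t w).

Let pV : progressive X V.
Proof.
apply: progressiveD; apply: progressiveB.
- apply: progressiveM; first exact: progressiveM.
  by apply: progressiveD; [exact: progressive_cst|exact: progressive_pint].
- by apply: progressive_pint; apply: progressiveM => //; exact: progressiveM.
- by apply: progressiveM => //; apply: progressiveD; [exact: progressive_cst|exact: progressive_pint].
- by apply: progressive_pint; exact: progressiveM.
Qed.

Let V_premartingale : premartingale X mu2 t1 V.
Proof.
have h1 := premartingale_by_parts (1 : R) t10 (progressiveM pth prN) pb pthN bC.
have h2 := premartingale_by_parts (0 : R) t10 pth pc pth1 cC.
exact: premartingaleD h1 h2.
Qed.

Let capped_t1 w s : 0 <= s <= t1 -> 0 <= capped rho s w <= t1.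
Proof.
move=> /andP[s0 st]; rewrite capped_ge0//=; apply: le_trans st; exact: capped_le.
Qed.

(** Prepares a second optional stopping. The integrals inside V are continuous in time because the
    cadlag factors th and N are bounded on each good path. *)
Let V_right_continuous : {ae mu2, forall w, forall s, 0 <= s < t1 ->
  V v w @[v --> s^'+] --> V s w}.
Proof.
apply: filterS good => w [ck cY ia ig _].
have cpint (f : R -> Omega -> R) : integrable_upto t1 (f ^~ w) ->
    cadlag_upto t1 (fun s => pint f s w).
  by move=> fi; apply: continuous_cadlag; exact: (primitive_continuous t10 fi).
have cth : cadlag_upto t1 (fun s => th s w).
  apply: cadlagM (cadlag_cst _ _); apply: cadlagM ck.
  by apply: cadlag_comp; [exact: continuous_expR|exact: cpint].
have cN : cadlag_upto t1 (fun s => N s w) by exact: cadlag_capped.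
have cthN := cadlagM cth cN.
have iM (f h : R -> Omega -> R) : integrable_upto t1 (f ^~ w) -> progressive X h ->
    cadlag_upto t1 (h ^~ w) -> cadlag_upto t1 (fun s => pint (fun v w => f v w * h v w) s w).
  move=> fi ph ch; apply: cpint; have [K hK] := cadlag_bounded ch.
  by apply: (integrable_upto_mul fi _ hK); exact: mpath.
have [rV _] : cadlag_upto t1 (fun s => V s w).
  apply: cadlagD; apply: cadlagB.
  - by apply: cadlagM cthN _; apply: cadlagD; [exact: cadlag_cst|exact: cpint].
  - by apply: (iM b (fun v w => th v w * N v w)) => //; exact: progressiveM.
  - by apply: cadlagM cth _; apply: cadlagD; [exact: cadlag_cst|exact: cpint].
  - exact: (iM c th).
by move=> s sI; exact: rV.
Qed.

(** V carries the switched-off rates after rho, where it differs from Y2 / k0; stopping it removes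
    that range. *)
Let V_stopped : premartingale X mu2 t1 (fun s w => V (capped rho s w) w).
Proof.
apply: optional_stopping => //; first exact: progressive_nonanticipating.
move=> s /andP[s0 _]; apply: (@Ft_id _ _ _ _ X s).
have h : progressive X (fun s w => V (capped rho s w) w) by exact: progressive_stopped.
exact: (progressive_adapted h s0).
Qed.

Lemma girsanov_step : premartingale X mu2 t1 (stopped Y2 rho).
Proof.
apply: premartingale_ae_eq (premartingaleZ k0 V_stopped).
  move=> s /andP[s0 _]; apply: (@Ft_id _ _ _ _ X s).
  have h : progressive X (stopped Y2 rho) by exact: progressive_stopped.
  exact: (progressive_adapted h s0).
move=> s sI; apply: filterS good => w [ck cY ia ig qE].
rewrite /stopped -/(capped rho s w).
(* Up to time r the indicator [alive rho] is 1 and N coincides with Y1, so all terms of V reduce to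
   those of [exponential_transform_path]. *)
set r := capped rho s w.
have /andP[r0 rt] : 0 <= r <= t1 by exact: capped_t1.
have rrho : (r%:E <= rho w)%E by rewrite /r cappedE// ge_min lexx orbT.
have aliveE v : 0 <= v <= r -> alive rho v w = 1.
  by move=> /andP[_ vr]; rewrite /alive (le_trans _ rrho)// lee_fin.
have cE v : 0 <= v <= r -> capped rho v w = v.
  move=> /andP[_ vr]; apply: EFin_inj; rewrite cappedE// min_l//.
  by apply: le_trans rrho; rewrite lee_fin.
have NE v : 0 <= v <= r -> N v w = Y1 v w.
  by move=> vI; rewrite /N /stopped -/(capped rho v w) cE.
have sub v s' : 0 <= s' <= r -> 0 <= v <= s' -> 0 <= v <= r.
  by move=> /andP[_ sr] /andP[-> vs]; exact: le_trans vs sr.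
have DE v : 0 <= v <= r -> D v w = expR (primitive (fun s => - a (X s w)) v).
  move=> vI; congr expR; apply: eq_primitive => s' s'I.
  by rewrite /b0 /rate aliveE ?mul1r//; exact: sub vI s'I.
have GE v : 0 <= v <= r -> pint (rate g) v w = primitive (fun s => g (X s w)) v.
  move=> vI; apply: eq_primitive => s' s'I.
  by rewrite /rate aliveE ?mul1r//; exact: sub vI s'I.
have bE v : 0 <= v <= r ->
    b v w = - a (X v w) * expR (primitive (fun s => - a (X s w)) v).
  by move=> vI; rewrite /b DE// /b0 /rate aliveE// mul1r.
have cE' v : 0 <= v <= r -> c v w = g (X v w) * expR (primitive (fun s => - a (X s w)) v) +
    - a (X v w) * expR (primitive (fun s => - a (X s w)) v) * primitive (fun s => g (X s w)) v.
  by move=> vI; rewrite /c bE// DE// GE// /rate aliveE// mul1r.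
have rr : 0 <= r <= r by rewrite r0 lexx.
have cr := cadlagS rt ck.
have [K1 kK] := cadlag_bounded cr.
have iga := integrable_uptoS rt ig; have iaa := integrable_uptoS rt ia.
(* No path regularity of u (X) is assumed: it is Y1 plus a continuous integral. *)
have cu : cadlag_upto r (fun s => u (X s w)).
  apply: cadlag_eq (cadlagD (cadlagS rt cY) (continuous_cadlag (primitive_continuous r0 iga))).
  by move=> v _; rewrite /Y1 subrK.
have [K2 uK] := cadlag_bounded cu.
have mp (f : E -> R) : measurable_fun [set: borel E] f -> measurable_fun `[0, r] (fun s => f (X s w)).
  by move=> mf; exact: (@progressive_section (fun s w => f (X s w)) r w (pf mf) r0).
have k0n : k0 != 0 by exact: lt0r_neq0.
pose Dp v := expR (primitive (fun s => - a (X s w)) v).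
pose bp v := - a (X v w) * Dp v.
pose cp v := g (X v w) * Dp v + bp v * primitive (fun s => g (X s w)) v.
pose thp v := expR (primitive (fun s => a (X s w)) v) * kappa (X v w) / k0.
pose yp v := u (X v w) - primitive (fun s => g (X s w)) v.
have eN : N r w = yp r by rewrite NE.
have eb : pint b r w = primitive bp r.
  by apply: eq_primitive => v vI; rewrite (bE v vI).
have eI : pint (fun s w => b s w * (th s w * N s w)) r w =
    primitive (fun s => bp s * (thp s * yp s)) r.
  by apply: eq_primitive => v vI; rewrite (bE v vI) (NE v vI).
have ec : pint c r w = primitive cp r.
  by apply: eq_primitive => v vI; rewrite (cE' v vI).
have eJ : pint (fun s w => c s w * th s w) r w = primitive (fun s => cp s * thp s) r.
  by apply: eq_primitive => v vI; rewrite (cE' v vI).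
have eth : th r w = thp r by [].
have path_eq : V r w = k0^-1 * (kappa (X r w) * u (X r w) - primitive (fun s => q (X s w)) r).
  rewrite /V eN eb eI ec eJ eth.
  apply: (@exponential_transform_path R r (fun s => a (X s w)) (fun s => g (X s w))
    (fun s => q (X s w)) (fun s => kappa (X s w)) (fun s => u (X s w)) k0 (Num.max K1 K2)
    r0 k0n iaa iga (mp _ mkappa) (mp _ mu) (mp _ mq)).
  - by move=> v vI; rewrite le_max; apply/orP; left; exact: kK.
  - by move=> v vI; rewrite le_max; apply/orP; right; exact: uK.
  - apply: lebesgue_aeS qE => v qv /andP[v0 vr]; apply: qv.
    by rewrite v0 (le_trans vr).
by rewrite path_eq (mulVKf k0n).
Qed.

End girsanov_step.

Lemma nondecreasing_times (Omega : Type) (R : realType) (S : nat -> Omega -> \bar R) w :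
  (forall n w, (S n w <= S n.+1 w)%E) ->
  forall i j, (i <= j)%N -> (S i w <= S j w)%E.
Proof.
move=> hS i j /subnK <-; elim: (j - i)%N => [//|l IH].
by apply: le_trans IH _; exact: hS.
Qed.

(** * Girsanov transform of local martingales *)

Section girsanov.
Context {R : realType} {E : ptopologicalType} {d : measure_display}
  {Omega : measurableType d}.
Variable X : borel_right_process R E Omega.
Local Notation Ft t := (g_sigma_algebraType (F_ X t)).
Local Notation leb := (@lebesgue_measure R).

Lemma as_upto_law (L : laws R E Omega) t x (p : Omega -> Prop) :
  as_upto X L t x p -> {ae L t x, forall w, p w}.
Proof.
move=> [N [FN N0 Np]]; exists N; split => //; first exact: F_measurable FN.
by move=> w /= npw; apply: contrapT => /Np.
Qed.

Hypothesis hE : lusin_space R E.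

Lemma ae_law (L : laws R E Omega) t x (p : Omega -> Prop) :
  laws_equiv X L x -> 0 <= t ->
  {ae law X x, forall w, p w} -> {ae L t x, forall w, p w}.
Proof. by move=> hL t0 /(as_upto_ae _ hE hL t0)/as_upto_law. Qed.

Lemma cadlagP (L : laws R E Omega) x (Y : R -> Omega -> R) :
  laws_equiv X L x -> cadlag X L x Y <->
  {ae law X x, forall w, forall t : R, 0 <= t -> cadlag_upto t (Y ^~ w)}.
Proof.
move=> hL; split => [cY|cY t t0]; last first.
  by apply/(as_upto_ae _ hE hL t0); apply: filterS cY => w; exact.
apply: ae_all_times => [s t w st h s0|t t0].
  by apply: (cadlagS st); apply: h; exact: le_trans st.
have /(as_upto_ae _ hE hL (ltW t0)) := cY t (ltW t0).
by apply: filterS => w.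
Qed.

Lemma path_progressive (f : E -> R) : measurable_fun [set: borel E] f ->
  progressive X (fun s w => f (X s w)).
Proof. by move=> mf; apply: progressive_comp mf _; exact: progressive_path. Qed.

Lemma path_section (f : E -> R) (t : R) w : measurable_fun [set: borel E] f ->
  0 <= t -> measurable_fun `[0, t] (fun s => f (X s w)).
Proof. by move=> mf t0; exact: (progressive_section w (path_progressive mf) t0). Qed.

Lemma path_integrableP (f : E -> R) (t : R) w : measurable_fun [set: borel E] f ->
  0 <= t -> (clock (fun s w => f (X s w)) t w < +oo)%E <->
  integrable_upto t (fun s => f (X s w)).
Proof.
move=> mf t0; split => [h|/integrableP[_ //]].
by apply/integrableP; split => //; apply/measurable_EFinP; exact: path_section.
Qed.

Variables (L1 L2 : laws R E Omega) (x : E) (kappa a u g q : E -> R).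
Hypothesis hL1 : laws_equiv X L1 x.
Hypothesis hL2 : laws_equiv X L2 x.
Hypothesis mkappa : measurable_fun [set: borel E] kappa.
Hypothesis ma : measurable_fun [set: borel E] a.
Hypothesis mu : measurable_fun [set: borel E] u.
Hypothesis mg : measurable_fun [set: borel E] g.
Hypothesis mq : measurable_fun [set: borel E] q.
Hypothesis kappa0 : forall y, 0 < kappa y.
Hypothesis fa : {ae law X x, forall w, forall t : R, 0 <= t ->
  integrable_upto t (fun s => a (X s w))}.
Hypothesis fg : {ae law X x, forall w, forall t : R, 0 <= t ->
  integrable_upto t (fun s => g (X s w))}.
Hypothesis density : forall t A, 0 <= t -> F_ X t A ->
  L1 t x A = (\int[L2 t x]_(w in A)
    (expR (pint (fun s w => a (X s w)) t w) * kappa (X t w) / kappa x)%:E)%E.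
Hypothesis ck : {ae law X x, forall w, forall t : R, 0 <= t ->
  cadlag_upto t (fun s => kappa (X s w))}.
Hypothesis lm : local_martingale X L1 x
  (fun t w => u (X t w) - time_integral X g t w).
Hypothesis qE : {ae law X x, forall w, forall t : R, 0 <= t ->
  {ae leb, forall s, 0 <= s <= t ->
    q (X s w) = kappa (X s w) * (g (X s w) - a (X s w) * u (X s w))}}.

Let Y1 (t : R) (w : Omega) : R := u (X t w) - time_integral X g t w.
Let Y2 (t : R) (w : Omega) : R := kappa (X t w) * u (X t w) - time_integral X q t w.

Let good (t : R) w := [/\ cadlag_upto t (fun s => kappa (X s w)),
  cadlag_upto t (fun s => Y1 s w),
  integrable_upto t (fun s => a (X s w)),
  integrable_upto t (fun s => g (X s w)) &
  {ae leb, forall s, 0 <= s <= t ->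
    q (X s w) = kappa (X s w) * (g (X s w) - a (X s w) * u (X s w))}].

Let ae_good : {ae law X x, forall w, forall t : R, 0 <= t -> good t w}.
Proof.
have cY1 : {ae law X x, forall w, forall t : R, 0 <= t -> cadlag_upto t (Y1 ^~ w)}.
  by have [_ + _] := lm; move/(cadlagP _ hL1).
apply: filterS3 ck cY1 (filterI fa (filterI fg qE)) => w c1 c2 [c3 [c4 c5]] t t0.
by split; [exact: c1|exact: c2|exact: c3|exact: c4|exact: c5].
Qed.

Let good_cadlag_u t w : 0 <= t -> good t w -> cadlag_upto t (fun s => u (X s w)).
Proof.
move=> t0 [_ cY _ ig _].
apply: cadlag_eq (cadlagD cY (continuous_cadlag (primitive_continuous t0 ig))).
by move=> v _; rewrite /Y1 subrK.
Qed.

(** Along a good path q (X) is almost everywhere a combination of the integrable g (X) and a (X)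
    with the bounded coefficients kappa (X) and kappa (X) u (X). *)
Let good_q t w : 0 <= t -> good t w -> integrable_upto t (fun s => q (X s w)).
Proof.
move=> t0 gw; have [ck' cY ia ig qe] := gw; have cu := good_cadlag_u t0 gw.
have [K1 kK] := cadlag_bounded ck'; have [K2 uK] := cadlag_bounded (cadlagM ck' cu).
have i1 := integrable_upto_mul ig (path_section w mkappa t0) kK.
have i2 := integrable_upto_mul ia
  (measurable_funM (path_section w mkappa t0) (path_section w mu t0)) uK.
have i3 : integrable_upto t (fun s => g (X s w) * kappa (X s w) -
    a (X s w) * (kappa (X s w) * u (X s w))) by exact: RintegrableB.
apply/integrableP; split; first by apply/measurable_EFinP; exact: path_section.
have /integrableP[m3 +] := i3; congr (_ < _)%E; apply: ae_eq_integral => //.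
- exact: measurableT_comp.
- by apply: measurableT_comp => //; apply/measurable_EFinP; exact: path_section.
- apply: lebesgue_aeS qe => s h; rewrite /= in_itv/= => sI.
  have -> : q (X s w) = g (X s w) * kappa (X s w) - a (X s w) * (kappa (X s w) * u (X s w)).
    by rewrite (h sI); ring.
  by [].
Qed.

Let good_Y2 t w : 0 <= t -> good t w -> cadlag_upto t (Y2 ^~ w).
Proof.
move=> t0 gw; have [ck' _ _ _ _] := gw.
apply: cadlagB; first by apply: cadlagM ck' _; exact: good_cadlag_u.
by apply: continuous_cadlag; apply: primitive_continuous => //; exact: good_q.
Qed.

Lemma girsanov_integrable : {ae law X x, forall w, forall t : R, 0 <= t ->
  integrable_upto t (fun s => q (X s w))}.
Proof. by apply: filterS ae_good => w gw t t0; apply: good_q => //; exact: gw. Qed.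

Let k s w := `|a (X s w)| + `|g (X s w)|.

Let pk : progressive X k.
Proof.
apply: progressiveD.
  exact: (progressive_comp (@normr_measurable R setT) (path_progressive ma)).
exact: (progressive_comp (@normr_measurable R setT) (path_progressive mg)).
Qed.

Let fk t : 0 < t -> {ae law X x, forall w, (clock k t w < +oo)%E}.
Proof.
move=> t0; apply: filterS ae_good => w /(_ t (ltW t0))[_ _ ia ig _].
suff /integrableP[] : integrable_upto t (k ^~ w) by [].
by apply: RintegrableD => //; exact: Rintegrable_norm.
Qed.

Let sg n := clock_time hE pk fk n.
Let rho (T : nat -> Omega -> \bar R) n w := Order.min (T n w) (sg n w).

Let pY2 : progressive X Y2.
Proof.
apply: progressiveB; first by apply: progressiveM; exact: path_progressive.
by apply: progressive_pint; exact: path_progressive.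
Qed.

Let adapted_progressive Y : progressive X Y -> adapted X Y.
Proof.
move=> pY t B t0 mB; apply: F_preimage mB; exact: progressive_adapted.
Qed.

Let pth : progressive X (fun s w =>
  expR (pint (fun s w => a (X s w)) s w) * kappa (X s w) / kappa x).
Proof.
have p1 : progressive X (fun s w => expR (pint (fun s w => a (X s w)) s w)).
  apply: (progressive_comp (@measurable_expR R)); apply: progressive_pint.
  exact: path_progressive.
have p2 := progressiveM p1 (path_progressive mkappa).
exact: (progressiveM p2 (progressive_cst (kappa x)^-1)).
Qed.

(** The localizing times are the minima of those of the given local martingale and the clock times;
    at a fixed index and horizon everything is [girsanov_step]. *)
Lemma girsanov : local_martingale X L2 x Y2.
Proof.
have [_ _ [T [sT TS Tu mT]]] := lm.
have ssg n : stopping_time X (sg n) := clock_time_stopping hE pk fk n.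
have sR n : stopping_time X (rho T n) by exact: stopping_time_min.
split; first exact: adapted_progressive.
  by apply/(cadlagP _ hL2); apply: filterS ae_good => w gw t t0; apply: good_Y2 => //; exact: gw.
exists (rho T); split; first exact: sR.
- move=> n w; rewrite /rho le_min !ge_min TS/= orbC.
  by rewrite (clock_timeS hE pk fk n w).
- move=> t t0; apply/(as_upto_ae _ hE hL2 t0).
  have /(as_upto_ae _ hE hL1 t0) := Tu t t0.
  move=> h; apply: filterS2 h (clock_time_unbounded hE pk fk) => w [n tn] /(_ t)[m tm].
  exists (maxn n m); rewrite /rho le_min; apply/andP; split.
    by apply: le_trans tn _; apply: nondecreasing_times => //; exact: leq_maxl.
  apply: le_trans tm _; apply: (@nondecreasing_times _ _ sg); last exact: leq_maxr.
  exact: clock_timeS.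
- move=> n; have pS : progressive X (stopped Y2 (rho T n)) by exact: progressive_stopped.
  have [mTa mTc _ _] := mT n.
  apply: (premartingale_martingale hL2); first exact: adapted_progressive.
    apply/(cadlagP _ hL2); apply: filterS ae_good => w gw t t0.
    apply: (cadlag_capped (Y := Y2)) => //; first by have [h _] := sR n.
    by apply: good_Y2 => //; exact: gw.
  move=> t t0.
  have bound (f : E -> R) w : measurable_fun [set: borel E] f ->
      (forall s, `|f (X s w)| <= `|k s w|) ->
      (\int[leb]_(s in `[0%R, t]) `|alive (sg n) s w * f (X s w)|%:E <= n%:R%:E)%E.
    move=> mf fle; apply: le_trans (clock_time_bound hE pk fk n w t0).
    have pa (Z : R -> Omega -> R) : progressive X Z ->
        measurable_fun `[0, t] (fun s => `|alive (sg n) s w * Z s w|%:E).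
      move=> pZ; apply/measurable_EFinP/measurableT_comp => //.
      apply: (@progressive_section _ _ _ _ X (fun s w => alive (sg n) s w * Z s w)) => //.
      by apply: progressiveM => //; exact: progressive_alive.
    apply: ge0_le_integral => //.
    + by apply: (pa (fun s w => f (X s w))); exact: path_progressive.
    + exact: pa.
    + by move=> s _; rewrite lee_fin !normrM ler_wpM2l.
  apply: (@girsanov_step _ _ _ _ X (L1 t x) (L2 t x) t kappa a u g q (kappa x) n%:R
    (T n) (sg n) hE t0 (ler0n _ _) mkappa ma mu mg mq kappa0 (kappa0 x) _ (sT n) (ssg n)).
  (* The density is given at horizon s but is needed under the laws of horizon t; consistency of
     both families bridges this. *)
  + move=> s A /andP[s0 st] FA; rewrite (hL1.2 s t A s0 st FA) (density s0 FA).
    apply/esym; apply: (integral_consistent hL2 s0 st _ FA).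
    apply/measurable_EFinP.
    exact: (progressive_adapted pth s0).
  + move=> w; apply: (bound a w ma) => s.
    by rewrite /k [leRHS]ger0_norm ?addr_ge0// lerDl.
  + move=> w; apply: (bound g w mg) => s.
    by rewrite /k [leRHS]ger0_norm ?addr_ge0// lerDr.
  + have h := martingale_premartingale hL1 (mT n).
    refine (h t t0).
  + have := as_upto_law (mTc t t0); apply: filterS => w [h _]; exact: h.
  + by apply: (ae_law hL2 t0); apply: filterS ae_good => w gw; exact: (gw t t0).
Qed.

End girsanov.

(** * Uniqueness of the generator *)

(** The times i/(j+1) are countable, so almost sure statements at each of them hold jointly;
    continuity covers the remaining times. *)
Lemma vanishing_on_grid (R : realType) (f : R -> R) :
  (forall t, 0 <= t -> {within `[0, t], continuous f}) ->
  (forall i j : nat, f (i%:R / j.+1%:R) = 0) -> forall s, 0 <= s -> f s = 0.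
Proof.
move=> cf f0 s s0.
(* The mesh point after s is at most s + 1, so with this horizon the cap in [grid] has no effect. *)
have s1 : 0 <= s <= s + 1 by rewrite s0 lerDl ler01.
have lim1 : f (grid (s + 1) k s) @[k --> \oo] --> f s.
  apply: (@grid_right_cvg R R f (s + 1) s s1) => st.
  have s10 : 0 <= s + 1 by rewrite addr_ge0.
  by have [h _] := continuous_cadlag (cf _ s10); apply: h; rewrite s0 st.
have lim0 : f (grid (s + 1) k s) @[k --> \oo] --> 0.
  apply: cvg_near_cst; apply: nearW => k.
  rewrite /grid min_r; first exact: f0.
  rewrite ler_pdivrMr// -natr1 mulrDl mul1r lerD//.
    by rewrite truncn_le// mulr_ge0.
  by rewrite -natr1 lerDr.
exact: cvg_unique lim1 lim0.
Qed.

Section generator_uniqueness.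
Context {R : realType} {E : ptopologicalType} {d : measure_display}
  {Omega : measurableType d}.
Variable X : borel_right_process R E Omega.
Local Notation Ft t := (g_sigma_algebraType (F_ X t)).
Local Notation leb := (@lebesgue_measure R).

Hypothesis hE : lusin_space R E.

(* For L = \int b, integration by parts makes L^2 - \int b L = L^2 / 2 a
   martingale, so that E L^2 = 0. *)
Lemma vanishing_drift (mu : probability Omega R) (t1 : R) (b : R -> Omega -> R) C :
  0 <= t1 -> progressive X b ->
  (forall w, (\int[leb]_(s in `[0%R, t1]) `|b s w|%:E <= C%:E)%E) ->
  premartingale X mu t1 (pint b) ->
  {ae mu, forall w, pint b t1 w = 0}.
Proof.
move=> t10 pb bC pL.
have ib w : integrable_upto t1 (b ^~ w).
  apply/integrableP; split.
    by apply/measurable_EFinP; exact: progressive_section w pb t10.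
  by apply: le_lt_trans (bC w) _; rewrite ltry.
have h := premartingale_by_parts (0 : R) t10 (progressive_pint pb) pb pL bC.
have {h} pL2 : premartingale X mu t1 (fun t w => 2^-1 * (pint b t w * pint b t w)).
  apply: premartingale_ae_eq h => [s /andP[s0 st]|s sI].
    apply: (@Ft_id _ _ _ _ X s); have m := progressive_adapted (progressive_pint pb) s0.
    by apply: measurable_funM => //; exact: measurable_funM.
  apply: aeW => w; rewrite add0r.
  have /= := product_rule 0 0 t10 (ib w) (ib w) sI; rewrite !add0r mul0r add0r.
  set f := fun v => b v w * primitive (b ^~ w) v.
  have -> : primitive (fun v => b v w * (0 + primitive (b ^~ w) v) +
      b v w * (0 + primitive (b ^~ w) v)) s = primitive f s + primitive f s.
    have ib_f : integrable_upto s f.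
      have /andP[_ st] := sI; apply: (integrable_uptoS st).
      apply: (integrable_upto_mul (ib w) (measurable_primitive t10 (ib w))) => v vI.
      exact: primitive_bounded vI.
    rewrite -primitiveD//; apply: eq_primitive => v _; rewrite /f add0r//.
  move=> e; have -> : pint b s w * pint b s w = primitive f s + primitive f s by [].
  have -> : pint (fun v w => b v w * pint b v w) s w = primitive f s by [].
  by field.
have I0 : \int[mu]_w (2^-1 * (pint b t1 w * pint b t1 w)) = 0.
  rewrite (pL2.2 0 t1 setT (lexx 0) t10 (lexx t1)); last first.
    exact: sigma_setT (F_sigma X 0).
  have -> : (fun w => 2^-1 * (pint b 0 w * pint b 0 w)) = cst 0.
    by apply/funext => w; rewrite [pint b 0 w](@primitive0 R (b ^~ w)) mul0r mulr0.
  by rewrite /Rintegral integral0.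
have t1I : 0 <= t1 <= t1 by rewrite t10 lexx.
have i2 := pL2.1 t1 t1I.
have {}I0 : (\int[mu]_w `|(2^-1 * (pint b t1 w * pint b t1 w))%:E| = 0)%E.
  transitivity (\int[mu]_w (2^-1 * (pint b t1 w * pint b t1 w))%:E)%E.
    apply: eq_integral => w _; rewrite gee0_abs// lee_fin mulr_ge0 ?invr_ge0//.
    by rewrite -expr2 sqr_ge0.
  by rewrite -EFin_Rintegral// I0.
have mf : measurable_fun setT (fun w => (2^-1 * (pint b t1 w * pint b t1 w))%:E).
  by apply/measurable_EFinP; exact: Rintegrable_measurable i2.
have := (ae_eq_integral_abs mu measurableT mf).1 I0.
apply: filterS => w /(_ I) [] /eqP; rewrite mulf_eq0 invr_eq0 pnatr_eq0/=.
by rewrite mulf_eq0 orbb => /eqP.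
Qed.

Variables (L : laws R E Omega) (x : E) (u g1 g2 : E -> R).
Hypothesis hL : laws_equiv X L x.
Hypothesis mu : measurable_fun [set: borel E] u.
Hypothesis mg1 : measurable_fun [set: borel E] g1.
Hypothesis mg2 : measurable_fun [set: borel E] g2.
Hypothesis fg1 : {ae law X x, forall w, forall t : R, 0 <= t ->
  integrable_upto t (fun s => g1 (X s w))}.
Hypothesis fg2 : {ae law X x, forall w, forall t : R, 0 <= t ->
  integrable_upto t (fun s => g2 (X s w))}.

Let Y (g : E -> R) (t : R) (w : Omega) : R := u (X t w) - time_integral X g t w.
Hypothesis lm1 : local_martingale X L x (Y g1).
Hypothesis lm2 : local_martingale X L x (Y g2).

Let pY g : measurable_fun [set: borel E] g -> progressive X (Y g).
Proof.
move=> mg; apply: progressiveB; first exact: path_progressive.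
by apply: progressive_pint; exact: path_progressive.
Qed.

Let stopped_premartingale g (T S : Omega -> \bar R) t : 0 <= t ->
  measurable_fun [set: borel E] g -> stopping_time X T -> stopping_time X S ->
  martingale X L x (stopped (Y g) T) ->
  premartingale X (L t x) t (stopped (Y g) (fun w => Order.min (T w) (S w))).
Proof.
move=> t0 mg sT sS mT.
have -> : stopped (Y g) (fun w => Order.min (T w) (S w)) =
    (fun s w => stopped (Y g) T (capped S s w) w).
  apply/funext => s; apply/funext => w; rewrite /stopped.
  rewrite -/(capped T (capped S s w) w) -/(capped (fun w => Order.min (T w) (S w)) s w).
  by rewrite capped_capped//; [have [h _] := sT|have [h _] := sS].
have pS : progressive X (stopped (Y g) T).
  by apply: progressive_stopped => //; exact: pY.
have [_ mTc _ _] := mT.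
have pm : premartingale X (L t x) t (stopped (Y g) T).
  have h := martingale_premartingale hL mT; exact: (h t t0).
have rc : {ae L t x, forall w, forall s, 0 <= s < t ->
    stopped (Y g) T v w @[v --> s^'+] --> stopped (Y g) T s w}.
  by have := as_upto_law (mTc t t0); apply: filterS => w [h _]; exact: h.
apply: (optional_stopping (progressive_nonanticipating pS) pm sS _ rc).
move=> s /andP[s0 _]; apply: (@Ft_id _ _ _ _ X s).
have h : progressive X (fun s w => stopped (Y g) T (capped S s w) w).
  exact: progressive_stopped.
exact: (progressive_adapted h s0).
Qed.

Let k s w := `|g1 (X s w)| + `|g2 (X s w)|.

Let pk : progressive X k.
Proof.
apply: progressiveD.
  exact: (progressive_comp (@normr_measurable R setT) (path_progressive hE mg1)).
exact: (progressive_comp (@normr_measurable R setT) (path_progressive hE mg2)).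
Qed.

Let fk t : 0 < t -> {ae law X x, forall w, (clock k t w < +oo)%E}.
Proof.
move=> t0; apply: filterS2 fg1 fg2 => w /(_ t (ltW t0)) i1 /(_ t (ltW t0)) i2.
suff /integrableP[] : integrable_upto t (k ^~ w) by [].
by apply: RintegrableD => //; exact: Rintegrable_norm.
Qed.

Let sg n := clock_time hE pk fk n.
Let ssg n : stopping_time X (sg n). Proof. exact: clock_time_stopping. Qed.

Let c s w := g2 (X s w) - g1 (X s w).
Let pc : progressive X c.
Proof. by apply: progressiveB; exact: path_progressive. Qed.

(** In the difference of the two stopped martingales u cancels, leaving the time integral of g2 - g1
    up to the common stopping time. [vanishing_drift] applies since the clock bounds it. *)
Let stopped_drift (T1 T2 : Omega -> \bar R) n t : 0 <= t ->
  stopping_time X T1 -> stopping_time X T2 ->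
  martingale X L x (stopped (Y g1) T1) -> martingale X L x (stopped (Y g2) T2) ->
  {ae law X x, forall w,
    pint (fun s w => alive (fun w => Order.min (T1 w) (Order.min (T2 w) (sg n w))) s w * c s w) t w = 0}.
Proof.
move=> t0 sT1 sT2 mT1 mT2.
pose rho w := Order.min (T1 w) (Order.min (T2 w) (sg n w)).
have srho : stopping_time X rho by do ?apply: stopping_time_min.
have rho0 w : (0 <= rho w)%E by have [h _] := srho.
pose b s w := alive rho s w * c s w.
have pb : progressive X b by apply: progressiveM => //; exact: progressive_alive.
have p1 : premartingale X (L t x) t (stopped (Y g1) rho).
  by apply: stopped_premartingale => //; exact: stopping_time_min.
have p2 : premartingale X (L t x) t (stopped (Y g2) rho).
  have -> : rho = (fun w => Order.min (T2 w) (Order.min (T1 w) (sg n w))).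
    by apply/funext => w; rewrite /rho minCA.
  by apply: stopped_premartingale => //; exact: stopping_time_min.
have bC w : (\int[leb]_(s in `[0%R, t]) `|b s w|%:E <= n%:R%:E)%E.
  have pa (Z : R -> Omega -> R) : progressive X Z ->
      measurable_fun `[0, t] (fun s => `|Z s w|%:E).
    by move=> pZ; apply/measurable_EFinP/measurableT_comp => //;
      exact: (progressive_section w pZ t0).
  have m1 := pa _ pb.
  have m2 := pa _ (progressiveM (progressive_alive (ssg n)) pk).
  apply: le_trans (clock_time_bound hE pk fk n w t0).
  apply: ge0_le_integral.
  - by [].
  - by move=> s _; rewrite lee_fin.
  - exact: m1.
  - exact: m2.
  - move=> s _; rewrite lee_fin /b !normrM; apply: ler_pM => //.
      rewrite /alive /rho !le_min.
      by case: (s%:E <= T1 w)%E; case: (s%:E <= T2 w)%E; case: (s%:E <= sg n w)%E;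
        rewrite ?normr0 ?normr1 ?ler01.
    rewrite /k [leRHS]ger0_norm ?addr_ge0// [leRHS]addrC; exact: ler_normB.
have pL : premartingale X (L t x) t (pint b).
  apply: premartingale_ae_eq (premartingaleD p1 (premartingaleZ (-1) p2)).
    move=> s /andP[s0 _]; apply: (@Ft_id _ _ _ _ X s).
    exact: (progressive_adapted (progressive_pint pb) s0).
  move=> s /andP[s0 st]; apply: (ae_law hE hL t0); apply: filterS2 fg1 fg2 => w i1 i2.
  rewrite /stopped -/(capped rho s w); set r := capped rho s w.
  have r0 : 0 <= r by exact: capped_ge0.
  have rs : r <= s by exact: capped_le.
  have rrho : (r%:E <= rho w)%E by rewrite /r cappedE// ge_min lexx orbT.
  have -> : pint b s w = primitive (fun v => c v w) r.
    rewrite /pint /primitive /Rintegral integral_mkcond [in RHS]integral_mkcond.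
    congr fine; apply: eq_integral => v _; rewrite !patchE !mem_setE !in_itv/= /b /alive.
    have [v0|v0]/= := leP 0 v => //.
    have [vs|sv] := leP v s; last first.
      by rewrite ifF//; apply/negbTE; rewrite -ltNge; exact: le_lt_trans rs sv.
    have -> : (v <= r) = (v%:E <= rho w)%E.
      by rewrite -lee_fin /r cappedE// [LHS]le_min lee_fin vs.
    by case: (v%:E <= _)%E; rewrite ?mul1r// mul0r.
  have -> : primitive (fun v => c v w) r =
      primitive (fun s => g2 (X s w)) r - primitive (fun s => g1 (X s w)) r.
    rewrite -[X in _ - X]mul1r -mulNr -primitiveZ; last exact: i1.
    rewrite -primitiveD; last 2 first.
    - exact: i2.
    - by apply: RintegrableZ => //; exact: i1.
    by apply: eq_primitive => v _; rewrite mulN1r.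
  by rewrite /Y /time_integral -!/(primitive _ _); ring.
have [N [mN N0 hN]] := vanishing_drift t0 pb bC pL.
(* Equivalence of laws concerns events of F_t only, so the exceptional set is replaced by this
   F_t-event contained in it. *)
pose Z := ~` (pint b t @^-1` [set 0]).
have FZ : F_ X t Z.
  apply: (sigma_setC (F_sigma X t)); apply: F_preimage => //.
  exact: (progressive_adapted (progressive_pint pb) t0).
exists Z; split.
- exact: F_measurable FZ.
- apply/(hL.1 t Z t0 FZ)/eqP; rewrite -measure_le0 -N0; apply: le_measure.
  + by rewrite inE; exact: F_measurable FZ.
  + by rewrite inE.
  + by move=> w wZ; exact: hN.
- by move=> w wp bw; apply: wp.
Qed.

(** For every localizing index the stopped drift vanishes almost surely at all times i/(j+1), hence
    identically by continuity. Its density is then zero almost everywhere, and on [0, t] a large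
    index makes the indicator 1. *)
Lemma generator_unique : {ae law X x, forall w, forall t : R, 0 <= t ->
  {ae leb, forall s, 0 <= s <= t -> g1 (X s w) = g2 (X s w)}}.
Proof.
have [_ _ [T1 [sT1 T1S T1u mT1]]] := lm1.
have [_ _ [T2 [sT2 T2S T2u mT2]]] := lm2.
have sgS n w : (sg n w <= sg n.+1 w)%E by exact: clock_timeS.
pose rho n w := Order.min (T1 n w) (Order.min (T2 n w) (sg n w)).
have srho n : stopping_time X (rho n) by do ?apply: stopping_time_min.
have pb n : progressive X (fun s w => alive (rho n) s w * c s w).
  by apply: progressiveM pc; exact: progressive_alive.
have grid0 : {ae law X x, forall w, forall n i j : nat,
    pint (fun s w => alive (rho n) s w * c s w) (i%:R / j.+1%:R) w = 0}.
  apply: ae_foralln => n; apply: ae_foralln => i; apply: ae_foralln => j.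
  by apply: stopped_drift => //; rewrite divr_ge0.
have reach (t : R) : 0 <= t -> {ae law X x, forall w, exists n, (t%:E <= rho n w)%E}.
  move=> t0.
  have /(as_upto_ae _ hE hL t0) h1 := T1u t t0.
  have /(as_upto_ae _ hE hL t0) h2 := T2u t t0.
  apply: filterS3 h1 h2 (clock_time_unbounded hE pk fk) => w [n1 h1] [n2 h2] /(_ t)[n3 h3].
  exists (maxn n1 (maxn n2 n3)); rewrite /rho !le_min; apply/and3P; split.
  - by apply: le_trans h1 _; apply: nondecreasing_times => //; exact: leq_maxl.
  - apply: le_trans h2 _; apply: nondecreasing_times => //.
    by rewrite leq_max leq_maxl orbT.
  - apply: le_trans h3 _; apply: (@nondecreasing_times _ _ sg) => //.
    by rewrite leq_max leq_maxr orbT.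
apply: ae_all_times => [s t w st h s0|t /ltW t0].
  have t0 := le_trans s0 st; apply: lebesgue_aeS (h t0) => v hv /andP[v0 vs].
  by apply: hv; rewrite v0 (le_trans vs).
apply: filterS3 (reach t t0) grid0 (filterI fg1 fg2) => w [n tn] h0 [i1 i2] _.
have ib (v : R) : 0 <= v -> integrable_upto v (fun s => alive (rho n) s w * c s w).
  move=> v0.
  have ic : integrable_upto v (fun s => c s w).
    by apply: RintegrableB => //; [exact: i2|exact: i1].
  have h : integrable_upto v (fun s => c s w * alive (rho n) s w).
    apply: (integrable_upto_mul (K := 1) ic).
      exact: (progressive_section w (progressive_alive (srho n)) v0).
    by move=> s _; rewrite /alive; case: (_ <= _)%E; rewrite ?normr0 ?normr1.
  by apply: eq_integrable h => // s _ /=; rewrite mulrC.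
have zero (v : R) : 0 <= v -> primitive (fun s => alive (rho n) s w * c s w) v = 0.
  apply: vanishing_on_grid => [u0 u00|i j]; last exact: h0.
  by apply: primitive_continuous => //; exact: ib.
have := primitive_eq0_ae t0 (ib t t0) (fun v vI => zero v (proj1 (andP vI))).
apply: lebesgue_aeS => v hv /[dup] vI /andP[v0 vt].
have := hv vI; rewrite /alive (le_trans _ tn) ?lee_fin// mul1r /c => /eqP.
by rewrite subr_eq0 => /eqP ->.
Qed.


End generator_uniqueness.

(** * The risk-neutral measure and the eigen-measure *)

Section densities.
Context {R : realType} {E : ptopologicalType} {d : measure_display}
  {Omega : measurableType d}.
Variable X : borel_right_process R E Omega.
Local Notation Ft t := (g_sigma_algebraType (F_ X t)).
Local Notation leb := (@lebesgue_measure R).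
Hypothesis hE : lusin_space R E.

Lemma adaptedP (Y : R -> Omega -> R) :
  adapted X Y <-> forall t : R, 0 <= t -> measurable_fun [set: Ft t] (Y t).
Proof.
split => [aY t t0|mY t B t0 mB]; last exact: F_preimage (mY t t0) mB.
by apply/F_fun_measurable => B mB; exact: aY.
Qed.

Lemma density_laws_equiv (L : laws R E Omega) (D : R -> Omega -> R) x :
  adapted X D -> {ae law X x, forall w, forall t : R, 0 <= t -> 0 < D t w} ->
  has_density X L D -> laws_equiv X L x.
Proof.
move=> /adaptedP aD D0 [dD cD]; split; last first.
  by move=> s t A s0 st FA; apply: cD => //; rewrite s0 st.
move=> t A t0 FA; have mA := F_measurable FA; rewrite dD//.
have mD : measurable_fun A (fun w => (D t w)%:E).
  by apply/measurable_EFinP/measurable_funTS; exact: Ft_id (aD t t0).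
split => [I0|PA0]; last exact: null_set_integral.
have {}I0 : (\int[law X x]_(w in A) `|(D t w)%:E| = 0)%E.
  rewrite -I0; apply: ae_eq_integral => //; first exact: measurableT_comp.
  by apply: filterS D0 => w Dw _; rewrite gee0_abs// lee_fin ltW// Dw.
have h := (ae_eq_integral_abs (law X x) mA mD).1 I0.
have [N [mN N0 hN]] : {ae law X x, forall w, ~ A w}.
  apply: filterS2 h D0 => w hw Dw Aw; have [/eqP] := hw Aw.
  by rewrite gt_eqF// Dw.
apply/eqP; rewrite -measure_le0 -N0; apply: le_measure; rewrite ?inE//.
by move=> w Aw; apply: hN => /=.
Qed.

Lemma density_ratio (L1 L2 : laws R E Omega) (D1 D2 Z : R -> Omega -> R) x :
  adapted X D1 -> adapted X D2 -> adapted X Z ->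
  {ae law X x, forall w, forall t : R, 0 <= t -> 0 < D2 t w} ->
  has_density X L1 D1 -> has_density X L2 D2 ->
  (forall t : R, 0 <= t -> {ae law X x, forall w, D1 t w = Z t w * D2 t w}) ->
  forall t A, 0 <= t -> F_ X t A ->
  L1 t x A = (\int[L2 t x]_(w in A) (Z t w)%:E)%E.
Proof.
move=> /adaptedP aD1 /adaptedP aD2 /adaptedP aZ D20 [d1 _] [d2 _] DZ t A t0 FA.
have mA := F_measurable FA.
(* [density_integral] asks for a density that is nonnegative everywhere, while D2 is positive only
   almost surely; hence the absolute value. *)
have mD2 : measurable_fun [set: Ft t] (fun w => `|D2 t w|).
  by apply: measurableT_comp => //; exact: aD2.
rewrite (@density_integral _ _ _ _ X (L2 t x) (law X x) t (fun w => `|D2 t w|) mD2 _ _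
  (Z t) A (aZ t t0) FA)//; last first.
  move=> B FB; rewrite d2//; have mB := F_measurable FB.
  apply: ae_eq_integral => //.
  - by apply/measurable_EFinP/measurable_funTS; exact: Ft_id (aD2 t t0).
  - by apply/measurable_EFinP/measurable_funTS; exact: Ft_id mD2.
  - by apply: filterS D20 => w Dw _; rewrite gtr0_norm// Dw.
rewrite d1//; apply: ae_eq_integral => //.
- by apply/measurable_EFinP/measurable_funTS; exact: Ft_id (aD1 t t0).
- apply/measurable_EFinP/measurable_funTS; apply: (@Ft_id _ _ _ _ X t).
  by apply: measurable_funM => //; exact: aZ.
- by apply: filterS2 (DZ t t0) D20 => w Dw Dp _; rewrite Dw mulrC gtr0_norm// Dp.
Qed.

Lemma time_integrableP (L : laws R E Omega) (f : E -> R) x :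
  laws_equiv X L x -> measurable_fun [set: borel E] f ->
  (forall t : R, 0 < t -> as_upto X L t x (fun w =>
    (\int[leb]_(s in `[0%R, t]) `|f (X s w)|%:E < +oo)%E)) <->
  {ae law X x, forall w, forall t : R, 0 <= t ->
    integrable_upto t (fun s => f (X s w))}.
Proof.
move=> hL mf; split => [h|h t t0]; last first.
  apply/(as_upto_ae _ hE hL (ltW t0)); apply: filterS h => w hw.
  exact: ((path_integrableP X hE w mf (ltW t0)).2 (hw t (ltW t0))).
apply: ae_all_times => [s t w st i s0|t t0].
  by apply: (integrable_uptoS st); apply: i; exact: le_trans st.
have /(as_upto_ae _ hE hL (ltW t0)) := h t t0; apply: filterS => w hw _.
exact: ((path_integrableP X hE w mf (ltW t0)).1 hw).
Qed.

Lemma local_martingale_cst (L : laws R E Omega) x (c : R) :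
  laws_equiv X L x -> local_martingale X L x (fun _ _ => c).
Proof.
move=> hL; have aC : adapted X (fun _ _ => c).
  by apply/adaptedP => t t0; exact: measurable_cst.
have cC : cadlag X L x (fun _ _ => c).
  by apply/(cadlagP hE _ hL); apply: aeW => w t t0; exact: cadlag_cst.
split => //; exists (fun _ _ => +oo%E); split => //.
- move=> n; split => // t t0.
  have -> : [set w : Omega | (+oo <= t%:E)%E] = set0 by apply/seteqP; split.
  exact: sigma_set0 (F_sigma X t).
- move=> t t0; apply/(as_upto_ae _ hE hL t0); apply: aeW => w; exists 0%N.
  exact: leey.
- move=> n; apply: (premartingale_martingale hL) => // t t0.
  exact: premartingale_cst.
Qed.

Lemma normal_ae x : {ae law X x, forall w, X 0 w = x}.
Proof.
have mD : measurable [set w | X 0 w = x].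
  have -> : [set w | X 0 w = x] = X 0 @^-1` [set x] by [].
  rewrite -[X in measurable X]setTI; apply: (measurable_path X (lexx 0)) => //.
  exact: (lusin_measurable1 x hE).
exists (~` [set w | X 0 w = x]); split => //; first exact: measurableC.
by have := probability_setC (law X x) mD; rewrite brp_normal subee// => <-.
Qed.

End densities.

Lemma integral_cst_upto (R : realType) (c t : R) : 0 <= t ->
  (\int[lebesgue_measure]_(s in `[0%R, t]) cst c%:E s = (c * t)%:E)%E.
Proof.
move=> t0; rewrite integral_cst//= lebesgue_measure_itv/= lte_fin.
move: t0; rewrite le_eqVlt => /orP[/eqP <-|->]; first by rewrite ltxx mule0 mulr0.
by rewrite -EFinB subr0 -EFinM.
Qed.

Lemma integrable_upto_cst (R : realType) (c t : R) : 0 <= t ->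
  integrable_upto t (fun=> c).
Proof.
move=> t0; apply/integrableP; split; first exact: measurable_cst.
by rewrite (integral_cst_upto `|c| t0) ltry.
Qed.

Lemma primitive_cst (R : realType) (c t : R) : 0 <= t ->
  primitive (fun=> c) t = c * t.
Proof. by move=> t0; rewrite /primitive /Rintegral (integral_cst_upto c t0). Qed.

(** * Recovery of the short rate, the semigroup and the generator *)

Section recovery.
Context {R : realType} {E : ptopologicalType} {d : measure_display}
  {Omega : measurableType d}.
Variable X : borel_right_process R E Omega.
Local Notation Ft t := (g_sigma_algebraType (F_ X t)).
Local Notation leb := (@lebesgue_measure R).
Variables (S M : R -> Omega -> R) (r pi : E -> R) (lambda : R) (Q Qpi : laws R E Omega).
Hypothesis hE : lusin_space R E.
Hypothesis hS : pricing_kernel X S.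
Hypothesis hM : risk_neutral_factorization X S r M.
Hypothesis hpi : positive_eigenfunction X S lambda pi.
Hypothesis cW : forall x, cadlag X (law_P X) x (eigen_density X S lambda pi).
Hypothesis dQ : has_density X Q M.
Hypothesis dQpi : has_density X Qpi (eigen_density X S lambda pi).

Let W := eigen_density X S lambda pi.
Let h (x : E) := (pi x)^-1.
Let mpi : measurable_fun [set: borel E] pi. Proof. by case: hpi. Qed.
Let pi0 x : 0 < pi x. Proof. by case: hpi. Qed.
Let mr : measurable_fun [set: borel E] r. Proof. by case: hM. Qed.
Let mh : measurable_fun [set: borel E] h.
Proof.
have -> : h = (fun y => pi y `^ (-1)).
  by apply/funext => y; rewrite /h powR_inv1// ltW.
exact: (measurableT_comp (measurable_powR (-1)) mpi).
Qed.
Let h0 x : 0 < h x. Proof. by rewrite invr_gt0. Qed.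

Let S_good x : {ae law X x, forall w,
  [/\ S 0 w = 1, forall t : R, 0 <= t -> 0 < S t w &
      forall t : R, 0 < t -> exists2 l : R, 0 < l & S s w @[s --> t^'-] --> l]}.
Proof. by case: hS. Qed.

Let aS : adapted X S. Proof. by case: hS => -[]. Qed.
Let aM : adapted X M. Proof. by case: hM => _ _ /(_ point)[]. Qed.

Let path_adapted (f : E -> R) (t : R) : measurable_fun [set: borel E] f ->
  0 <= t -> measurable_fun [set: Ft t] (fun w => f (X t w)).
Proof. by move=> mf t0; exact: (progressive_adapted (path_progressive hE mf) t0). Qed.

Let aW : adapted X W.
Proof.
apply/adaptedP => t t0; rewrite /W /eigen_density.
apply: measurable_funM; last exact: (adaptedP X S).1 aS t t0.
apply: measurable_funM => //; apply: measurable_funM; first exact: path_adapted.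
have m0 := Ft_sub t0 (path_adapted mh (lexx 0)).
exact: m0.
Qed.

Let M_pos x : {ae law X x, forall w, forall t : R, 0 <= t -> 0 < M t w}.
Proof. by case: hM => _ _ _ /(_ x) + _; apply: filterS => w []. Qed.

Let W_pos x : {ae law X x, forall w, forall t : R, 0 <= t -> 0 < W t w}.
Proof.
apply: filterS (S_good x) => w [_ Sp _] t t0.
by rewrite /W /eigen_density mulr_gt0 ?Sp// mulr_gt0 ?expR_gt0// divr_gt0.
Qed.

Let hQ x : laws_equiv X Q x.
Proof. exact: (density_laws_equiv aM (M_pos x) dQ). Qed.

Let hQpi x : laws_equiv X Qpi x.
Proof. exact: (density_laws_equiv aW (W_pos x) dQpi). Qed.

Let r_int x : {ae law X x, forall w, forall t : R, 0 <= t ->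
  integrable_upto t (fun s => r (X s w))}.
Proof.
apply/(time_integrableP hE (laws_equiv_P X x) mr) => t t0.
by case: hM => _ + _ _ _; exact.
Qed.

Let drift (x : E) := r x - lambda.
Let mdrift : measurable_fun [set: borel E] drift.
Proof. exact: measurable_funB. Qed.

Let drift_int x : {ae law X x, forall w, forall t : R, 0 <= t ->
  integrable_upto t (fun s => drift (X s w))}.
Proof.
apply: filterS (r_int x) => w ir t t0; apply: RintegrableB => //; first exact: ir.
exact: integrable_upto_cst.
Qed.

Let driftE x t : 0 <= t -> {ae law X x, forall w,
  pint (fun s w => drift (X s w)) t w = time_integral X r t w - lambda * t}.
Proof.
move=> t0; apply: filterS (r_int x) => w ir.
have h1 : primitive (fun s => r (X s w) + - lambda) t =
    primitive (fun s => r (X s w)) t + primitive (fun=> - lambda) t.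
  by apply: primitiveD; [exact: ir|exact: integrable_upto_cst].
by rewrite [LHS]h1 primitive_cst// mulNr.
Qed.

Let Ndrift (x : E) := lambda - r x.
Let mNdrift : measurable_fun [set: borel E] Ndrift.
Proof. exact: measurable_funB. Qed.

Let Ndrift_int x : {ae law X x, forall w, forall t : R, 0 <= t ->
  integrable_upto t (fun s => Ndrift (X s w))}.
Proof.
apply: filterS (r_int x) => w ir t t0; apply: RintegrableB => //; last exact: ir.
exact: integrable_upto_cst.
Qed.

Let NdriftE x t : 0 <= t -> {ae law X x, forall w,
  pint (fun s w => Ndrift (X s w)) t w = - (time_integral X r t w - lambda * t)}.
Proof.
move=> t0; apply: filterS (r_int x) => w ir.
have h1 : primitive (fun s => lambda + -1 * r (X s w)) t =
    primitive (fun=> lambda) t + primitive (fun s => -1 * r (X s w)) t.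
  apply: primitiveD; first exact: integrable_upto_cst.
  by apply: RintegrableZ => //; exact: ir.
transitivity (primitive (fun s => lambda + -1 * r (X s w)) t).
  by apply: eq_primitive => s _; rewrite /Ndrift mulN1r.
rewrite h1 primitive_cst// primitiveZ; last exact: ir.
by rewrite mulN1r opprB.
Qed.

(** Equates the two factorizations of S; normality turns pi (X_0) into the constant pi x. *)
Let eigen_relation x t : 0 <= t -> {ae law X x, forall w,
  W t w = expR (- (time_integral X r t w - lambda * t)) * pi (X t w) / pi x * M t w}.
Proof.
move=> t0; have SM : {ae law X x, forall w,
    S t w = expR (- time_integral X r t w) * M t w}.
  by case: hM => _ _ _ _; exact.
apply: filterS2 SM (normal_ae X hE x) => w SE X0.
rewrite /W /eigen_density X0 SE opprB expRD; ring.
Qed.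

Let adapted_progressive Y : progressive X Y -> adapted X Y.
Proof.
by move=> pY; apply/adaptedP => t t0; exact: progressive_adapted pY t0.
Qed.

Let p_exp (f kappa : E -> R) (c : R) : measurable_fun [set: borel E] f ->
  measurable_fun [set: borel E] kappa ->
  progressive X (fun t w => expR (pint (fun s w => f (X s w)) t w) * kappa (X t w) / c).
Proof.
move=> mf mk.
have p1 : progressive X (fun s w => expR (pint (fun s w => f (X s w)) s w)).
  apply: (progressive_comp (@measurable_expR R)); apply: progressive_pint.
  exact: path_progressive.
have p2 := progressiveM p1 (path_progressive hE mk).
exact: (progressiveM p2 (progressive_cst c^-1)).
Qed.

Let Q_density x t A : 0 <= t -> F_ X t A -> Q t x A =
  (\int[Qpi t x]_(w in A)
    (expR (pint (fun s w => drift (X s w)) t w) * h (X t w) / h x)%:E)%E.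
Proof.
apply: (density_ratio aM aW (adapted_progressive (p_exp (h x) mdrift mh)) (W_pos x) dQ dQpi).
move=> {}t t0; apply: filterS2 (driftE x t0) (eigen_relation x t0) => w -> ->.
rewrite expRN /h; field.
by rewrite !gt_eqF ?expR_gt0.
Qed.

Let Qpi_density x t A : 0 <= t -> F_ X t A -> Qpi t x A =
  (\int[Q t x]_(w in A)
    (expR (pint (fun s w => Ndrift (X s w)) t w) * pi (X t w) / pi x)%:E)%E.
Proof.
apply: (density_ratio aW aM (adapted_progressive (p_exp (pi x) mNdrift mpi)) (M_pos x) dQpi dQ).
by move=> {}t t0; apply: filterS2 (NdriftE x t0) (eigen_relation x t0) => w -> ->.
Qed.

Let S_cadlag x : {ae law X x, forall w, forall t : R, 0 <= t -> cadlag_upto t (S ^~ w)}.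
Proof.
have [_ /(_ x)[L [A [[_ cL _] [_ cA _] SE]]]] : semimartingale X (law_P X) S by case: hS.
have hP := laws_equiv_P X x.
have {}SE : {ae law X x, forall w, forall t : R, forall s : R, 0 <= s <= t ->
    S s w = S 0 w + L s w + A s w}.
  apply: ae_all_times => [s t w st h' v /andP[v0 vs]|t /ltW t0].
    by apply: h'; rewrite v0 (le_trans vs).
  exact: (as_upto_ae _ hE hP t0).1 (SE t t0).
apply: filterS3 SE ((cadlagP hE _ hP).1 cL) ((cadlagP hE _ hP).1 cA) => w SEw cLw cAw t t0.
apply: cadlag_eq (cadlagD (cadlagD (cadlag_cst t (S 0 w)) (cLw t t0)) (cAw t t0)).
by move=> s sI; rewrite (SEw t s sI).
Qed.

Let W_cadlag x : {ae law X x, forall w, forall t : R, 0 <= t -> cadlag_upto t (W ^~ w)}.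
Proof. exact: (cadlagP hE _ (laws_equiv_P X x)).1 (cW x). Qed.

Let exp_cadlag (c t : R) : cadlag_upto t (fun s => expR (c * s)).
Proof.
apply: (@cadlag_comp R t expR (fun s => c * s)); first exact: continuous_expR.
apply: continuous_cadlag; apply: continuous_subspaceT => s.
by apply: cvgM; [exact: cvg_cst|exact: cvg_id].
Qed.

(** pi (X) is W / S up to an exponential and a constant factor, and 1 / S is cadlag because the
    kernel has positive left limits. *)
Let pi_cadlag x : {ae law X x, forall w, forall t : R, 0 <= t ->
  cadlag_upto t (fun s => pi (X s w))}.
Proof.
apply: filterS3 (S_good x) (S_cadlag x) (W_cadlag x) => w [_ Sp Sl] cS cWw t t0.
have cV : cadlag_upto t (fun s => (S s w)^-1).
  apply: cadlagV (cS t t0) => s /andP[s0 _]; first by rewrite gt_eqF// Sp.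
  by have [l l0 Hl] := Sl s s0; exists l => //; rewrite gt_eqF.
apply: cadlag_eq (cadlagM (cadlagM (cWw t t0) cV)
  (cadlagM (exp_cadlag (- lambda) t) (cadlag_cst t (pi (X 0 w))))) => s /andP[s0 _].
rewrite /W /eigen_density mulNr expRN; field.
by rewrite !gt_eqF ?expR_gt0 ?Sp.
Qed.

(** h (X) is S / W up to an exponential and a constant factor. That W has positive left limits is
    [positive_left_limits] with Q^pi as the law of density W. *)
Let h_cadlag x : {ae law X x, forall w, forall t : R, 0 <= t ->
  cadlag_upto t (fun s => h (X s w))}.
Proof.
have Wl := positive_left_limits (hQpi x) ((adaptedP X W).1 aW)
  (fun s A s0 FA => dQpi.1 s x A s0 FA) (W_pos x) (W_cadlag x).
apply: filterS3 (filterI (W_pos x) Wl) (filterI (S_good x) (S_cadlag x)) (W_cadlag x).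
move=> w [Wp {}Wl] [[_ Sp _] cS] cWw t t0.
have cV : cadlag_upto t (fun s => (W s w)^-1).
  apply: cadlagV (cWw t t0) => s /andP[s0 _]; first by rewrite gt_eqF// Wp.
  by have [l l0 Hl] := Wl s s0; exists l => //; rewrite gt_eqF.
apply: cadlag_eq (cadlagM (cadlagM cV (cS t t0))
  (cadlagM (exp_cadlag lambda t) (cadlag_cst t (h (X 0 w))))) => s /andP[s0 _].
rewrite /W /eigen_density /h; field.
by rewrite !gt_eqF ?expR_gt0 ?Sp.
Qed.

(** The version of G^pi h obtained by solving the recovery formula for it. *)
Let gh (y : E) : R := (lambda - r y) * h y.
Let mgh : measurable_fun [set: borel E] gh.
Proof. exact: measurable_funM. Qed.

Let gh_int_lm x : {ae law X x, forall w, forall t : R, 0 <= t ->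
    integrable_upto t (fun s => gh (X s w))} /\
  local_martingale X Qpi x (fun t w => h (X t w) - time_integral X gh t w).
Proof.
have m1 : measurable_fun [set: borel E] (fun=> 1 : R) by exact: measurable_cst.
have m0 : measurable_fun [set: borel E] (fun=> 0 : R) by exact: measurable_cst.
have i0 : {ae law X x, forall w, forall t : R, 0 <= t ->
    integrable_upto t (fun s => (fun=> 0 : R) (X s w))}.
  by apply: aeW => w t t0; exact: integrable_upto_cst.
have lm : local_martingale X Q x
    (fun t w => (fun=> 1 : R) (X t w) - time_integral X (fun=> 0) t w).
  have -> : (fun t w => (fun=> 1 : R) (X t w) - time_integral X (fun=> 0) t w) = (fun _ _ => 1).
    by apply/funext => t; apply/funext => w; rewrite /time_integral /Rintegral integral0 subr0.
  exact: local_martingale_cst.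
have qE : {ae law X x, forall w, forall t : R, 0 <= t ->
    {ae leb, forall s, 0 <= s <= t -> gh (X s w) =
      h (X s w) * ((fun=> 0 : R) (X s w) - drift (X s w) * (fun=> 1 : R) (X s w))}}.
  by apply: aeW => w t t0; apply: aeW => s _; rewrite /gh /drift; ring.
have G := girsanov hE (hQ x) (hQpi x) mh mdrift m1 m0 mgh h0 (drift_int x) i0
  (@Q_density x) (h_cadlag x) lm qE.
have GI := girsanov_integrable hE (hQ x) mh m1 mgh (drift_int x) i0
  (h_cadlag x) lm qE.
split; first exact: GI.
by under eq_fun do under eq_fun do rewrite -[h _]mulr1.
Qed.

Lemma short_rate_generator : extended_generator X Qpi h gh.
Proof.
split => // x; last by have [] := gh_int_lm x.
by apply: (time_integrableP hE (hQpi x) mgh).2; have [] := gh_int_lm x.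
Qed.

Lemma short_rate_unique g : extended_generator X Qpi h g ->
  forall x, {ae law X x, forall w, forall t : R, 0 <= t ->
    {ae leb, forall s, 0 <= s <= t -> g (X s w) = gh (X s w)}}.
Proof.
move=> [_ mg ig lg] x; have [igh lgh] := gh_int_lm x.
exact: (generator_unique hE (hQpi x) mh mg mgh
  ((time_integrableP hE (hQpi x) mg).1 (ig x)) igh (lg x) lgh).
Qed.

Lemma short_rate_recovered g : extended_generator X Qpi h g ->
  eq_off_zero_time X Qpi r (fun x => lambda - g x / h x).
Proof.
move=> hg x t t0; apply: (as_upto_ae _ hE (hQpi x) t0).2.
apply: filterS (short_rate_unique hg x) => w /(_ t t0); apply: lebesgue_aeS => s gs sI.
rewrite (gs sI) /gh; field.
by rewrite gt_eqF.
Qed.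

Lemma risk_neutral_semigroup (t : R) (f : E -> R) x : 0 <= t ->
  measurable_fun [set: borel E] f ->
  transition_operator X Q t f x =
  ((pi x)%:E * \int[Qpi t x]_w (expR (time_integral X r t w - lambda * t) *
    (f (X t w) / pi (X t w)))%:E)%E.
Proof.
move=> t0 mf; rewrite /transition_operator.
pose Z w := expR (pint (fun s w => drift (X s w)) t w) * h (X t w) / h x.
have mZ : measurable_fun [set: Ft t] Z.
  exact: (progressive_adapted (p_exp (h x) mdrift mh) t0).
have Z0 w : 0 <= Z w by rewrite /Z divr_ge0 ?mulr_ge0 ?expR_ge0 ?ltW.
have FT : F_ X t setT by exact: sigma_setT (F_sigma X t).
rewrite (@density_integral _ _ _ _ X (Q t x) (Qpi t x) t Z mZ Z0 _ _ _
  (path_adapted mf t0) FT); last by move=> A FA; exact: Q_density.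
pose V w := expR (time_integral X r t w - lambda * t) * (f (X t w) / pi (X t w)).
have mtime : measurable_fun setT (time_integral X r t).
  apply: (@Ft_id _ _ _ _ X t).
  exact: (progressive_adapted (progressive_pint (path_progressive hE mr)) t0).
have mXt (k : E -> R) : measurable_fun [set: borel E] k -> measurable_fun setT (fun w => k (X t w)).
  by move=> mk; apply: (@Ft_id _ _ _ _ X t); exact: path_adapted.
have mV : measurable_fun setT V.
  apply: measurable_funM; last by apply: measurable_funM; [exact: mXt|exact: (mXt h)].
  by apply: measurableT_comp; [exact: measurable_expR|exact: measurable_funB].
transitivity (\int[Qpi t x]_w ((pi x)%:E * (V w)%:E))%E.
  apply: ae_eq_integral => //.
  - apply/measurable_EFinP; apply: measurable_funM; last exact: mXt.
    exact: Ft_id mZ.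
  - by apply/measurable_EFinP; apply: measurable_funM.
  - apply: (ae_law hE (hQpi x) t0); apply: filterS (driftE x t0) => w dE _.
    rewrite /Z /V dE -EFinM; congr EFin; rewrite /h; field.
    by rewrite !gt_eqF.
(* f (X_t) need not be integrable, so pi x is pulled out of positive and negative parts separately;
   the rule for c (a - b) holds also when both are infinite. *)
have posB (c : R) (a b : \bar R) : (0 < c)%R -> (0 <= a)%E -> (0 <= b)%E ->
    (c%:E * a - c%:E * b = c%:E * (a - b))%E.
  move=> c0; case: a => [a| |] //; case: b => [b| |] // _ _.
  - by rewrite -!EFinM -!EFinB mulrBr.
  - by rewrite gt0_muley// addeNy gt0_muleNy.
  - by rewrite gt0_muley//= gt0_muley.
  - by rewrite gt0_muley// addeNy gt0_muleNy.
have mVE : measurable_fun setT (fun w => (V w)%:E) by exact/measurable_EFinP.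
rewrite integralE [in RHS]integralE (ge0_funeposM _ (ltW (pi0 x))) (ge0_funenegM _ (ltW (pi0 x))).
rewrite !ge0_integralZl_EFin ?ltW//; last 2 first.
- exact: measurable_funeneg.
- exact: measurable_funepos.
by apply: posB => //; exact: integral_ge0.
Qed.

Lemma risk_neutral_generator (f g gf gfh : E -> R) :
  extended_generator X Qpi h g -> extended_generator X Qpi f gf ->
  extended_generator X Qpi (fun x => f x * h x) gfh ->
  extended_generator X Q f (fun x => gf x + carre_du_champ h f g gf gfh x / h x).
Proof.
move=> hg [mf mgf _ _] [mfh mgfh igfh lfh].
have [_ mg _ _] := hg.
set q := fun x => gf x + carre_du_champ h f g gf gfh x / h x.
have mq : measurable_fun [set: borel E] q.
  have -> : q = (fun y => gf y + carre_du_champ h f g gf gfh y * pi y).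
    by apply/funext => y; rewrite /q /h invrK.
  apply: measurable_funD => //; apply: measurable_funM => //.
  by apply: measurable_funB; [apply: measurable_funB => //|]; exact: measurable_funM.
have ifh x := (time_integrableP hE (hQpi x) mgfh).1 (igfh x).
have qE x : {ae law X x, forall w, forall t : R, 0 <= t ->
    {ae leb, forall s, 0 <= s <= t -> q (X s w) =
      pi (X s w) * (gfh (X s w) - Ndrift (X s w) * (f (X s w) * h (X s w)))}}.
  (* Off a set of zero time the given version of G^pi h is (lambda - r) h. Then [gf] cancels, and
     what remains is kappa (g - a u) with kappa = pi, a = lambda - r and u = f h. *)
  apply: filterS (short_rate_unique hg x) => w gE t t0.
  apply: lebesgue_aeS (gE t t0) => s gs sI.
  rewrite /q /carre_du_champ (gs sI) /gh /h /Ndrift; field.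
  by rewrite gt_eqF.
split => // x.
  apply: (time_integrableP hE (hQ x) mq).2.
  exact: (girsanov_integrable hE (hQpi x) mpi mfh mq (Ndrift_int x) (ifh x)
    (pi_cadlag x) (lfh x) (qE x)).
have := girsanov hE (hQpi x) (hQ x) mpi mNdrift mfh mgfh mq pi0 (Ndrift_int x) (ifh x)
  (@Qpi_density x) (pi_cadlag x) (lfh x) (qE x).
congr local_martingale; apply/funext => t; apply/funext => w; congr (_ - _).
by rewrite mulrC /h mulfVK// gt_eqF.
Qed.

End recovery.

Theorem theorem4p1 (R : realType) (E : ptopologicalType)
    (d : measure_display) (Omega : measurableType d)
    (X : borel_right_process R E Omega)
    (S M : R -> Omega -> R) (r pi : E -> R) (lambda : R)
    (Q Qpi : laws R E Omega) :
  lusin_space R E ->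
  pricing_kernel X S ->
  risk_neutral_factorization X S r M ->
  positive_eigenfunction X S lambda pi ->
  (forall x, cadlag X (law_P X) x (eigen_density X S lambda pi)) ->
  has_density X Q M ->
  has_density X Qpi (eigen_density X S lambda pi) ->
  let h := fun x => (pi x)^-1 in
  [/\ (* (1) *)
      (exists gh, extended_generator X Qpi h gh) /\
      (forall gh, extended_generator X Qpi h gh ->
         eq_off_zero_time X Qpi r (fun x => lambda - gh x / h x)),
      (* (2) *)
      forall (t : R) (f : E -> R) (x : E), 0 <= t ->
        measurable_fun [set: borel E] f ->
        transition_operator X Q t f x =
        ((pi x)%:E *
         \int[Qpi t x]_w (expR (time_integral X r t w - lambda * t) *
                          (f (X t w) / pi (X t w)))%:E)%E &
      (* (3) *)
      forall f gh gf gfh : E -> R,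
        extended_generator X Qpi h gh ->
        extended_generator X Qpi f gf ->
        extended_generator X Qpi (fun x => f x * h x) gfh ->
        extended_generator X Q f
          (fun x => gf x + carre_du_champ h f gh gf gfh x / h x)].
Proof.
move=> hE hS hM hpi cW dQ dQpi h; split.
- split; first by eexists; exact: (short_rate_generator hE hS hM hpi cW dQ dQpi).
  exact: (short_rate_recovered hE hS hM hpi cW dQ dQpi).
- by move=> t f x t0 mf; exact: (risk_neutral_semigroup hE hS hM hpi dQ dQpi).
- exact: (risk_neutral_generator hE hS hM hpi cW dQ dQpi).
Qed.
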